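(* Let $w:\mathbb R\to(-\infty,0]$ satisfy Assumption (A) given in the context, with $\operatorname{supp}w=[-s_w,s_w]$ and $\Delta:=-\inf w=-w(0)$. Suppose in addition that $w$ is $C^3$ on $[-r_w,r_w]$ for some $r_w\in(0,s_w]$ and that there exist $\delta_w\in(0,s_w)$ and $\tau>0$ such that $$w(z)\le\tau\,(z-s_w)\quad\text{for all }z\in[\delta_w,s_w].$$ Let $K\ge3$ be a natural number, let $\gamma>0$, $\ell>0$, and fix $j\in\{2,\dots,K-1\}$. Let positions $X^{(1)}<\dots<X^{(K)}$ in $\mathbb R$ and masses $m^{(1)},\dots,m^{(K)}\in(0,1)$ be given with $\sum_{k=1}^Km^{(k)}=1$ and $X^{(k+1)}-X^{(k)}>2s_w\ell$ for all $k=1,\dots,K-1$. Let $\alpha\in(0,s_w)$ satisfy $$\frac{|w(\alpha)|}{\Delta}<\min\left\{\frac{m^{(j)}}{m^{(j-1)}},\frac{m^{(j)}}{m^{(j+1)}}\right\}$$ and define $a:=X^{(j-1)}+\alpha\ell$ and $b:=X^{(j+1)}-\alpha\ell$. Define $$\rho:=\sum_{k=1}^Km^{(k)}g(\cdot\,;X^{(k)},\sigma_k^2),\qquad\sigma_k^2:=\frac{\ell}{\gamma w''(0)m^{(k)}},$$ and the effective potential $V_{\rm eff}:=\left(\gamma\ell\,w(\cdot/\ell)\right)\ast\rho$ on $\mathbb R$. Let $(X_t)_{t\ge0}$ be the diffusion on $\mathbb R$ solving $dX_t=-V_{\rm eff}'(X_t)\,dt+\sqrt2\,dB_t$, and let $\tau_{a,b}:=\inf\{t\ge0:X_t\in(-\infty,a]\cup[b,\infty)\}$.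 Fix $x_0\in(X^{(j)}-s_w\ell,X^{(j)}+s_w\ell)$. Then, as $\gamma\to\infty$ (all of $w,\ell,K,j,\alpha,x_0$, the positions $X^{(k)}$ and the masses $m^{(k)}$ being fixed), $$\mathbb E[\tau_{a,b}\mid X_0=x_0]\sim\frac{\left(X^{(j+1)}-X^{(j)}-2s_w\ell\right)\left(X^{(j)}-X^{(j-1)}-2s_w\ell\right)}{X^{(j+1)}-X^{(j-1)}-4s_w\ell}\sqrt{\frac{2\pi\ell}{\gamma w''(0)m^{(j)}}}\;e^{\gamma\ell\Delta m^{(j)}-\frac12},$$ and $$\mathbb P[\tau_a<\tau_b\mid X_0=x_0]\sim p^{(j)}:=\frac{X^{(j+1)}-X^{(j)}-2s_w\ell}{X^{(j+1)}-X^{(j-1)}-4s_w\ell},$$ where $\tau_a,\tau_b$ denote the first hitting times of $a$ and $b$ by $(X_t)$.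
   Context: Assumption (A) on $w:\mathbb R\to(-\infty,0]$: (i) $w$ is even, Lipschitz continuous, and non-decreasing on $[0,\infty)$; (ii) $w$ has compact support, there is $s_w\in[0,\infty)$ with $\operatorname{supp}w=[-s_w,s_w]$, and $w\le 0$; (iii) $w$ is $C^2$ in a neighbourhood of $0$ and attains its global minimum at $0$, with $w''(0)>0$. $g(\cdot\,;\mu,\sigma^2)$ is the density of the one-dimensional Gaussian distribution with mean $\mu$ and variance $\sigma^2$; $\ast$ is convolution on $\mathbb R$ (no periodization); $(B_t)$ is a standard one-dimensional Brownian motion; $f\sim h$ as $\gamma\to\infty$ means $\lim_{\gamma\to\infty}f/h=1$. *)

(* Defs.v *)
From HB Require Import structures.
From mathcomp Require Import all_boot all_order all_algebra.
From mathcomp Require Import all_classical all_reals all_analysis.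

Set Implicit Arguments.
Unset Strict Implicit.
Unset Printing Implicit Defensive.

Import Order.TTheory GRing.Theory Num.Theory.
Import numFieldNormedType.Exports.

Local Open Scope ring_scope.
Local Open Scope classical_set_scope.

Definition support_of {R : realType} (f : R -> R) : set R :=
  closure [set x | f x != 0].

Definition assumption_A {R : realType} (w : R -> R) (s_w : R) : Prop :=
  [/\ [/\ forall x, w (- x) = w x,
          lipschitz w
        & {in `[0, +oo[ &, {homo w : x y / x <= y}}],
      [/\ compact (support_of w),
          0 <= s_w,
          support_of w = `[- s_w, s_w]
        & forall x, w x <= 0]
    & [/\ \forall x \near (0 : R),
            [/\ derivable w x 1, derivable w^`() x 1
              & {for x, continuous w^`(2)}],
          forall x, w 0 <= w x
        & 0 < w^`(2) 0]].

(* C^n regularity on a set A without isolated points (for instance a closed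
   interval): difference quotients are taken inside A, so derivatives at the
   end-points of a closed interval are one-sided. *)
Definition Cn_on {R : realType} (n : nat) (A : set R) (f : R -> R) : Prop :=
  exists D : nat -> R -> R,
    [/\ forall x, A x -> D 0%N x = f x,
        forall k, (k < n)%N -> forall x, A x ->
          (D k y - D k x) / (y - x) @[y --> within A x^'] --> D k.+1 x
      & {within A, continuous (D n)}].

(* The Gaussian density is parametrised by its variance v, whereas the
   library's [normal_pdf] takes the standard deviation. *)
Definition gauss {R : realType} (mu v x : R) : R :=
  normal_pdf mu (Num.sqrt v) x.

Definition convolution {R : realType} (f h : R -> R) (x : R) : R :=
  \int[@lebesgue_measure R]_y (f (x - y) * h y).

Definition sigma2 {R : realType} (w : R -> R) (ell gamma m : R) : R :=
  ell / (gamma * w^`(2)%classic 0 * m).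

Definition rho {R : realType} (w : R -> R) (ell : R) (K : nat)
    (X m : nat -> R) (gamma x : R) : R :=
  \sum_(1 <= k < K.+1) m k * gauss (X k) (sigma2 w ell gamma (m k)) x.

Definition V_eff {R : realType} (w : R -> R) (ell : R) (K : nat)
    (X m : nat -> R) (gamma : R) : R -> R :=
  convolution (fun x => gamma * ell * w (x / ell)) (rho w ell K X m gamma).

(* Processes are families indexed by R, of which only the times t >= 0 are
   meaningful. *)

Definition filtration {R : realType} {d : measure_display}
    {Omega : measurableType d} (F : R -> set (set Omega)) : Prop :=
  [/\ forall t, 0 <= t -> sigma_algebra setT (F t),
      forall t, 0 <= t -> F t `<=` measurable
    & forall s t, 0 <= s -> s <= t -> F s `<=` F t].

Definition adapted {R : realType} {d : measure_display}
    {Omega : measurableType d} (F : R -> set (set Omega))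
    (Y : R -> Omega -> R) : Prop :=
  forall t, 0 <= t -> forall C : set R, measurable C -> F t (Y t @^-1` C).

Definition brownian_motion {R : realType} {d : measure_display}
    {Omega : measurableType d} (P : probability Omega R)
    (F : R -> set (set Omega)) (B : R -> Omega -> R) : Prop :=
  [/\ adapted F B,
      {ae P, forall omega, B 0 omega = 0},
      {ae P, forall omega, {within `[0, +oo[, continuous (B ^~ omega)}},
      forall s t, 0 <= s -> s < t -> forall C : set R, measurable C ->
        P ((B t \- B s) @^-1` C) = normal_prob 0 (Num.sqrt (t - s)) C
    & forall s t, 0 <= s -> s < t ->
        forall (A : set Omega) (C : set R), F s A -> measurable C ->
        P (A `&` (B t \- B s) @^-1` C) = (P A * P ((B t \- B s)%R @^-1` C))%E].

(* Y is a (weak) solution of dY_t = - V'(Y_t) dt + sqrt 2 dB_t, Y_0 = y0.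
   The noise being additive, the stochastic integral is sqrt 2 * B_t. *)
Definition langevin_solution {R : realType} {d : measure_display}
    {Omega : measurableType d} (P : probability Omega R)
    (F : R -> set (set Omega)) (B : R -> Omega -> R)
    (V : R -> R) (y0 : R) (Y : R -> Omega -> R) : Prop :=
  [/\ filtration F /\ brownian_motion P F B,
      adapted F Y,
      forall omega, {within `[0, +oo[, continuous (Y ^~ omega)},
      {ae P, forall omega, Y 0 omega = y0}
    & {ae P, forall omega, forall t, 0 <= t ->
        (@lebesgue_measure R).-integrable `[0, t]
          (fun s => (V^`()%classic (Y s omega))%:E) /\
        Y t omega = Y 0 omega
          - (\int[@lebesgue_measure R]_(s in `[0, t]) V^`()%classic (Y s omega))
          + Num.sqrt 2 * B t omega}].

(* Equal to +oo on the paths that never visit A. *)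
Definition hitting_time {R : realType} {d : measure_display}
    {Omega : measurableType d} (Y : R -> Omega -> R) (A : set R)
    (omega : Omega) : \bar R :=
  ereal_inf [set t%:E | t in [set t : R | 0 <= t /\ A (Y t omega)]].

Definition asymp_equiv {R : realType} (f : R -> \bar R) (h : R -> R) : Prop :=
  (f gamma / (h gamma)%:E)%E @[gamma --> +oo] --> 1%:E.

(* Main.v *)
From HB Require Import structures.
From mathcomp Require Import all_boot all_order all_algebra.
From mathcomp Require Import all_classical all_reals all_analysis.
From mathcomp Require Import measurable_realfun.
From mathcomp Require Import ring lra zify.
Require Import Defs.

Set Implicit Arguments.
Unset Strict Implicit.
Unset Printing Implicit Defensive.

Import Order.TTheory GRing.Theory Num.Theory.
Import numFieldNormedType.Exports.

Local Open Scope ring_scope.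
Local Open Scope classical_set_scope.

(** The exit problem of dX = - V'(X) dt + sqrt 2 dB from ]a, b[ has an explicit
    solution.  With the scale function S(x) = int_a^x exp V, the speed mass
    M(x) = int_a^x exp (- V) and T(x) = int_a^x exp(V) M, one has
      E tau = T(b) S(x0) / S(b) - T(x0)   and   P[tau_a < tau_b] = 1 - S(x0) / S(b),
    and the theorem is the asymptotics of these three integrals for V = V_eff.

    Asymptotics.  The function w vanishes outside [- s_w, s_w] and the Gaussian
    clumps have a width of order gamma^(-1/2), so that for large gamma a particle
    feels a clump only at distance less than s_w * ell.  On [a, b] the function
    exp V therefore tends to 1 on the two gaps that separate the middle clump
    from its neighbours, and to 0 on the wells ([expV_cvg]): S(b) tends to the
    total length of the gaps and S(x0) to that of the left one.  On the other
    hand exp (- V) concentrates at the bottom X j of the middle well, where its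
    mass is given by Laplace's method ([laplace_cvg]): the neighbouring wells are
    cut by a and b at a depth that the condition on the masses keeps strictly
    below the depth of the middle one ([boltzmann_rest]).  Dividing by this mass,
    M tends to the indicator function of the points to the right of X j, so T(b)
    tends to the length of the right gap and T(x0) to 0 ([scale_speed_cvg]).  The
    factor exp (- 1 / 2) is an effect of the convolution: averaging w over a
    Gaussian of variance eps^2 raises its minimum by about w''(0) eps^2 / 2, and
    the variance of the clump is such that this amounts to 1 / 2 in V
    ([smoothing_laplace], [scaledE]).

    Exit problem.  The noise is additive, so no stochastic integral is needed.
    Let u'' - V' u' = - c on ]a, b[.  Along a grid of mesh h the increments of
    u(X), taken as long as the path has not left ]a, b[, are expanded to second
    order in the increment of B; whether the path has left is known at the
    beginning of each step, so that independence kills the terms in xi and in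
    xi^2 - h, and the remainders add up to O(sqrt h) ([euler_step_mean]).  Letting
    h tend to 0 gives
      E[c (t /\ tau) + u(X_(t /\ tau))] = u(x0)   ([dynkin_formula]),
    and letting t tend to infinity, with c = 1 and u = 0 at a and b, then with
    c = 0 and u = 1 at a and 0 at b, gives the two formulas above
    ([exit_time_finite_and_mean], [exit_left_probability]). *)

(** * Gaussian integrals *)

Section gaussian.
Context {R : realType}.
Local Notation mu := (@lebesgue_measure R).
Implicit Types (a b s : R).

Lemma measurable_affine a b : measurable_fun setT (fun x : R => a * x + b).
Proof. by apply: measurable_funD => //; exact: measurable_funM. Qed.

Lemma affine_preimage_ocitv a b (u v : R) : a != 0 ->
  (mu ((fun x : R => a * x + b)%R @^-1` `]u, v]) = (`|a|^-1)%:E * mu `]u, v])%E.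
Proof.
move=> a0; have [a_gt0|a_lt0|a_eq0] := ltgtP 0 a; last by rewrite a_eq0 eqxx in a0.
  have -> : (fun x : R => a * x + b) @^-1` `]u, v] =
            `](u - b) / a, (v - b) / a]%classic.
    apply/seteqP; split => x /=; rewrite !in_itv/= ltr_pdivrMr// ler_pdivlMr//;
    rewrite ltrBlDr lerBrDr mulrC //.
  rewrite !lebesgue_measure_itv/= !lte_fin ltr_pM2r ?invr_gt0// ltrD2r gtr0_norm//.
  case: ifPn => uv; last by rewrite mule0.
  by rewrite -!EFinB -EFinM; congr EFin; field.
have -> : (fun x : R => a * x + b) @^-1` `]u, v] =
          `[(v - b) / a, (u - b) / a[%classic.
  apply/seteqP; split => x /=; rewrite !in_itv/= ltr_ndivlMr// ler_ndivrMr//;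
  by rewrite ltrBlDr lerBrDr mulrC andbC.
rewrite !lebesgue_measure_itv/= !lte_fin ltr_nM2r ?invr_lt0// ltrD2r ltr0_norm//.
case: ifPn => uv; last by rewrite mule0.
by rewrite -!EFinB -EFinM; congr EFin; field.
Qed.

Lemma ge0_integral_affine a b (f : R -> \bar R) : a != 0 ->
  measurable_fun setT f -> (forall x, 0 <= f x)%E ->
  (\int[mu]_x f x = `|a|%:E * \int[mu]_x f (a * x + b)%R)%E.
Proof.
move=> a0 mf f0.
pose k : {nonneg R} := NngNum (normr_ge0 a).
pose phi (x : R) : measurableTypeR R := a * x + b.
have mphi : measurable_fun (setT : set (measurableTypeR R)) phi by exact: measurable_affine.
pose nu0 : {measure set (measurableTypeR R) -> \bar R} :=
  measure_function_pushforward__canonical__measure_function_Measure mu mphi.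
pose nu := mscale k nu0.
rewrite (@eq_measure_integral _ _ _ _ nu).
  by rewrite ge0_integral_mscale//= ge0_integral_pushforward.
move=> A mA _; apply: (@lebesgue_measure_unique R nu) => //= _ [[u v] _ <-] /=.
rewrite /nu/= /mscale/= /pushforward affine_preimage_ocitv// muleA -EFinM divff ?mul1e//.
by rewrite normr_eq0.
Qed.

(** By uniqueness of the Radon-Nikodym derivative of the normal law. *)
Lemma ge0_integral_normal_prob m s (f : R -> \bar R) :
  measurable_fun setT f -> (forall x, 0 <= f x)%E ->
  (\int[normal_prob m s]_x f x = \int[mu]_x (f x * (normal_pdf m s x)%:E))%E.
Proof.
move=> mf f0; pose dom := @normal_prob_dominates R m s.
rewrite -(Radon_Nikodym_SigmaFinite.change_of_variables dom)//.
have mh : measurable_fun setT (Radon_Nikodym_SigmaFinite.f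
  (normal_prob m s) (@lebesgue_measure R)).
  exact: (measurable_int _ (Radon_Nikodym_SigmaFinite.f_integrable dom)).
have mp : measurable_fun setT (fun x => (normal_pdf m s x)%:E).
  by apply/measurable_EFinP; exact: measurable_normal_pdf.
apply: ae_eq_integral => //.
- exact: emeasurable_funM.
- exact: emeasurable_funM.
- apply: ae_eqe_mul2l; apply: integral_ae_eq => //.
    exact: Radon_Nikodym_SigmaFinite.f_integrable.
  by move=> A _ mA; rewrite -(Radon_Nikodym_SigmaFinite.f_integral dom).
Qed.

Lemma normal_pdf_affine m s x : s != 0 ->
  `|s| * normal_pdf m s (s * x + m) = normal_pdf 0 1 x.
Proof.
move=> s0; rewrite !normal_pdfE ?oner_eq0// /normal_peak /normal_fun mulrA; congr (_ * _).
  rewrite -mulrnAr sqrtrM ?sqr_ge0// sqrtr_sqr invfM mulrA divff ?normr_eq0// mul1r.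
  by rewrite expr1n mul1r.
by congr expR; rewrite expr1n addrK subr0; field.
Qed.

Lemma ge0_integral_normal_std m s (f : R -> \bar R) : s != 0 ->
  measurable_fun setT f -> (forall x, 0 <= f x)%E ->
  (\int[normal_prob m s]_x f x = \int[normal_prob 0%R 1%R]_x f (s * x + m)%R)%E.
Proof.
move=> s0 mf f0; have mfa : measurable_fun setT (fun x : R => f (s * x + m)%R).
  exact (measurableT_comp mf (measurable_affine s m)).
rewrite (ge0_integral_normal_prob m s mf f0).
rewrite (ge0_integral_normal_prob 0 1 mfa (fun x => f0 _)).
rewrite (ge0_integral_affine m s0); last 2 first.
- apply: emeasurable_funM => //.
  by apply/measurable_EFinP; exact: measurable_normal_pdf.
- by move=> x; rewrite mule_ge0// lee_fin normal_pdf_ge0.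
rewrite -ge0_integralZl//.
- apply: eq_integral => x _; rewrite -(normal_pdf_affine m x s0) EFinM.
  by rewrite muleCA.
- apply: emeasurable_funM => //; apply/measurable_EFinP.
  exact (measurableT_comp (measurable_normal_pdf m s) (measurable_affine s m)).
- by move=> x _; rewrite mule_ge0// lee_fin normal_pdf_ge0.
Qed.

End gaussian.

Section gaussian_moments.
Context {R : realType}.
Local Notation mu := (@lebesgue_measure R).
Local Notation p := (@normal_pdf R 0 1).
Local Notation std := (@normal_prob R 0 1).

Lemma std_pdfE x : p x = normal_peak 1 * expR (- (x ^+ 2 / 2)).
Proof. by rewrite normal_pdfE ?oner_eq0// /normal_fun subr0 expr1n mulNr. Qed.

Lemma std_pdf_gt0 x : 0 < p x.
Proof. by rewrite std_pdfE mulr_gt0 ?expR_gt0// normal_peak_gt0 ?oner_eq0. Qed.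

Lemma std_pdfN x : p (- x) = p x.
Proof. by rewrite !std_pdfE sqrrN. Qed.

Lemma is_derive_std_pdf (x : R) : is_derive x 1 p (- (x * p x)).
Proof.
have -> : p = (fun y => normal_peak 1 * expR (- (y ^+ 2 / 2))).
  by apply/funext => y; rewrite std_pdfE.
have h : is_derive x (1 : R) (fun y : R => - (y ^+ 2 / 2)) (- x).
  apply: is_derive_eq; rewrite ?scaler0 ?add0r /GRing.scale /=; by field.
by apply: is_derive_eq; rewrite /GRing.scale /=; ring.
Qed.

(** exp (x ^ 2 / 2) is the square of exp (x ^ 2 / 4) >= 1 + x ^ 2 / 4. *)
Lemma std_pdf_decay x : x ^+ 4 * p x <= 16 * normal_peak 1.
Proof.
rewrite std_pdfE mulrCA mulrC ler_pM2r ?normal_peak_gt0 ?oner_eq0// expRN.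
rewrite ler_pdivrMr ?expR_gt0//.
have -> : x ^+ 2 / 2 = x ^+ 2 / 4 + x ^+ 2 / 4 by field.
rewrite expRD; have := expR_ge1Dx (x ^+ 2 / 4).
set e := expR _; move=> h; have x2 := sqr_ge0 x; nra.
Qed.

Lemma cvg0_le_inv (f : R -> R) (C : R) :
  (forall x, 1 <= x -> `|f x| <= C / x) -> f x @[x --> +oo] --> 0.
Proof.
move=> h; apply/cvgrPdist_le => e e0; near=> x.
have x1 : 1 <= x by near: x; apply: nbhs_pinfty_ge; rewrite num_real.
rewrite sub0r normrN (le_trans (h x x1))// ler_pdivrMr ?(lt_le_trans ltr01)//.
rewrite -ler_pdivrMl//.
Unshelve. all: by end_near. Qed.

Lemma std_pdf_poly_cvg0 (a b c : R) :
  (a + b * x + c * x ^+ 2) * p x @[x --> +oo] --> 0.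
Proof.
apply: (@cvg0_le_inv _ ((`|a| + `|b| + `|c|) * (16 * normal_peak 1))) => x x1.
have x0 : 0 < x by exact: lt_le_trans x1.
rewrite normrM (gtr0_norm (std_pdf_gt0 _)) ler_pdivlMr//.
have d := std_pdf_decay x; have p0 := std_pdf_gt0 x.
have h : `|a + b * x + c * x ^+ 2| <= (`|a| + `|b| + `|c|) * x ^+ 2.
  rewrite (le_trans (ler_normD _ _))// normrM (ger0_norm (sqr_ge0 x)) mulrDl lerD2r.
  rewrite (le_trans (ler_normD _ _))// normrM (gtr0_norm x0) mulrDl.
  have x2 : x <= x ^+ 2 by rewrite expr2 ler_peMl // ltW.
  rewrite lerD ?ler_wpM2l// ler_peMr//; exact: le_trans x2.
have A0 : 0 <= `|a| + `|b| + `|c| by rewrite !addr_ge0.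
rewrite (@le_trans _ _ ((`|a| + `|b| + `|c|) * (x ^+ 4 * p x)))//; last first.
  by rewrite ler_wpM2l.
have px0 : 0 <= p x * x by rewrite mulr_ge0 ?ltW.
rewrite -mulrA (@le_trans _ _ ((`|a| + `|b| + `|c|) * x ^+ 2 * (p x * x)))//.
  exact: ler_wpM2r.
rewrite -mulrA ler_wpM2l//; have : 0 <= p x * x ^+ 3 * (x - 1).
  by rewrite !mulr_ge0 ?exprn_ge0 ?subr_ge0 // ltW.
nra.
Qed.

Lemma ge0_FTC2y_is_derive (f F : R -> R) (a l : R) :
  (forall x : R, is_derive x (1 : R) F (f x)) -> continuous f ->
  (forall x, a <= x -> 0 <= f x) -> F x @[x --> +oo] --> l ->
  (\int[mu]_(x in `[a, +oo[) (f x)%:E = (l - F a)%:E)%E.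
Proof.
move=> dF cf f0 Fl; rewrite (ge0_continuous_FTC2y f0 _ Fl) ?EFinB//.
- exact: continuous_subspaceT.
- apply: cvg_at_right_filter; apply: differentiable_continuous.
  by apply/derivable1_diffP; exact: ex_derive.
- by move=> x _; rewrite derive1E; apply: derive_val.
Qed.

Lemma continuous_std_pdf : continuous p.
Proof. by apply: continuous_normal_pdf; rewrite oner_eq0. Qed.

Lemma std_half_moment3 :
  (\int[mu]_(x in `[0%R, +oo[) (x ^+ 3 * p x)%:E = (2 * p 0)%:E)%E.
Proof.
have dF (x : R) : is_derive x (1 : R) (fun x => - ((2 + x ^+ 2) * p x)) (x ^+ 3 * p x).
  by have ? := is_derive_std_pdf x; apply: is_derive_eq; rewrite /GRing.scale /=; ring.
rewrite (ge0_FTC2y_is_derive dF (l := 0))//.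
- by rewrite sub0r opprK expr0n addr0.
- by move=> x; apply: cvgM; [exact: exprn_continuous|exact: continuous_std_pdf].
- by move=> x x0; rewrite mulr_ge0 ?exprn_ge0// normal_pdf_ge0.
- have := std_pdf_poly_cvg0 (-2) 0 (-1).
  by apply: cvg_trans; apply: near_eq_cvg; near=> x; ring.
Unshelve. all: by end_near. Qed.

(** The second and third moments are obtained from explicit antiderivatives on
    the half-line; for the second one the antiderivative - x p belongs to
    x ^ 2 p - p. *)
Lemma std_half_moment2 :
  (\int[mu]_(x in `[0%R, +oo[) (x ^+ 2 * p x)%:E =
   \int[mu]_(x in `[0%R, +oo[) (p x)%:E)%E.
Proof.
(* x ^ 2 p - p changes sign, whereas the fundamental theorem on a half-line
   requires a nonnegative integrand: K exp (- x) restores positivity and has an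
   elementary integral. *)
pose K := p 0 * expR 1.
have K0 : 0 < K by rewrite mulr_gt0 ?std_pdf_gt0 ?expR_gt0.
have pub x : p x <= p 0.
  rewrite !std_pdfE ler_pM2l ?normal_peak_gt0 ?oner_eq0// ler_expR lerN2.
  by rewrite expr0n/= mul0r divr_ge0 ?sqr_ge0.
have cp := continuous_std_pdf.
have ce : continuous (fun x : R => expR (- x)).
  by move=> x; apply: continuous_comp; [exact: oppr_continuous|exact: continuous_expR].
have expy : expR (- x) @[x --> +oo%R] --> (0 : R) by exact: cvgr_expR.
have cKe : K * expR (- x) @[x --> +oo%R] --> (0 : R).
  by rewrite -[X in _ --> X](mulr0 K); apply: cvgM; [exact: cvg_cst|].
have cK : continuous (fun x : R => K * expR (- x)).
  by move=> x; apply: cvgM; [exact: cvg_cst|exact: ce].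
have f0 x : 0 <= x -> (0 <= (x ^+ 2 * p x - p x + K * expR (- x))%:E)%E.
  move=> x0; rewrite lee_fin; have [x1|x1] := leP 1 x.
    apply: addr_ge0; last by rewrite mulr_ge0 ?expR_ge0// ltW.
    rewrite -[X in _ - X]mul1r -mulrBl mulr_ge0 ?normal_pdf_ge0//.
    by rewrite subr_ge0 exprn_ege1.
  have : p x <= K * expR (- x).
    rewrite (le_trans (pub x))// /K -mulrA ler_peMr ?normal_pdf_ge0// -expRD.
    by rewrite -[leLHS]expR0 ler_expR subr_ge0 ltW.
    by have := normal_pdf_ge0 0 1 x; have := sqr_ge0 x; nra.
have intK : (\int[mu]_(x in `[0%R, +oo[) (K * expR (- x))%:E = K%:E)%E.
  have dF (x : R) : is_derive x (1 : R) (fun x => - (K * expR (- x))) (K * expR (- x)).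
    by apply: is_derive_eq; rewrite /GRing.scale /=; ring.
  rewrite (ge0_FTC2y_is_derive dF (l := 0))//.
  - by rewrite oppr0 expR0 mulr1 sub0r opprK.
  - by move=> x _; rewrite mulr_ge0 ?expR_ge0// ltW.
  - by rewrite -[X in _ --> X]oppr0; exact: cvgN.
have intf : (\int[mu]_(x in `[0%R, +oo[) (x ^+ 2 * p x - p x + K * expR (- x))%:E = K%:E)%E.
  have dF (x : R) : is_derive x (1 : R) (fun x => - (x * p x) - K * expR (- x))
      (x ^+ 2 * p x - p x + K * expR (- x)).
    by have ? := is_derive_std_pdf x; apply: is_derive_eq; rewrite /GRing.scale /=; ring.
  rewrite (ge0_FTC2y_is_derive dF (l := 0))//.
  - by rewrite oppr0 expR0 mulr1 mul0r oppr0 !sub0r opprK.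
  - move=> x; apply: cvgD; last exact: cK.
    apply: cvgB; last exact: cp.
    by apply: cvgM; [exact: exprn_continuous|exact: cp].
  - rewrite -[X in _ --> X]subr0; apply: cvgB => //.
    have := std_pdf_poly_cvg0 0 (-1) 0.
    by apply: cvg_trans; apply: near_eq_cvg; near=> x; ring.
have mp : measurable_fun (`[0%R, +oo[ : set R) p by apply: measurable_funTS; exact: measurable_normal_pdf.
have me : measurable_fun (`[0%R, +oo[ : set R) (fun x : R => K * expR (- x)).
  by apply: measurable_funTS; exact: continuous_measurable_fun.
have mx2 : measurable_fun (`[0%R, +oo[ : set R) (fun x : R => x ^+ 2 * p x).
  by apply: measurable_funM => //; exact: exprn_measurable.
have Ke0 x : (0 <= (K * expR (- x))%:E)%E by rewrite lee_fin mulr_ge0 ?expR_ge0// ltW.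
have : (\int[mu]_(x in `[0%R, +oo[) ((x ^+ 2 * p x)%:E + (K * expR (- x))%:E) =
        \int[mu]_(x in `[0%R, +oo[) ((x ^+ 2 * p x - p x + K * expR (- x))%:E + (p x)%:E))%E.
  by apply: eq_integral => x _; rewrite -!EFinD; congr EFin; ring.
rewrite ge0_integralD//; last 3 first.
- by move=> x _; rewrite lee_fin mulr_ge0 ?sqr_ge0 ?normal_pdf_ge0.
- exact/measurable_EFinP.
- exact/measurable_EFinP.
rewrite ge0_integralD//; last 4 first.
- by move=> x; rewrite /= in_itv/= andbT; move=> x0; exact: f0.
- by apply/measurable_EFinP; apply: measurable_funD => //; exact: measurable_funB.
- by move=> x _; rewrite lee_fin normal_pdf_ge0.
- exact/measurable_EFinP.
rewrite intK intf [RHS]addeC => /(congr1 (fun z => z - K%:E)%E).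
by rewrite !addeK.
Unshelve. all: by end_near. Qed.

Lemma std_integral_even (f : R -> R) : continuous f -> (forall x, 0 <= f x) ->
  (forall x, f (- x) = f x) ->
  (\int[std]_x (f x)%:E = 2%:E * \int[mu]_(x in `[0%R, +oo[) (f x * p x)%:E)%E.
Proof.
move=> cf f0 fN; rewrite ge0_integral_normal_prob//; last first.
  by apply/measurable_EFinP; exact: continuous_measurable_fun.
under eq_integral do rewrite -EFinM.
rewrite ge0_symfun_integralT ?set_itvcy//.
- by move=> x; rewrite mulr_ge0// normal_pdf_ge0.
- by move=> x; apply: cvgM; [exact: cf|exact: continuous_std_pdf].
- by move=> x; rewrite /= fN std_pdfN.
Qed.

Lemma std_moment2 : (\int[std]_x (x ^+ 2)%:E = 1)%E.
Proof.
rewrite std_integral_even; [|exact: exprn_continuous|exact: sqr_ge0|exact: sqrrN].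
rewrite std_half_moment2.
rewrite -[LHS](_ : \int[std]_x (1 : R)%:E = _)%E; first by rewrite integral_cst//= mul1e probability_setT.
rewrite std_integral_even//; last by move=> ?; exact: cvg_cst.
by under eq_integral do rewrite mul1r.
Qed.

Lemma std_moment3 : (\int[std]_x (`|x| ^+ 3)%:E = (4 * p 0)%:E)%E.
Proof.
rewrite std_integral_even.
- rewrite -[RHS](_ : 2%:E * (2 * p 0)%:E = _)%E; last by rewrite -EFinM; congr EFin; ring.
  rewrite -std_half_moment3; congr (_ * _)%E; apply: eq_integral => x.
  by rewrite inE/= in_itv/= andbT => x0; rewrite ger0_norm.
- move=> x; apply: (@continuous_comp _ _ _ (fun y : R => `|y|) (fun y => y ^+ 3)).
    exact: norm_continuous.
  exact: exprn_continuous.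
- by move=> x; rewrite exprn_ge0.
- by move=> x; rewrite normrN.
Qed.

(** The signed version of ge0_integral_normal_std, by splitting f into its
    positive and negative parts. *)
Lemma integral_normal_affine m s (f : R -> \bar R) : s != 0 ->
  measurable_fun setT f -> std.-integrable setT (fun x => f (s * x + m)%R) ->
  (normal_prob m s).-integrable setT f /\
  (\int[normal_prob m s]_x f x = \int[std]_x f (s * x + m)%R)%E.
Proof.
move=> s0 mf intf; have mfa := measurable_int _ intf; have a0 g x := abse_ge0 (g x : \bar R).
have if0 : (normal_prob m s).-integrable setT f.
  apply/integrableP; split=> //.
  rewrite (ge0_integral_normal_std m s0 _ (fun x => abse_ge0 _)).
    by case/integrableP : intf.
  exact: measurableT_comp.
split; first exact: if0.
rewrite [LHS]integralE [RHS]integralE.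
rewrite (ge0_integral_normal_std m s0 _ (fun x => funepos_ge0 _ x)).
  rewrite (ge0_integral_normal_std m s0 _ (fun x => funeneg_ge0 _ x)).
    by congr (_ - _)%E; apply: eq_integral => x _; rewrite ?funeposE ?funenegE.
  exact: measurable_funeneg.
exact: measurable_funepos.
Qed.

Lemma std_integral_opp (f : R -> R) :
  std.-integrable setT (fun x => (f x)%:E) ->
  std.-integrable setT (fun x => (f (- x))%:E) /\
  \int[std]_x f (- x) = \int[std]_x f x.
Proof.
move=> fi; have mf := measurable_int _ fi.
have eN : normal_prob 0 (-1) = std.
  apply/funext => A; apply: eq_integral => x _.
  by rewrite !normal_pdfE ?oppr_eq0 ?oner_eq0// /normal_peak /normal_fun sqrrN.
have N10 : -1 != 0 :> R by rewrite oppr_eq0 oner_eq0.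
have mfN : measurable_fun setT (fun x : R => (f (- x))%:E).
  exact (measurableT_comp mf (@oppr_measurable R setT)).
have [] := @integral_normal_affine 0 (-1) (fun x => (f (- x))%:E) N10 mfN.
  by apply: eq_integrable fi => // x _; rewrite mulN1r addr0 opprK.
rewrite eN => fiN e; split => //; rewrite /Rintegral e; congr fine.
by apply: eq_integral => x _; rewrite mulN1r addr0 opprK.
Qed.

Lemma integrable_std_le (f g : R -> R) : measurable_fun setT f ->
  std.-integrable setT (fun x => (g x)%:E) -> (forall x, `|f x| <= g x) ->
  std.-integrable setT (fun x => (f x)%:E).
Proof.
move=> mf gi fg; apply: le_integrable gi => //; first exact/measurable_EFinP.
by move=> x _; rewrite /= lee_fin (le_trans (fg x))// ler_norm.
Qed.

Lemma integrable_std_abs3 : std.-integrable setT (fun x => (`|x| ^+ 3)%:E).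
Proof.
apply/integrableP; split.
  by apply/measurable_EFinP; apply: measurable_funX; exact: normr_measurable.
under eq_integral => x _ do rewrite /= ger0_norm ?exprn_ge0//.
by rewrite std_moment3 ltry.
Qed.

Lemma integrable_std_sqr : std.-integrable setT (fun x => (x ^+ 2)%:E).
Proof.
apply/integrableP; split.
  by apply/measurable_EFinP; exact: exprn_measurable.
under eq_integral => x _ do rewrite /= ger0_norm ?sqr_ge0//.
by rewrite std_moment2 ltry.
Qed.

Lemma integrable_std_cst (c : R) : std.-integrable setT (fun=> c%:E).
Proof. exact: finite_measure_integrable_cst. Qed.

Lemma integrable_std_abs : std.-integrable setT (fun x => `|x|%:E).
Proof.
apply: (@integrable_std_le _ (fun x => 1 + x ^+ 2)); first exact: normr_measurable.
  by under eq_fun do rewrite EFinD; apply: integrableD => //;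
    [exact: integrable_std_cst|exact: integrable_std_sqr].
move=> x; rewrite normr_id; have e := real_normK (num_real x).
by have := sqr_ge0 (`|x| - 1); have := sqr_ge0 x; nra.
Qed.

Lemma integrable_std_id : std.-integrable setT (fun x => x%:E).
Proof. exact: integrable_std_le integrable_std_abs _. Qed.

Lemma std_mean0 : \int[std]_x x = 0.
Proof.
have [i] := std_integral_opp integrable_std_id.
under eq_Rintegral do rewrite -mulN1r.
rewrite RintegralZl//; last exact: integrable_std_id.
by move=> e; lra.
Qed.

Lemma std_var1 : \int[std]_x (x ^+ 2) = 1.
Proof. by rewrite /Rintegral std_moment2. Qed.

End gaussian_moments.

(** * Dominated convergence and Gaussian smoothing *)

Lemma Rdominated_cvg d (T : measurableType d) (R : realType)
  (mu : {measure set T -> \bar R}) (D : set T) (f_ : nat -> T -> R) (f g : T -> R) :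
  measurable D -> (forall n, measurable_fun D (f_ n)) -> measurable_fun D f ->
  {ae mu, forall x, D x -> f_ ^~ x @ \oo --> f x} ->
  mu.-integrable D (EFin \o g) ->
  {ae mu, forall x n, D x -> `|f_ n x| <= g x} ->
  mu.-integrable D (EFin \o f) /\
  (\int[mu]_(x in D) f_ n x @[n --> \oo] --> \int[mu]_(x in D) f x).
Proof.
move=> mD mf_ mf f_f gi fg.
have [||||i _ c] := @dominated_convergence d T R mu D mD (fun n x => (f_ n x)%:E)
   (fun x => (f x)%:E) (fun x => (g x)%:E) _ _ _ gi.
- by move=> n; exact/measurable_EFinP.
- exact/measurable_EFinP.
- by apply: filterS f_f => x h Dx; apply: cvg_EFin; [exact: nearW|exact: h].
- by apply: filterS fg => x h n Dx; rewrite /= lee_fin; exact: h.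
split; first exact: i.
apply: fine_cvg; rewrite fineK; first exact: c.
exact: integrable_fin_num.
Qed.

Section real_integrable.
Context d (T : measurableType d) (R : realType) (mu : {measure set T -> \bar R}).
Variables (D : set T) (mD : measurable D).
Implicit Types f g : T -> R.

Lemma integrable_addr f g : mu.-integrable D (fun x => (f x)%:E) ->
  mu.-integrable D (fun x => (g x)%:E) -> mu.-integrable D (fun x => (f x + g x)%:E).
Proof. by move=> fi gi; under eq_fun do rewrite EFinD; exact: integrableD. Qed.

Lemma integrable_subr f g : mu.-integrable D (fun x => (f x)%:E) ->
  mu.-integrable D (fun x => (g x)%:E) -> mu.-integrable D (fun x => (f x - g x)%:E).
Proof. by move=> fi gi; under eq_fun do rewrite EFinB; exact: integrableB. Qed.

Lemma integrable_scaler (k : R) f : mu.-integrable D (fun x => (f x)%:E) ->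
  mu.-integrable D (fun x => (k * f x)%:E).
Proof. by move=> fi; under eq_fun do rewrite EFinM; exact: integrableZl. Qed.

Lemma integrable_le_real f g : measurable_fun D f ->
  mu.-integrable D (fun x => (g x)%:E) -> (forall x, D x -> `|f x| <= g x) ->
  mu.-integrable D (fun x => (f x)%:E).
Proof.
move=> mf gi fg; apply: le_integrable gi => //; first exact/measurable_EFinP.
by move=> x Dx; rewrite /= lee_fin (le_trans (fg x Dx))// ler_norm.
Qed.

Lemma integrable_normr f : mu.-integrable D (fun x => (f x)%:E) ->
  mu.-integrable D (fun x => `|f x|%:E).
Proof. by move=> /integrable_abse. Qed.

End real_integrable.

Section smoothing.
Context {R : realType}.
Local Notation std := (@normal_prob R 0 1).
Implicit Types (f : R -> R) (z e u : R).

(** The mean of f over a Gaussian of mean z and standard deviation e; the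
    convolution of w with one clump has this form. *)
Definition smoothing f z e : R := \int[std]_u f (z - e * u).

Lemma measurable_smoothed f z e : measurable_fun setT f ->
  measurable_fun setT (fun u : R => f (z - e * u)).
Proof.
move=> mf; apply: (@measurableT_comp _ _ _ _ _ _ f _ (fun u => z - e * u)) => //.
by apply: measurable_funB => //; exact: measurable_funM.
Qed.

Lemma integrable_smoothed f z e C : measurable_fun setT f ->
  (forall x, `|f x| <= C) -> std.-integrable setT (fun u => (f (z - e * u))%:E).
Proof.
move=> mf fC; apply: integrable_std_le (integrable_std_cst C) _ => //.
exact: measurable_smoothed.
Qed.

Lemma std_int_cst (c : R) : \int[std]_x c = c.
Proof. by rewrite Rintegral_cst//= probability_setT mulr1. Qed.

Lemma smoothing_le0 f z e C : measurable_fun setT f ->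
  (forall x, `|f x| <= C) -> (forall x, f x <= 0) -> smoothing f z e <= 0.
Proof.
move=> mf fC f0; rewrite -[leRHS]std_int_cst; apply: le_Rintegral => //.
- exact: integrable_smoothed mf fC.
- exact: integrable_std_cst.
Qed.

Lemma smoothing_lipschitz f z e C L : measurable_fun setT f ->
  (forall x, `|f x| <= C) -> (forall x y, `|f x - f y| <= L * `|x - y|) ->
  `|smoothing f z e - f z| <= L * `|e| * \int[std]_x `|x|.
Proof.
move=> mf fC fL; rewrite -[X in _ - X]std_int_cst /smoothing.
have i1 := integrable_smoothed z e mf fC.
have i2 := integrable_std_cst (f z).
rewrite -RintegralB//.
apply: (le_trans (le_normr_Rintegral _ _)) => //.
  exact: integrable_subr.
rewrite -RintegralZl//; last exact: integrable_std_abs.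
apply: le_Rintegral => //.
- by apply: integrable_normr; exact: integrable_subr.
- by apply: integrable_scaler => //; exact: integrable_std_abs.
- move=> u _; rewrite (le_trans (fL _ _))//.
  by rewrite addrAC subrr sub0r normrN normrM mulrA.
Qed.

(** Only the values |e N| > eta can bring z into the support of f, and their
    probability is bounded by the third moment.  The second moment would not be
    enough: the contribution of a clump to V_eff is a smoothing divided by
    e ^ 2. *)
Lemma smoothing_far f z e C s eta : measurable_fun setT f ->
  (forall x, `|f x| <= C) -> (forall x, s <= `|x| -> f x = 0) ->
  0 < eta -> s + eta <= `|z| ->
  `|smoothing f z e| <= C / eta ^+ 3 * `|e| ^+ 3 * \int[std]_x (`|x| ^+ 3).
Proof.
move=> mf fC f0 eta0 zs; have i1 := integrable_smoothed z e mf fC.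
have C0 : 0 <= C by exact: le_trans (fC 0).
have pt u : `|f (z - e * u)| <= C / eta ^+ 3 * `|e| ^+ 3 * `|u| ^+ 3.
  have [/f0 ->|zu] := leP s `|z - e * u|.
    by rewrite normr0 !mulr_ge0 ?invr_ge0 ?exprn_ge0 ?(ltW eta0).
  rewrite (le_trans (fC _))// -mulrA -exprMn -normrM mulrAC -mulrA ler_peMr// -exprVn.
  rewrite -exprMn exprn_ege1// ler_pdivlMr// mul1r.
  have := lerB_normD z (- (e * u)); rewrite normrN => h.
  by move: zs zu h; lra.
have i3 : std.-integrable setT (fun x => (C / eta ^+ 3 * `|e| ^+ 3 * `|x| ^+ 3)%:E).
  by apply: integrable_scaler => //; exact: integrable_std_abs3.
apply: (le_trans (le_normr_Rintegral _ _)) => //.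
rewrite -RintegralZl//; last exact: integrable_std_abs3.
apply: le_Rintegral => //.
exact: integrable_normr.
Qed.

(** By symmetry the smoothing is also the mean of f (z + e N), and one of the
    two points z - e N and z + e N is at least as far from 0 as z. *)
Lemma smoothing_lower f z e C : measurable_fun setT f ->
  (forall x, `|f x| <= C) ->
  (forall x y, `|x| <= `|y| -> f x <= f y) ->
  (f z - f 0) / 2 <= smoothing f z e - f 0.
Proof.
move=> mf fC mono; have i1 := integrable_smoothed z e mf fC.
have [i2 e2] := std_integral_opp i1.
have : \int[std]_u (f z + f 0) <= \int[std]_u (f (z - e * u) + f (z - e * - u)).
  apply: le_Rintegral => //.
  - exact: integrable_std_cst.
  - exact: integrable_addr.
  move=> u _; have [h|h] := leP `|z| `|z - e * u|.
    by apply: lerD; apply: mono => //; rewrite normr0.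
  rewrite [leLHS]addrC; apply: lerD; apply: mono; rewrite ?normr0//.
  rewrite mulrN opprK; have : `|z + e * u + (z - e * u)| = 2 * `|z|.
    by rewrite (_ : _ + _ = 2 * z); [rewrite normrM ger0_norm|ring].
  by move=> h2; have := ler_normD (z + e * u) (z - e * u); rewrite h2; lra.
have := RintegralD measurableT i1 i2; rewrite e2 => ->.
by rewrite std_int_cst -/(smoothing f z e); lra.
Qed.

(** f (e u - e N) - f 0 is about k / 2 * e ^ 2 * (u - N) ^ 2, and the mean of
    (u - N) ^ 2 is u ^ 2 + 1.  The summand 1 is the origin of the factor
    exp (- 1 / 2) in the final formula. *)
Lemma smoothing_laplace f (C K k : R) (e : nat -> R) u : measurable_fun setT f ->
  (forall x, `|f x| <= C) ->
  (forall x, 0 <= f x - f 0 <= K * x ^+ 2) ->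
  (f x - f 0) / x ^+ 2 @[x --> 0^'] --> k / 2 ->
  (forall n, 0 < e n) -> e n @[n --> \oo] --> 0 ->
  (smoothing f (e n * u) (e n) - f 0) / e n ^+ 2 @[n --> \oo] --> k / 2 * (u ^+ 2 + 1).
Proof.
move=> mf fC fK fk e0 ecvg.
(* h extends the difference quotient continuously to 0, so that the formula
   below also covers the point v = u. *)
pose h x := if x == 0 then k / 2 else (f x - f 0) / x ^+ 2.
have hE x : f x - f 0 = h x * x ^+ 2.
  rewrite /h; case: eqP => [->|/eqP x0]; first by rewrite subrr expr0n mulr0.
  by rewrite divfK// expf_neq0.
have h0 : h 0 = k / 2 by rewrite /h eqxx.
have ch : h x @[x --> 0] --> h 0.
  rewrite h0; apply/cvgrPdist_le => /= d d0.
  have /cvgrPdist_le/(_ d d0) := fk; rewrite near_withinE => H.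
  near=> x; rewrite /h; case: eqP => [_|/eqP x0]; first by rewrite subrr normr0 ltW.
  by apply: (near H x).
have smE n : (smoothing f (e n * u) (e n) - f 0) / e n ^+ 2 =
    \int[std]_v ((f (e n * u - e n * v) - f 0) / e n ^+ 2).
  have i1 := integrable_smoothed (e n * u) (e n) mf fC.
  have i2 := integrable_std_cst (f 0).
  rewrite -{1}[f 0]std_int_cst /smoothing -RintegralB// -RintegralZr//.
  exact: integrable_subr.
under eq_fun do rewrite smE.
have -> : k / 2 * (u ^+ 2 + 1) = \int[std]_v (k / 2 * (u - v) ^+ 2).
  have i1 : std.-integrable setT (fun v => (-2 * u * v)%:E).
    by apply: integrable_scaler => //; exact integrable_std_id.
  have i2 : std.-integrable setT (fun v => (u ^+ 2 + -2 * u * v)%:E).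
    by apply: integrable_addr => //; exact: integrable_std_cst.
  transitivity (\int[std]_v (k / 2 * (u ^+ 2 + -2 * u * v + v ^+ 2))); last first.
    by apply: eq_Rintegral => v _; congr (_ * _); ring.
  rewrite RintegralZl//; last by apply: integrable_addr => //; exact: integrable_std_sqr.
  rewrite RintegralD//; last exact: integrable_std_sqr.
  rewrite RintegralD//; last exact: integrable_std_cst.
  have := RintegralZl (-2 * u) measurableT integrable_std_id; rewrite std_mean0 => ->.
  by rewrite std_var1 std_int_cst mulr0 addr0.
have fe n v : (f (e n * u - e n * v) - f 0) / e n ^+ 2 = h (e n * (u - v)) * (u - v) ^+ 2.
  rewrite -mulrBr hE exprMn -mulrA; congr (_ * _).
  by rewrite mulrAC divff ?mul1r// expf_neq0// gt_eqF.
have [||||| _] := @Rdominated_cvg _ _ R std setT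
  (fun n v => (f (e n * u - e n * v) - f 0) / e n ^+ 2)
  (fun v => k / 2 * (u - v) ^+ 2) (fun v => K * (u - v) ^+ 2) measurableT; last exact.
- move=> n; apply: measurable_funM => //; apply: measurable_funB => //.
  exact: measurable_smoothed.
- by apply: measurable_funM => //; apply: measurable_funX; exact: measurable_funB.
- apply: aeW => v _; under eq_fun do rewrite fe.
  apply: cvgM; last exact: cvg_cst.
  rewrite -h0.
  have ce : e n * (u - v) @[n --> \oo] --> 0.
    by rewrite -[X in _ --> X](mul0r (u - v)); apply: cvgM => //; exact: cvg_cst.
  exact: (cvg_comp _ h ce ch).
- have -> : EFin \o (fun v => K * (u - v) ^+ 2) =
    (fun v => (K * (u ^+ 2 + -2 * u * v + v ^+ 2))%:E).
    by apply/funext => v /=; congr EFin; ring.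
  apply: integrable_scaler => //; apply: integrable_addr => //; last exact: integrable_std_sqr.
  apply: integrable_addr => //; first exact: integrable_std_cst.
  by apply: integrable_scaler => //; exact integrable_std_id.
- apply: aeW => v n _; rewrite -mulrBr; have /andP[f1 f2] := fK (e n * (u - v)).
  rewrite ger0_norm ?divr_ge0 ?sqr_ge0// ler_pdivrMr ?exprn_gt0//.
  by rewrite (le_trans f2)// exprMn; lra.
Unshelve. all: by end_near. Qed.

End smoothing.

(** * Calculus *)

Section calculus.
Context {R : realType}.
Implicit Types (f df : R -> R) (x y : R).

Lemma is_derive_continuous f df : (forall x, is_derive x (1 : R) f (df x)) ->
  continuous f.
Proof.
move=> fd x; apply: differentiable_continuous; apply/derivable1_diffP.
exact: ex_derive.
Qed.

Lemma mean_value f df : (forall x, is_derive x (1 : R) f (df x)) ->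
  forall x y, exists z, [/\ `|z - x| <= `|y - x|, Num.min x y <= z <= Num.max x y
     & f y - f x = df z * (y - x)].
Proof.
move=> fd; have cf := is_derive_continuous fd.
have main x y : x <= y -> exists2 z, x <= z <= y & f y - f x = df z * (y - x).
  move=> xy; have [z zxy e] :=
    MVT_segment xy (fun z _ => fd z) (continuous_subspaceT (A := `[x, y]) cf).
  by exists z => //; move: zxy; rewrite in_itv.
move=> x y; have [xy|yx] := leP x y.
  have [z /andP[z1 z2] e] := main x y xy; exists z; split; [|by rewrite z1 z2|by []].
  by rewrite !ger0_norm ?subr_ge0//; lra.
have [z /andP[z1 z2] e] := main y x (ltW yx); exists z; split; [|by rewrite z1 z2|].
  by rewrite !ler0_norm ?subr_le0// ?(ltW yx)//; lra.
by rewrite -opprB e; ring.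
Qed.

Lemma lipschitz_of_derive f df C : (forall x, is_derive x (1 : R) f (df x)) ->
  (forall x, `|df x| <= C) -> forall x y, `|f x - f y| <= C * `|x - y|.
Proof.
move=> fd dC x y; have [z [_ _ ->]] := mean_value fd y x.
by rewrite normrM ler_wpM2r.
Qed.

Lemma continuous_of_lipschitz f C :
  (forall x y, `|f x - f y| <= C * `|x - y|) -> continuous f.
Proof.
move=> fC x; apply/cvgrPdist_le => /= e e0.
have C0 : 0 <= C.
  by have := le_trans (normr_ge0 _) (fC 1 0); rewrite subr0 normr1 mulr1.
have C1 : 0 < C + 1 by rewrite ltr_wpDl.
near=> y; rewrite (le_trans (fC _ _))//.
have h : `|x - y| <= e / (C + 1).
  near: y; apply/nbhs_normP; exists (e / (C + 1)) => /=; first exact: divr_gt0.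
  by move=> ? /= /ltW.
rewrite (le_trans (ler_wpM2l C0 h))// mulrCA ger_pMr//.
by rewrite ler_pdivrMr ?mul1r ?lerDl.
Unshelve. all: by end_near. Qed.

Lemma taylor1 f df C : (forall x, is_derive x (1 : R) f (df x)) ->
  (forall x y, `|df x - df y| <= C * `|x - y|) ->
  forall x k, `|f (x + k) - f x - k * df x| <= C * k ^+ 2.
Proof.
move=> fd dC x k; have [z [zx _ e]] := mean_value fd x (x + k).
have xk : x + k - x = k by ring.
rewrite xk in zx e; rewrite e mulrC -mulrBr normrM.
have C0 : 0 <= C.
  by have := le_trans (normr_ge0 _) (dC 1 0); rewrite subr0 normr1 mulr1.
rewrite (@le_trans _ _ (`|k| * (C * `|z - x|)))// ?ler_wpM2l//.
rewrite mulrCA ler_wpM2l// -real_normK ?num_real// expr2 ler_wpM2l//.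
Qed.

(** A derivative identified by a quadratic bound on the remainder: this form
    survives integration against an integrable function, which differentiates
    convolutions without any exchange of limits. *)
Lemma is_derive_of_quadratic f (a : R) x C :
  (forall k, `|f (x + k) - f x - k * a| <= C * k ^+ 2) -> is_derive x (1 : R) f a.
Proof.
move=> h.
have hc : h^-1 *: (f (h *: (1 : R) + x) - f x) @[h --> (0 : R)^'] --> a.
  apply/cvgrPdist_le => /= e e0.
  have C0 : 0 < `|C| + 1 by rewrite ltr_wpDl.
  rewrite near_withinE; near=> k => k0.
  have -> : a - k^-1 *: (f (k *: (1 : R) + x) - f x) = - (k^-1 * (f (x + k) - f x - k * a)).
    rewrite /GRing.scale /= mulr1 [k + x]addrC; field; exact: k0.
  rewrite normrN normrM normfV mulrC ler_pdivrMr ?normr_gt0//.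
  rewrite (le_trans (h k))// -real_normK ?num_real// expr2 mulrA ler_wpM2r//.
  have kd : `|k| <= e / (`|C| + 1).
    near: k; apply/nbhs_normP; exists (e / (`|C| + 1)); first exact: divr_gt0.
    by move=> ? /=; rewrite sub0r normrN => /ltW.
  rewrite (le_trans (ler_wpM2r _ (ler_norm C)))// (le_trans (ler_wpM2l _ kd))//.
  by rewrite mulrCA ger_pMr// ler_pdivrMr// mul1r lerDl.
apply: DeriveDef; last by apply/cvg_lim.
by apply/cvg_ex; exists a.
Unshelve. all: by end_near. Qed.

End calculus.

(** One constant serves all four bounds, which keeps the closure properties
    short. *)
Definition bounded_C11 {R : realType} (C : R) (f df : R -> R) : Prop :=
  [/\ forall x, is_derive x (1 : R) f (df x), forall x, `|f x| <= C,
      forall x, `|df x| <= C & forall x y, `|df x - df y| <= C * `|x - y|].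

Section bounded_C11_theory.
Context {R : realType}.

Lemma bounded_C11_scale (c C : R) f df : bounded_C11 C f df ->
  bounded_C11 (`|c| * C) (fun x => c * f x) (fun x => c * df x).
Proof.
move=> [fd fC dC dl]; split=> [x|x|x|x y].
- by have := fd x => ?; apply: is_derive_eq; rewrite /GRing.scale /=; ring.
- by rewrite normrM ler_wpM2l.
- by rewrite normrM ler_wpM2l.
- by rewrite -mulrBr normrM -mulrA ler_wpM2l.
Qed.

Lemma bounded_C11_sum (I : eqType) (r : seq I) (f df : I -> R -> R) :
  (forall k, k \in r -> exists C, bounded_C11 C (f k) (df k)) ->
  exists C, bounded_C11 C (fun x => \sum_(k <- r) f k x) (fun x => \sum_(k <- r) df k x).
Proof.
elim: r => [|k r IH] H.
  exists 0; split=> [x|x|x|x y]; rewrite ?big_nil ?normr0 ?subr0 ?mul0r ?normr0//.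
  have -> : (fun x : R => \sum_(k <- [::]) f k x) = cst 0.
    by apply/funext => y; rewrite big_nil.
  exact: is_derive_cst.
have [C1 [d1 b1 c1 l1]] := H k (mem_head _ _).
have [|C2 [d2 b2 c2 l2]] := IH; first by move=> i ir; apply: H; rewrite in_cons ir orbT.
exists (C1 + C2); split=> [x|x|x|x y]; rewrite ?big_cons.
- have -> : (fun x : R => \sum_(k <- k :: r) f k x) =
            (fun x => f k x + \sum_(k <- r) f k x).
    by apply/funext => y; rewrite big_cons.
  by have := d1 x; have := d2 x => ? ?; apply: is_derive_eq.
- by rewrite (le_trans (ler_normD _ _))// lerD.
- by rewrite (le_trans (ler_normD _ _))// lerD.
- by rewrite opprD addrACA mulrDl (le_trans (ler_normD _ _))// lerD.
Qed.

(** The first and second derivatives are the density times polynomials in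
    x - mu, which (1 + t) exp (- t) <= 1 bounds. *)
Lemma bounded_C11_normal_pdf (mu s : R) : 0 < s ->
  exists C df, bounded_C11 C (normal_pdf mu s) df.
Proof.
move=> s0; pose g := normal_pdf mu s.
have gE x : g x = normal_peak s * expR (- ((x - mu) ^+ 2 / (2 * s ^+ 2))).
  by rewrite /g normal_pdfE ?gt_eqF// /normal_fun mulNr -mulr_natl.
have p0 : 0 < normal_peak s by rewrite normal_peak_gt0// gt_eqF.
pose d1 x := - ((x - mu) / s ^+ 2) * g x.
pose d2 x := ((x - mu) ^+ 2 / s ^+ 4 - (s ^+ 2)^-1) * g x.
have dg (x : R) : is_derive x (1 : R) g (d1 x).
  have -> : g = (fun x => normal_peak s * expR (- ((x - mu) ^+ 2 / (2 * s ^+ 2)))).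
    by apply/funext => y; rewrite gE.
  have h : is_derive x (1 : R) (fun y : R => - ((y - mu) ^+ 2 / (2 * s ^+ 2)))
     (- ((x - mu) / s ^+ 2)).
    apply: is_derive_eq; rewrite /GRing.scale /= ?scaler0; field; exact: lt0r_neq0.
  by apply: is_derive_eq; rewrite /d1 gE /GRing.scale /=; ring.
have dd1 (x : R) : is_derive x (1 : R) d1 (d2 x).
  have h : is_derive x (1 : R) (fun y : R => - ((y - mu) / s ^+ 2)) (- (s ^+ 2)^-1).
    apply: is_derive_eq; rewrite /GRing.scale /= ?scaler0; field; exact: lt0r_neq0.
  have := dg x => ?.
  apply: is_derive_eq; rewrite /d2 /d1 /GRing.scale /=; field; exact: lt0r_neq0.
pose t x := (x - mu) ^+ 2 / (2 * s ^+ 2).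
have t0 x : 0 <= t x by rewrite divr_ge0 ?sqr_ge0// mulr_ge0 ?sqr_ge0.
have gt x : (1 + t x) * g x <= normal_peak s.
  rewrite gE -/(t x) mulrCA ler_piMr ?(ltW p0)// expRN ler_pdivrMr ?expR_gt0// mul1r.
  exact: expR_ge1Dx.
have g0 x : 0 <= g x by exact: normal_pdf_ge0.
have b1 x : `|d1 x| <= normal_peak s / s.
  rewrite /d1 normrM normrN (ger0_norm (g0 x)) ler_pdivlMr//.
  rewrite (le_trans _ (gt x))// mulrAC ler_wpM2r//.
  rewrite normrM normfV (gtr0_norm (exprn_gt0 2 s0)) expr2 invfM -!mulrA mulVf ?gt_eqF// mulr1.
  have -> : t x = (`|x - mu| / s) ^+ 2 / 2.
    by rewrite /t expr_div_n real_normK ?num_real//; field; exact: lt0r_neq0.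
  by have := sqr_ge0 (`|x - mu| / s - 1); have := sqr_ge0 (`|x - mu| / s); nra.
have b2 x : `|d2 x| <= 2 * normal_peak s / s ^+ 2.
  have -> : d2 x = (2 * t x - 1) / s ^+ 2 * g x.
    by rewrite /d2 /t; congr (_ * _); field; exact: lt0r_neq0.
  have s20 : 0 < s ^+ 2 by exact: exprn_gt0.
  rewrite ler_pdivlMr// normrM (ger0_norm (g0 x)) normrM normfV (gtr0_norm s20).
  rewrite mulrAC divfK ?gt_eqF//.
  rewrite (@le_trans _ _ (2 * ((1 + t x) * g x)))// ?ler_wpM2l// mulrA ler_wpM2r//.
  by rewrite ler_norml; have := t0 x; lra.
have bg x : `|g x| <= normal_peak s by rewrite (ger0_norm (g0 x)) normal_pdf_ub// gt_eqF.
pose C := normal_peak s + normal_peak s / s + 2 * normal_peak s / s ^+ 2.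
have c1 : 0 <= normal_peak s / s by rewrite divr_ge0// ltW.
have c2 : 0 <= 2 * normal_peak s / s ^+ 2 by rewrite divr_ge0 ?sqr_ge0// mulr_ge0// ltW.
exists C, d1; split => //.
- by move=> x; rewrite (le_trans (bg x))// /C -addrA lerDl addr_ge0.
- by move=> x; rewrite (le_trans (b1 x))// /C addrAC lerDr addr_ge0// ltW.
- move=> x y; rewrite (le_trans (lipschitz_of_derive dd1 b2 x y))// ler_wpM2r//.
  by rewrite /C lerDr addr_ge0// ltW.
Qed.

End bounded_C11_theory.

(** * The interaction well *)

(** What the asymptotics use of w: an even Lipschitz well, non-decreasing
    away from 0, supported by [- s, s] and quadratic at its bottom, with k standing
    for w''(0). *)
Record clump_well {R : realType} (w : R -> R) (s L k : R) : Prop := ClumpWell {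
  cw_s : 0 < s;
  cw_k : 0 < k;
  cw_lip : forall x y, `|w x - w y| <= L * `|x - y|;
  cw_mono : forall x y, `|x| <= `|y| -> w x <= w y;
  cw_out : forall x, s <= `|x| -> w x = 0;
  cw_in : forall x, `|x| < s -> w x < 0;
  cw_taylor : (w x - w 0) / x ^+ 2 @[x --> (0 : R)^'] --> k / 2 }.

Section clump_well_theory.
Context {R : realType}.
Implicit Types (w : R -> R).

Lemma derivable_is_derive1 w x : derivable w x 1 -> is_derive x (1 : R) w (derive1 w x).
Proof. by move=> h; rewrite derive1E; exact: DeriveDef. Qed.

(** The derivative vanishes at the minimum 0, hence w'(h) - k h = o(h), and the
    mean value theorem on w - k / 2 x ^ 2 integrates this.  Evenness reduces the
    claim to positive x. *)
Lemma even_C2_taylor w (k : R) : (forall x, w (- x) = w x) ->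
  (\forall x \near (0 : R), derivable w x 1) ->
  derivable (derive1 w) 0 1 -> derive1 (derive1 w) 0 = k ->
  (forall x, w 0 <= w x) ->
  (w x - w 0) / x ^+ 2 @[x --> (0 : R)^'] --> k / 2.
Proof.
move=> wN dw dw1 wk wmin.
have /nbhs_normP[r /= r0 dr] := dw.
have dwr x : `|x| < r -> is_derive x (1 : R) w (derive1 w x).
  by move=> xr; apply: derivable_is_derive1; apply: dr; rewrite /= sub0r normrN.
have w10 : derive1 w 0 = 0.
  have h : is_derive (0 : R) (1 : R) w 0.
    apply: (@derive1_at_min _ w (- r) r 0).
    - by rewrite ge0_cp// ltW.
    - move=> t; rewrite in_itv/= => /andP[t1 t2].
      by apply: ex_derive; apply: dwr; rewrite ltr_norml t1.
    - by rewrite in_itv/= oppr_lt0 r0.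
    - by move=> t _; exact: wmin.
  by rewrite derive1E; apply: derive_val.
have d2 : (derive1 w h - k * h) / h @[h --> (0 : R)^'] --> 0.
  have := derivable_is_derive1 dw1; rewrite wk => -[/cvg_ex[l cl] lk].
  have lE : l = k by rewrite -lk; apply/esym/cvg_lim.
  rewrite lE in cl; rewrite -[X in _ --> X](subrr k).
  have : h^-1 *: (derive1 w (h *: (1 : R) + 0) - derive1 w 0) - k @[h --> (0 : R)^'] --> k - k.
    by apply: cvgB => //; exact: cvg_cst.
  apply: cvg_trans; apply: near_eq_cvg; rewrite near_withinE; near=> h => h0.
  by rewrite w10 subr0 addr0 /GRing.scale/= mulr1; field; exact: h0.
have /cvgrPdist_le d2e := d2.
apply/cvgrPdist_le => /= e e0; have := d2e e e0.
rewrite near_withinE => /nbhs_normP[q /= q0 hq]; rewrite near_withinE.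
pose m := Num.min r q; have m0 : 0 < m by rewrite lt_min r0.
apply/nbhs_normP; exists m => // y /=; rewrite sub0r normrN => ym y0.
have main x : 0 < x -> x < m -> `|w x - w 0 - k / 2 * x ^+ 2| <= e * x ^+ 2.
  rewrite lt_min => x0 /andP[xr xq].
  have dh t : t \in `]0, x[%R -> is_derive t (1 : R) (fun t => w t - k / 2 * t ^+ 2)
      (derive1 w t - k * t).
    rewrite in_itv/= => /andP[t0 tx].
    have ? : is_derive t (1 : R) w (derive1 w t).
      by apply: dwr; rewrite gtr0_norm// (lt_trans tx).
    by apply: is_derive_eq; rewrite /GRing.scale /=; field.
  have ch : {within `[0, x], continuous (fun t => w t - k / 2 * t ^+ 2)}.
    apply: continuous_in_subspaceT => t; rewrite inE/= in_itv/= => /andP[t0 tx].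
    apply: cvgB; last first.
      by apply: cvgM; [exact: cvg_cst|exact: exprn_continuous].
    apply: differentiable_continuous; apply/derivable1_diffP.
    by apply: ex_derive; apply: dwr; rewrite ger0_norm// (le_lt_trans tx).
  have [t] := MVT x0 dh ch.
  rewrite in_itv/= => /andP[t0 tx]; rewrite expr0n/= mulr0 !subr0 => E.
  rewrite addrAC E normrM (gtr0_norm x0) expr2 mulrA ler_wpM2r ?(ltW x0)//.
  have := hq t; rewrite /= sub0r normrN gtr0_norm// => /(_ (lt_trans tx xq) (lt0r_neq0 t0)).
  rewrite sub0r normrN normrM normfV (gtr0_norm t0) ler_pdivrMr// => H.
  by rewrite (le_trans H)// ler_wpM2l ?(ltW e0)// ltW.
have wE : w y = w `|y|.
  by have [y00|y00] := leP 0 y; [rewrite ger0_norm|rewrite ltr0_norm// wN].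
have yy : `|y| ^+ 2 = y ^+ 2 by rewrite real_normK// num_real.
have ny0 : 0 < `|y| by rewrite normr_gt0.
have y2 : 0 < y ^+ 2 by rewrite -yy exprn_gt0.
have := main _ ny0 ym; rewrite -wE yy => H.
have -> : k / 2 - (w y - w 0) / y ^+ 2 = - ((w y - w 0 - k / 2 * y ^+ 2) / y ^+ 2).
  by field; exact: y0.
by rewrite normrN normrM normfV (gtr0_norm y2) ler_pdivrMr.
Unshelve. all: by end_near. Qed.

Lemma assumption_A_clump_well w s : 0 < s -> assumption_A w s ->
  exists L, clump_well w s L (derive1n 2 w 0).
Proof.
move=> s0 [[wN wlip wmono] [_ _ wsupp wle0] [wC2 wmin k0]].
have [M [_ /(_ (`|M| + 1)) H]] := wlip.
have wabs x : w x = w `|x|.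
  by have [x0|x0] := leP 0 x; [rewrite ger0_norm|rewrite ltr0_norm// wN].
have mono x y : `|x| <= `|y| -> w x <= w y.
  move=> xy; rewrite (wabs x) (wabs y); apply: wmono => //.
  - by rewrite inE /= in_itv/= andbT.
  - by rewrite inE /= in_itv/= andbT.
exists (`|M| + 1); split => //.
- move=> x y; apply: (H _ (x, y)) => //=.
  by rewrite (le_lt_trans (ler_norm M))// ltrDl.
- have out x : s < `|x| -> w x = 0.
    move=> sx; apply/eqP; apply: contraT => wx.
    have : support_of w x by apply: subset_closure.
    rewrite wsupp /= in_itv/= => /andP[h1 h2].
    by move: sx; rewrite ltNge ler_norml h1 h2.
  move=> x; rewrite le_eqVlt => /orP[/eqP sx|]; last exact: out.
  (* Strictly outside [- s, s] the function vanishes by definition of the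
     support; the end-points follow by continuity. *)
  apply/eqP; rewrite eq_le wle0/= leNgt; apply/negP => wx.
  have lip y : `|w y - w x| <= (`|M| + 1) * `|y - x|.
    apply: (H _ (y, x)) => //=.
    by rewrite (le_lt_trans (ler_norm M))// ltrDl.
  have L0 : 0 < `|M| + 1 by rewrite ltr_wpDl.
  pose y := `|x| + - w x / (`|M| + 1) / 2.
  have d0 : 0 < - w x / (`|M| + 1) / 2 by rewrite !divr_gt0// oppr_gt0.
  have : w y = 0.
    by apply: out; rewrite gtr0_norm ?sx ?ltrDl// addr_gt0// -sx.
  have : `|w y - w `|x| | <= (`|M| + 1) * `|y - `|x| |.
    apply: (H _ (y, `|x|)) => //=.
    by rewrite (le_lt_trans (ler_norm M))// ltrDl.
  rewrite -wabs => h wy; move: h; rewrite wy sub0r normrN ltr0_norm//.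
  rewrite /y addrAC subrr add0r (gtr0_norm d0) mulrCA mulrA divfK ?gt_eqF// => h.
  by move: wx; lra.
  (* If w x = 0 with |x| < s, monotonicity makes w vanish beyond |x|, and the
     support would be contained in [- |x|, |x|]. *)
- move=> x xs; rewrite lt_neqAle wle0 andbT; apply/eqP => wx0.
  have : support_of w `<=` `[- `|x|, `|x|].
    rewrite /support_of [X in _ `<=` X](closure_id _).1; last exact: interval_closed.
    apply: closureS => y /= wy; rewrite in_itv/= -ler_norml leNgt; apply/negP => xy.
    move: wy => /eqP; apply; apply/eqP; rewrite eq_le wle0/= -wx0; apply: mono; exact: ltW.
  rewrite wsupp => /(_ s); rewrite /= !in_itv/= lexx andbT => /(_ _)/andP[|_].
    by rewrite ge0_cp// ltW.
  by rewrite leNgt xs.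
- have [dw dw1] : (\forall x \near (0 : R), derivable w x 1) /\ derivable (derive1 w) 0 1.
    split; first by apply: filterS wC2 => x [].
    have /nbhs_normP[r /= r0 hr] := wC2.
    have h0 : `|0 - 0 : R| < r by rewrite subrr normr0.
    case: (hr 0 h0) => _ h1 _; exact h1.
  apply: even_C2_taylor => //.
Qed.

Lemma inf_range_min w : (forall x, w 0 <= w x) -> inf (range w) = w 0.
Proof.
move=> h; apply/eqP; rewrite eq_le; apply/andP; split.
  by apply: ge_inf; [exists (w 0) => _ [x _ <-]|exists 0].
by apply: lb_le_inf; [exists (w 0), 0|move=> _ [x _ <-]].
Qed.

Section bounds.
Variables (w : R -> R) (s L k : R).
Hypothesis cw : clump_well w s L k.

Lemma cw_min x : w 0 <= w x.
Proof. by apply: (cw_mono cw); rewrite normr0. Qed.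

Lemma cw_le0 x : w x <= 0.
Proof.
have [h|h] := leP s `|x|; first by rewrite (cw_out cw).
by rewrite ltW// (cw_in cw).
Qed.

Lemma cw_bound x : `|w x| <= - w 0.
Proof. by rewrite ler0_norm ?cw_le0// lerN2 cw_min. Qed.

Lemma cw_w0 : w 0 < 0.
Proof. by apply: (cw_in cw); rewrite normr0 (cw_s cw). Qed.

Lemma cw_continuous : continuous w.
Proof. exact: continuous_of_lipschitz (cw_lip cw). Qed.

Lemma cw_measurable : measurable_fun setT w.
Proof. exact: continuous_measurable_fun cw_continuous. Qed.

(** The Taylor expansion gives both bounds near 0; elsewhere the upper one
    holds since w is bounded, the lower one since w is monotone and differs from
    its minimum. *)
Lemma cw_quadratic : exists K c, [/\ 0 < K, 0 < c,
  forall x, w x - w 0 <= K * x ^+ 2 &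
  forall x, `|x| <= s -> c * x ^+ 2 <= w x - w 0].
Proof.
have k0 := cw_k cw; have s0 := cw_s cw.
have /cvgrPdist_le/(_ (k / 4)) := cw_taylor cw.
rewrite divr_gt0// => /(_ isT); rewrite near_withinE => /nbhs_normP[r /= r0 hr].
pose q := Num.min (r / 2) s; have q0 : 0 < q by rewrite lt_min divr_gt0.
have qr : q < r by rewrite gt_min ltr_pdivrMr// mulr_natr mulr2n ltrDl r0.
have qs : q <= s by rewrite ge_min lexx orbT.
have near0 x : `|x| <= q -> k / 4 * x ^+ 2 <= w x - w 0 <= k * x ^+ 2.
  move=> xq; have [->|x0] := eqVneq x 0; first by rewrite subrr expr0n !mulr0 lexx.
  have x2 : 0 < x ^+ 2 by rewrite exprn_even_gt0.
  have := hr x; rewrite /= sub0r normrN => /(_ (le_lt_trans xq qr) x0).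
  rewrite ler_norml => /andP[h1 h2].
  by apply/andP; split; [rewrite -ler_pdivlMr//|rewrite -ler_pdivrMr//]; move: k0 h1 h2; lra.
exists (k + - w 0 / q ^+ 2), (k / 4 * (q / s) ^+ 2).
have w0 : 0 < - w 0 by rewrite oppr_gt0 cw_w0.
have q2 : 0 < q ^+ 2 by exact: exprn_gt0.
have x20 (x : R) : 0 <= x ^+ 2 by exact: sqr_ge0.
split.
- by rewrite addr_gt0// divr_gt0.
- by rewrite mulr_gt0 ?divr_gt0// exprn_gt0// divr_gt0.
- move=> x; rewrite mulrDl; have [xq|xq] := leP `|x| q.
    have /andP[_ h] := near0 x xq; rewrite (le_trans h)// lerDl mulr_ge0// divr_ge0// ltW//.
  have := cw_le0 x => wx; rewrite (@le_trans _ _ (- w 0))//; first by lra.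
  rewrite (@le_trans _ _ (- w 0 / q ^+ 2 * x ^+ 2))//; last by rewrite lerDr mulr_ge0// ltW.
  rewrite -mulrA ler_peMr ?(ltW w0)// mulrC ler_pdivlMr// mul1r.
  by rewrite -[x ^+ 2]real_normK ?num_real// lerXn2r ?nnegrE ?(ltW q0)// ltW.
- move=> x xs; have [xq|xq] := leP `|x| q.
    have /andP[h _] := near0 x xq; rewrite (le_trans _ h)// ler_wpM2r//.
    rewrite ger_pMr ?divr_gt0// exprn_ile1//; first by rewrite divr_ge0 ?ltW.
    by rewrite ler_pdivrMr// mul1r.
  rewrite (@le_trans _ _ (w q - w 0))//; last first.
    by rewrite lerD2r (cw_mono cw)// gtr0_norm// ltW.
  have qq : `|q| <= q by rewrite gtr0_norm.
  have /andP[h _] := near0 q qq; rewrite (le_trans _ h)//.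
  rewrite -[leLHS]mulrA; apply: ler_wpM2l; first by rewrite divr_ge0// ltW.
  rewrite expr_div_n -mulrA ler_piMr ?(ltW q2)// mulrC ler_pdivrMr ?exprn_gt0// mul1r.
  by rewrite -[x ^+ 2]real_normK ?num_real// lerXn2r ?nnegrE ?(ltW s0).
Qed.

End bounds.
End clump_well_theory.

(** * Convolutions *)

Section convolution.
Context {R : realType}.
Local Notation mu := (@lebesgue_measure R).
Local Notation std := (@normal_prob R 0 1).
Implicit Types (f rho : R -> R).

Lemma Rintegral_sum d (T : measurableType d) (m : {measure set T -> \bar R})
    (D : set T) (mD : measurable D) (I : eqType) (r : seq I) (F : I -> T -> R) :
  (forall i, i \in r -> m.-integrable D (fun x => (F i x)%:E)) ->
  m.-integrable D (fun x => (\sum_(i <- r) F i x)%:E) /\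
  \int[m]_(x in D) (\sum_(i <- r) F i x) = \sum_(i <- r) \int[m]_(x in D) F i x.
Proof.
elim: r => [|i r IH] H.
  rewrite big_nil; split.
    apply: eq_integrable (integrable0 m D) => // x _; by rewrite big_nil.
  rewrite /Rintegral (eq_integral (cst 0%E)) ?integral0// => x _; by rewrite big_nil.
have [|i1 e1] := IH; first by move=> k kr; apply: H; rewrite in_cons kr orbT.
have i2 := H i (mem_head _ _); split.
  by under eq_fun do rewrite big_cons; exact: integrable_addr.
rewrite big_cons -e1 -RintegralD//.
by apply: eq_Rintegral => x _; rewrite big_cons.
Qed.

Lemma integral_reflect (F : R -> \bar R) (x : R) : measurable_fun setT F ->
  (\int[mu]_y F y = \int[mu]_z F (x - z)%R)%E.
Proof.
move=> mF; have N10 : -1 != 0 :> R by rewrite oppr_eq0 oner_eq0.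
have key (G : R -> \bar R) : measurable_fun setT G -> (forall y, 0 <= G y)%E ->
    (\int[mu]_y G y = \int[mu]_z G (x - z)%R)%E.
  move=> mG G0; rewrite (ge0_integral_affine x N10 mG G0) normrN1 mul1e.
  by apply: eq_integral => z _; rewrite mulN1r addrC.
rewrite [LHS]integralE [RHS]integralE.
rewrite (key _ (measurable_funepos mF) (funepos_ge0 _)).
rewrite (key _ (measurable_funeneg mF) (funeneg_ge0 _)).
by congr (_ - _)%E; apply: eq_integral => z _; rewrite ?funeposE ?funenegE.
Qed.

(** The change of variables holds for nonnegative functions, hence for f + C. *)
Lemma Rintegral_normal_density f (m s C : R) : s != 0 -> measurable_fun setT f ->
  (forall x, `|f x| <= C) ->
  mu.-integrable setT (fun y => (f y * normal_pdf m s y)%:E) /\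
  \int[mu]_y (f y * normal_pdf m s y) = \int[std]_u f (s * u + m).
Proof.
move=> s0 mf fC.
have C0 : 0 <= C by exact: le_trans (fC 0).
have mp := measurable_normal_pdf m s.
have ip := @integrable_normal_pdf R m s.
have i2 : mu.-integrable setT (fun y => (C * normal_pdf m s y)%:E) by exact: integrable_scaler.
have i1 : mu.-integrable setT (fun y => (f y * normal_pdf m s y)%:E).
  apply: (integrable_le_real measurableT _ i2); first exact: measurable_funM.
  by move=> y _; rewrite normrM (ger0_norm (normal_pdf_ge0 _ _ _)) ler_wpM2r// normal_pdf_ge0.
split; first exact: i1.
have fC0 y : 0 <= f y + C by have := fC y; rewrite ler_norml; lra.
have mfC : measurable_fun setT (fun y => f y + C) by exact: measurable_funD.
have mfa : measurable_fun setT (fun u : R => f (s * u + m)).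
  exact (measurableT_comp mf (measurable_affine s m)).
have i3 : std.-integrable setT (fun u => (f (s * u + m))%:E).
  exact: integrable_std_le (integrable_std_cst C) _.
have : \int[mu]_y ((f y + C) * normal_pdf m s y) = \int[std]_u (f (s * u + m) + C).
  rewrite /Rintegral; congr fine.
  rewrite -(@ge0_integral_normal_std _ m s (fun y => (f y + C)%:E)) ?ge0_integral_normal_prob//.
  - exact/measurable_EFinP.
  - exact/measurable_EFinP.
under eq_Rintegral do rewrite mulrDl.
have -> := RintegralD measurableT i1 i2.
have -> := RintegralD measurableT i3 (integrable_std_cst C).
rewrite RintegralZl// std_int_cst /Rintegral integral_normal_pdf /= mulr1.
by move/addIr.
Qed.

Lemma integrable_convolved f rho (C x : R) : measurable_fun setT rho ->
  mu.-integrable setT (fun z => (f z)%:E) -> (forall x, `|rho x| <= C) ->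
  mu.-integrable setT (fun z => (f z * rho (x - z))%:E).
Proof.
move=> mrho fi rC.
have mf : measurable_fun setT f by apply/measurable_EFinP; exact: (measurable_int _ fi).
have i2 : mu.-integrable setT (fun z => (C * `|f z|)%:E).
  by apply: integrable_scaler => //; exact: integrable_normr.
apply: (integrable_le_real measurableT _ i2).
  have mx : measurable_fun setT (fun z : R => x - z) by exact: measurable_funB.
  by apply: measurable_funM; [exact mf|exact (measurableT_comp mrho mx)].
by move=> z _; rewrite normrM mulrC ler_wpM2r.
Qed.

(** The regularity comes from rho, the function f being only integrable; so
    V_eff has a Lipschitz derivative although w is merely Lipschitz. *)
Lemma convolution_C11 f rho rho1 (C : R) : mu.-integrable setT (fun z => (f z)%:E) ->
  bounded_C11 C rho rho1 ->
  bounded_C11 (C * \int[mu]_z `|f z|) (fun x => \int[mu]_z (f z * rho (x - z)))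
    (fun x => \int[mu]_z (f z * rho1 (x - z))).
Proof.
move=> fi [dr rC r1C r1l].
have mrho : measurable_fun setT rho.
  by apply: continuous_measurable_fun; exact: is_derive_continuous dr.
have mrho1 : measurable_fun setT rho1.
  by apply: continuous_measurable_fun; exact: continuous_of_lipschitz r1l.
have nfi : mu.-integrable setT (fun z => `|f z|%:E) by exact: integrable_normr.
have bnd (g : R -> R) (B : R) : mu.-integrable setT (fun z => (f z * g z)%:E) ->
    (forall z, `|g z| <= B) -> `|\int[mu]_z (f z * g z)| <= B * \int[mu]_z `|f z|.
  move=> gi gB; rewrite (le_trans (le_normr_Rintegral _ _))//.
  rewrite -RintegralZl//; apply: le_Rintegral => //.
  - exact: integrable_normr.
  - exact: integrable_scaler.
  - by move=> z _; rewrite normrM mulrC ler_wpM2r.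
have i0 x := integrable_convolved x mrho fi rC.
have i1 x := integrable_convolved x mrho1 fi r1C.
split.
- move=> x; apply: (@is_derive_of_quadratic _ _ _ _ (C * \int[mu]_z `|f z|)) => k.
  have iA : mu.-integrable setT (fun z => (f z * rho (x + k - z) - f z * rho (x - z))%:E).
    exact: (integrable_subr measurableT (i0 (x + k)) (i0 x)).
  have iB : mu.-integrable setT (fun z => (k * (f z * rho1 (x - z)))%:E).
    exact: (integrable_scaler measurableT k (i1 x)).
  have <- := RintegralZl k measurableT (i1 x).
  have <- := RintegralB measurableT (i0 (x + k)) (i0 x).
  have <- := RintegralB measurableT iA iB.
  pose g z := rho (x + k - z) - rho (x - z) - k * rho1 (x - z).
  have ig : mu.-integrable setT (fun z => (f z * g z)%:E).
    have := integrable_subr measurableT iA iB; apply: eq_integrable => // z _.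
    by congr EFin; rewrite /g; ring.
  have gB z : `|g z| <= C * k ^+ 2.
    have := taylor1 dr r1l (x - z) k.
    by rewrite (_ : x - z + k = x + k - z); last by ring.
  rewrite mulrAC; apply: le_trans (bnd g _ ig gB).
  rewrite le_eqVlt; apply/orP; left; apply/eqP; congr (`|_|).
  by apply: eq_Rintegral => z _; rewrite /g; ring.
- by move=> x; exact: bnd.
- by move=> x; exact: bnd.
- move=> x y; have <- := RintegralB measurableT (i1 x) (i1 y).
  pose g z := rho1 (x - z) - rho1 (y - z).
  have ig : mu.-integrable setT (fun z => (f z * g z)%:E).
    have := integrable_subr measurableT (i1 x) (i1 y); apply: eq_integrable => // z _.
    by congr EFin; rewrite /g; ring.
  have gB z : `|g z| <= C * `|x - y|.
    by rewrite (le_trans (r1l _ _))// (_ : x - z - (y - z) = x - y)//; ring.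
  rewrite mulrAC; apply: le_trans (bnd g _ ig gB).
  rewrite le_eqVlt; apply/orP; left; apply/eqP; congr (`|_|).
  by apply: eq_Rintegral => z _; rewrite /g; ring.
Qed.

End convolution.

(** * The effective potential *)

Section effective_potential.
Context {R : realType}.
Local Notation mu := (@lebesgue_measure R).
Variables (w : R -> R) (s L k : R) (cw : clump_well w s L k).
Hypothesis wk : derive1n 2 w 0 = k.
Variables (ell : R) (K : nat) (X m : nat -> R) (gamma : R).
Hypotheses (ell0 : 0 < ell) (gamma0 : 0 < gamma)
  (m0 : forall i, (1 <= i < K.+1)%N -> 0 < m i).

(** The standard deviation of clump i in units of ell.  The choice of sigma2
    makes gamma * ell * m i equal to 1 / (k * noise i ^ 2). *)
Definition noise (i : nat) : R := Num.sqrt (sigma2 w ell gamma (m i)) / ell.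

Lemma sigma2_gt0 i : (1 <= i < K.+1)%N -> 0 < sigma2 w ell gamma (m i).
Proof.
move=> iK; rewrite /sigma2 wk divr_gt0// mulr_gt0 ?m0// mulr_gt0// (cw_k cw)//.
Qed.

Lemma noise_gt0 i : (1 <= i < K.+1)%N -> 0 < noise i.
Proof. by move=> iK; rewrite divr_gt0// sqrtr_gt0 sigma2_gt0. Qed.

Lemma noise_sqr i : (1 <= i < K.+1)%N ->
  noise i ^+ 2 = (gamma * k * m i * ell)^-1.
Proof.
move=> iK; rewrite /noise expr_div_n sqr_sqrtr ?(ltW (sigma2_gt0 iK))// /sigma2 wk.
have := cw_k cw; have := m0 iK => mi k0; field.
by rewrite !gt_eqF.
Qed.

Let f z := gamma * ell * w (z / ell).

Let mf : measurable_fun setT f.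
Proof.
have mz : measurable_fun setT (fun z : R => z / ell) by exact: measurable_funM.
by apply: measurable_funM => //; exact (measurableT_comp (cw_measurable cw) mz).
Qed.

Let C : R := gamma * ell * - w 0.

Let fC x : `|f x| <= C.
Proof.
have ge0 : 0 <= gamma * ell by rewrite mulr_ge0// ltW.
rewrite normrM (ger0_norm ge0) /C ler_wpM2l//.
exact: cw_bound cw _.
Qed.

Let index_iotaP i : i \in index_iota 1 K.+1 -> (1 <= i < K.+1)%N.
Proof. by rewrite mem_index_iota. Qed.

Lemma V_effE x : V_eff w ell K X m gamma x =
  \sum_(1 <= i < K.+1) m i * (gamma * ell * smoothing w ((x - X i) / ell) (noise i)).
Proof.
rewrite /V_eff /convolution /rho.
have mh : measurable_fun setT (fun y : R => f (x - y)).
  have mx : measurable_fun setT (fun y : R => x - y) by exact: measurable_funB.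
  exact (measurableT_comp mf mx).
have H i : (1 <= i < K.+1)%N ->
    mu.-integrable setT (fun y => (f (x - y) * gauss (X i) (sigma2 w ell gamma (m i)) y)%:E) /\
    \int[mu]_y (f (x - y) * gauss (X i) (sigma2 w ell gamma (m i)) y) =
    gamma * ell * smoothing w ((x - X i) / ell) (noise i).
  move=> iK.
  have sn0 : Num.sqrt (sigma2 w ell gamma (m i)) != 0.
    by rewrite gt_eqF// sqrtr_gt0 sigma2_gt0.
  have [i1 ->] := Rintegral_normal_density (X i) sn0 mh (fun y => fC (x - y)).
  split; first exact: i1.
  rewrite /smoothing -RintegralZl//; last first.
    exact: integrable_smoothed (cw_measurable cw) (cw_bound cw).
  apply: eq_Rintegral => u _; rewrite /f /noise; congr (_ * _ * w _).
  by field; rewrite gt_eqF.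
have iF i : i \in index_iota 1 K.+1 -> mu.-integrable setT
    (fun y => (m i * (f (x - y) * gauss (X i) (sigma2 w ell gamma (m i)) y))%:E).
  by move=> /index_iotaP /H[i1 _]; exact: (integrable_scaler measurableT (m i) i1).
have [_ E] := Rintegral_sum measurableT iF.
transitivity (\int[mu]_y \sum_(1 <= i < K.+1)
    (m i * (f (x - y) * gauss (X i) (sigma2 w ell gamma (m i)) y))).
  by apply: eq_Rintegral => y _; rewrite mulr_sumr; apply: eq_bigr => i _; rewrite mulrCA.
rewrite E big_seq [RHS]big_seq; apply: eq_bigr => i /index_iotaP iK.
have [i1 <-] := H i iK.
by have := RintegralZl (m i) measurableT i1.
Qed.

Lemma V_eff_le0 x : V_eff w ell K X m gamma x <= 0.
Proof.
rewrite V_effE big_seq sumr_le0// => i /index_iotaP iK.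
apply: mulr_ge0_le0; first exact: ltW (m0 iK).
apply: mulr_ge0_le0; first by rewrite mulr_ge0// ltW.
exact (smoothing_le0 _ _ (cw_measurable cw) (cw_bound cw) (cw_le0 cw)).
Qed.

(** By reflection, V_eff is the convolution of the integrable function
    gamma ell w (. / ell) with the Gaussian mixture rho. *)
Lemma V_eff_C11 : exists C V1, bounded_C11 C (V_eff w ell K X m gamma) V1.
Proof.
have [C1 [r1 c11]] : exists C r1, bounded_C11 C (rho w ell K X m gamma) r1.
  have H i : exists C dg, (1 <= i < K.+1)%N ->
      bounded_C11 C (fun x => m i * gauss (X i) (sigma2 w ell gamma (m i)) x) dg.
    case: (boolP (1 <= i < K.+1)%N) => iK; last by exists 0, (fun=> 0).
    have sn0 : 0 < Num.sqrt (sigma2 w ell gamma (m i)) by rewrite sqrtr_gt0 sigma2_gt0.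
    have [D [dg h]] := bounded_C11_normal_pdf (X i) sn0.
    exists (`|m i| * D), (fun x => m i * dg x) => _.
    exact: (bounded_C11_scale (m i) h).
  have [dg Hdg] : exists dg : nat -> R -> R, forall i, (1 <= i < K.+1)%N -> exists C,
      bounded_C11 C (fun x => m i * gauss (X i) (sigma2 w ell gamma (m i)) x) (dg i).
    have [CC HH] := choice H; have [dg hdg] := choice HH.
    by exists dg => i iK; exists (CC i); exact: hdg.
  have [D hD] := bounded_C11_sum (fun i (h : i \in index_iota 1 K.+1) => Hdg i (index_iotaP h)).
  by exists D, (fun x => \sum_(1 <= i < K.+1) dg i x).
have fi : mu.-integrable setT (fun z => (f z)%:E).
  have i0 : mu.-integrable setT (fun z => (C * \1_(`[- (s * ell), s * ell]) z)%:E).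
    exact: (integrable_scaler measurableT C (integrable_indic_itv _ _ _ _)).
  apply: (integrable_le_real measurableT _ i0) => [|z _]; first exact: mf.
  have [zs|zs] := leP `|z| (s * ell).
    rewrite indicE mem_set ?mulr1//=.
    by rewrite in_itv/= -ler_norml.
  rewrite /f (cw_out cw); last by rewrite normrM normfV (gtr0_norm ell0) ler_pdivlMr// ltW.
  by rewrite mulr0 normr0 mulr_ge0// (le_trans _ (fC 0)).
exists (C1 * \int[mu]_z `|f z|), (fun x => \int[mu]_z (f z * r1 (x - z))).
suff -> : V_eff w ell K X m gamma = (fun x => \int[mu]_z (f z * rho w ell K X m gamma (x - z))).
  exact: convolution_C11.
apply/funext => x; rewrite /V_eff /convolution /Rintegral; congr fine.
have mr : measurable_fun setT (rho w ell K X m gamma).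
  by apply: continuous_measurable_fun; case: c11 => dr _ _ _; exact: is_derive_continuous dr.
rewrite (@integral_reflect _ (fun y => (f (x - y) * rho w ell K X m gamma y)%:E) x).
  by apply: eq_integral => z _; congr (_ * _)%:E; congr f; ring.
have mx : measurable_fun setT (fun y : R => x - y) by exact: measurable_funB.
apply/measurable_EFinP; apply: measurable_funM; last exact: mr.
exact (measurableT_comp mf mx).
Qed.

End effective_potential.

(** * The contribution of each clump for large gamma *)

Lemma cvg_sum_seq {R : realType} (I : eqType) (r : seq I) (f : I -> nat -> R) (l : I -> R) :
  (forall i, i \in r -> f i n @[n --> \oo] --> l i) ->
  \sum_(i <- r) f i n @[n --> \oo] --> \sum_(i <- r) l i.
Proof.
elim: r => [|i r IH] H.
  by rewrite big_nil; under eq_fun do rewrite big_nil; exact: cvg_cst.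
rewrite big_cons; under eq_fun do rewrite big_cons.
apply: cvgD; first exact: H (mem_head _ _).
by apply: IH => k kr; apply: H; rewrite in_cons kr orbT.
Qed.

Section asymptotics.
Context {R : realType}.
Local Notation std := (@normal_prob R 0 1).
Variables (w : R -> R) (s L k : R) (cw : clump_well w s L k).
Hypothesis wk : derive1n 2 w 0 = k.
Variables (ell : R) (K : nat) (X m : nat -> R).
Hypotheses (ell0 : 0 < ell) (m0 : forall i, (1 <= i < K.+1)%N -> 0 < m i).

Let s0 := cw_s cw.
Let k0 := cw_k cw.
Let w00 := cw_w0 cw.

Local Notation eps gamma i := (noise w ell m gamma i).
Local Notation V := (V_eff w ell K X m).

Definition clump_term (gamma : R) (i : nat) (x : R) : R :=
  m i * (gamma * ell * smoothing w ((x - X i) / ell) (eps gamma i)).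

Lemma V_eff_sum gamma x : 0 < gamma ->
  V gamma x = \sum_(1 <= i < K.+1) clump_term gamma i x.
Proof. by move=> g0; exact: (V_effE cw wk X ell0 g0 m0 x). Qed.

(** The noise at gamma = 1. *)
Definition kap i : R := Num.sqrt (k * m i * ell)^-1.

Lemma noiseE gamma i : 0 < gamma -> (1 <= i < K.+1)%N ->
  eps gamma i = kap i / Num.sqrt gamma.
Proof.
move=> g0 iK; have n0 := noise_gt0 cw wk ell0 g0 m0 iK.
have n2 := noise_sqr cw wk ell0 g0 m0 iK; have mi := m0 iK.
apply/eqP; rewrite -(@eqrXn2 _ 2) ?(ltW n0)// ?divr_ge0 ?sqrtr_ge0//.
apply/eqP; rewrite n2 expr_div_n !sqr_sqrtr ?ltW ?invr_gt0 ?mulr_gt0//.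
by field; rewrite !gt_eqF.
Qed.

Lemma kap_gt0 i : (1 <= i < K.+1)%N -> 0 < kap i.
Proof. by move=> iK; rewrite sqrtr_gt0 invr_gt0 !mulr_gt0// m0. Qed.

Lemma clump_termE gamma i x : 0 < gamma -> (1 <= i < K.+1)%N ->
  clump_term gamma i x =
  smoothing w ((x - X i) / ell) (eps gamma i) / (k * eps gamma i ^+ 2).
Proof.
move=> g0 iK; rewrite /clump_term (noise_sqr cw wk ell0 g0 m0 iK).
by have mi := m0 iK; field; rewrite !gt_eqF.
Qed.

Lemma clump_term_le0 gamma i x : 0 < gamma -> (1 <= i < K.+1)%N ->
  clump_term gamma i x <= 0.
Proof.
move=> g0 iK; rewrite /clump_term.
apply: mulr_ge0_le0; first exact: ltW (m0 iK).
apply: mulr_ge0_le0; first by rewrite mulr_ge0// ltW.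
exact (smoothing_le0 _ _ (cw_measurable cw) (cw_bound cw) (cw_le0 cw)).
Qed.

Definition far_const (eta : R) : R :=
  - w 0 / eta ^+ 3 * \int[std]_x (`|x| ^+ 3) / k.

Lemma far_const_ge0 eta : 0 < eta -> 0 <= far_const eta.
Proof.
move=> e0; rewrite /far_const !mulr_ge0 ?invr_ge0 ?exprn_ge0 ?oppr_ge0 ?(ltW e0) ?(ltW k0) ?(ltW w00)//.
by apply: Rintegral_ge0 => x _; rewrite exprn_ge0.
Qed.

(** The prefactor of a clump is of order noise ^ (-2), and the smoothing of w far
    from its support is of order noise ^ 3. *)
Lemma clump_term_far gamma i x eta : 0 < gamma -> (1 <= i < K.+1)%N ->
  0 < eta -> (s + eta) * ell <= `|x - X i| ->
  - clump_term gamma i x <= far_const eta * eps gamma i.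
Proof.
move=> g0 iK e0 far; have n0 := noise_gt0 cw wk ell0 g0 m0 iK.
have h : s + eta <= `|(x - X i) / ell|.
  by rewrite normrM normfV (gtr0_norm ell0) ler_pdivlMr.
have := smoothing_far (eps gamma i) (cw_measurable cw) (cw_bound cw) (cw_out cw) e0 h.
rewrite (clump_termE _ g0 iK) (gtr0_norm n0) => H.
have ke0 : 0 < k * eps gamma i ^+ 2 by rewrite mulr_gt0// exprn_gt0.
rewrite -mulNr ler_pdivrMr//; apply: le_trans (le_trans (ler_norm _) _) _.
  by rewrite normrN; exact: H.
rewrite le_eqVlt; apply/orP; left; apply/eqP; rewrite /far_const.
by field; rewrite !gt_eqF.
Qed.

(** The prefactor of the clump is of order gamma and the smoothing moves w by
    at most a multiple of its width, of order 1 / sqrt gamma. *)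
Lemma clump_term_lipschitz gamma i x : 0 < gamma -> (1 <= i < K.+1)%N ->
  `|clump_term gamma i x - m i * (gamma * ell * w ((x - X i) / ell))| <=
  L * (m i * ell * kap i * \int[std]_x `|x|) * Num.sqrt gamma.
Proof.
move=> g0 iK; have n0 := noise_gt0 cw wk ell0 g0 m0 iK.
have := smoothing_lipschitz ((x - X i) / ell) (eps gamma i) (cw_measurable cw) (cw_bound cw) (cw_lip cw).
rewrite /clump_term -!mulrBr => H.
have mi := m0 iK.
rewrite !normrM (gtr0_norm mi) (gtr0_norm g0) (gtr0_norm ell0).
have c0 : 0 <= m i * (gamma * ell) by rewrite !mulr_ge0// ltW.
rewrite mulrA (le_trans (ler_wpM2l c0 H))// (gtr0_norm n0) noiseE//.
have sg : Num.sqrt gamma ^+ 2 = gamma by rewrite sqr_sqrtr// ltW.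
rewrite -{1}sg le_eqVlt; apply/orP; left; apply/eqP.
by field; rewrite gt_eqF// sqrtr_gt0.
Qed.

Section sequence.
Variable gam : nat -> R.
Hypotheses (gam1 : forall n, 1 <= gam n) (gamy : gam n @[n --> \oo] --> +oo).

Let gam0 n : 0 < gam n.
Proof. exact: lt_le_trans ltr01 (gam1 n). Qed.

Let t n := Num.sqrt (gam n).

Let t1 n : 1 <= t n.
Proof. by rewrite -[leLHS]sqrtr1; exact: ler_wsqrtr. Qed.

Lemma sqrt_cvgy : t n @[n --> \oo] --> +oo.
Proof.
move/cvgryPge : gamy => gamy'; apply/cvgryPge => A; near=> n.
have : A ^+ 2 <= gam n by near: n; exact: gamy'.
have [A0|A0] := leP 0 A.
  by move=> h; rewrite -[A]ger0_norm// -sqrtr_sqr; exact: ler_wsqrtr.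
by move=> _; rewrite (le_trans (ltW A0))// sqrtr_ge0.
Unshelve. all: by end_near. Qed.

Lemma noise_le n i : (1 <= i < K.+1)%N -> eps (gam n) i <= kap i.
Proof.
move=> iK; rewrite noiseE//; rewrite ler_pdivrMr ?(lt_le_trans ltr01 (t1 n))//.
by apply: ler_peMr; [exact: ltW (kap_gt0 iK)|exact: t1].
Qed.

Lemma noise_cvg0 i : (1 <= i < K.+1)%N -> eps (gam n) i @[n --> \oo] --> 0.
Proof.
move=> iK; have -> : (fun n => eps (gam n) i) = (fun n => kap i * (t n)^-1).
  by apply/funext => n; rewrite noiseE.
rewrite -[X in _ --> X](mulr0 (kap i)); apply: cvgM; first exact: cvg_cst.
apply/(gtr0_cvgV0 _).2; last exact: sqrt_cvgy.
by apply: nearW => n; rewrite (lt_le_trans ltr01 (t1 n)).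
Qed.

Lemma expV_le1 n x : 0 < expR (V (gam n) x) <= 1.
Proof.
by rewrite expR_gt0/= -expR0 ler_expR (V_eff_le0 cw wk X ell0 (gam0 n) m0).
Qed.

Lemma expV_gap x : (forall i, (1 <= i < K.+1)%N -> s * ell < `|x - X i|) ->
  expR (V (gam n) x) @[n --> \oo] --> (1 : R).
Proof.
move=> far.
have lim : V (gam n) x @[n --> \oo] --> 0.
  have -> : (fun n => V (gam n) x) = (fun n => \sum_(1 <= i < K.+1) clump_term (gam n) i x).
    by apply/funext => n; rewrite V_eff_sum.
  rewrite [X in _ --> X](_ : _ = \sum_(1 <= i < K.+1) (0 : R)); last by rewrite big1.
  apply: (@cvg_sum_seq _ _ _ (fun i n => clump_term (gam n) i x)) => i.
  rewrite mem_index_iota => iK.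
  pose eta := `|x - X i| / ell - s.
  have eta0 : 0 < eta by rewrite subr_gt0 ltr_pdivlMr// far.
  have H n : - (far_const eta * eps (gam n) i) <= clump_term (gam n) i x <= 0.
    rewrite clump_term_le0// andbT lerNl clump_term_far// /eta addrC subrK divfK// gt_eqF//.
  apply: (@squeeze_cvgr _ _ _ _ (fun n => - (far_const eta * eps (gam n) i)) (fun=> 0));
    [exact: nearW H | | exact: cvg_cst].
  rewrite -[X in _ --> X]oppr0 -[X in _ --> - X](mulr0 (far_const eta)).
  by apply: cvgN; apply: cvgM; [exact: cvg_cst|exact: noise_cvg0].
have := cvg_comp _ expR lim (@continuous_expR R 0).
by rewrite expR0.
Qed.

(** The potential is at most - A gamma + B sqrt gamma, A > 0 coming from clump i
    and B sqrt gamma from its smoothing; the other clumps only lower it. *)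
Lemma expV_well x i : (1 <= i < K.+1)%N -> `|x - X i| < s * ell ->
  expR (V (gam n) x) @[n --> \oo] --> (0 : R).
Proof.
move=> iK xi; pose z := (x - X i) / ell.
have zs : `|z| < s by rewrite normrM normfV (gtr0_norm ell0) ltr_pdivrMr.
have wz := cw_in cw zs; have mi := m0 iK.
pose B := L * (m i * ell * kap i * \int[std]_x `|x|).
pose A := m i * ell * - w z.
have A0 : 0 < A by rewrite !mulr_gt0// oppr_gt0.
have H n : V (gam n) x <= - (A * t n ^+ 2 - B * t n).
  rewrite V_eff_sum// (big_rem i) ?mem_index_iota//=.
  have : \sum_(y <- rem i (index_iota 1 K.+1)) clump_term (gam n) y x <= 0.
    rewrite big_seq sumr_le0// => y /mem_rem; rewrite mem_index_iota => yK.
    exact: clump_term_le0.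
  have := clump_term_lipschitz x (gam0 n) iK; rewrite ler_norml => /andP[_].
  rewrite -/B -/z -/(t n); have tn : t n ^+ 2 = gam n by rewrite sqr_sqrtr// ltW.
  by rewrite -tn /A; lra.
have lim : expR (- (A * t n ^+ 2 - B * t n)) @[n --> \oo] --> 0.
  apply: (cvg_comp _ (fun y => expR (- y)) _ (@cvgr_expR R)).
  move/cvgryPge : sqrt_cvgy => ty; apply/cvgryPge => D; near=> n.
  have h : (`|D| + 1 + `|B|) / A + 1 <= t n by near: n; exact: ty.
  have : (`|D| + 1 + `|B|) / A <= t n - 1 by lra.
  rewrite ler_pdivrMr// => h2; have := t1 n; have := ler_norm D; have := ler_norm B.
  have := normr_ge0 D; nra.
apply: (squeeze_cvgr _ (cvg_cst 0) lim); apply: nearW => n.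
by rewrite expR_ge0/= ler_expR.
Unshelve. all: by end_near. Qed.

End sequence.
End asymptotics.

(** * Positions of the clumps *)

Section indices.
Variables (K j : nat) (hj : (2 <= j <= K.-1)%N).

Lemma index_pred : j.-1.+1 = j. Proof. by move: hj; lia. Qed.
Lemma index_left : (1 <= j.-1 < K.+1)%N. Proof. by move: hj; lia. Qed.
Lemma index_mid : (1 <= j < K.+1)%N. Proof. by move: hj; lia. Qed.
Lemma index_right : (1 <= j.+1 < K.+1)%N. Proof. by move: hj; lia. Qed.
Lemma index_gap_left : (1 <= j.-1 < K)%N. Proof. by move: hj; lia. Qed.
Lemma index_gap_right : (1 <= j < K)%N. Proof. by move: hj; lia. Qed.

End indices.

Section neighbours.
Context {R : realType}.
Variables (s ell alpha : R) (K j : nat) (X : nat -> R).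
Hypotheses (s0 : 0 < s) (ell0 : 0 < ell) (hj : (2 <= j <= K.-1)%N)
  (al0 : 0 < alpha) (als : alpha < s)
  (gap : forall i, (1 <= i < K)%N -> 2 * s * ell < X i.+1 - X i).

Let jmS : j.-1.+1 = j. Proof. exact: index_pred hj. Qed.
Let sl0 : 0 < 2 * s * ell. Proof. by rewrite !mulr_gt0. Qed.

Lemma gap_left : 2 * s * ell < X j - X j.-1.
Proof. by have := gap (index_gap_left hj); rewrite jmS. Qed.

Lemma gap_right : 2 * s * ell < X j.+1 - X j.
Proof. exact: gap (index_gap_right hj). Qed.

Lemma separation i i' : (1 <= i)%N -> (i < i')%N -> (i' < K.+1)%N ->
  2 * s * ell < X i' - X i.
Proof.
move=> i1; elim: i' => // i' IH; rewrite ltnS leq_eqVlt => /orP[/eqP <-|ii] iK.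
  by apply: gap; rewrite i1.
have i'K : (1 <= i' < K)%N by rewrite (leq_trans i1 (ltnW ii)).
have := IH ii (ltnW iK); have := gap i'K.
have : 0 < 2 * s * ell by rewrite !mulr_gt0.
by lra.
Qed.

Lemma position_lt i i' : (1 <= i)%N -> (i < i')%N -> (i' < K.+1)%N -> X i < X i'.
Proof.
move=> i1 ii iK; have := separation i1 ii iK; have := sl0.
by lra.
Qed.

(** Points of the middle well are at distance at least (s + clearance) * ell from
    every other clump. *)
Definition clearance : R := Num.min (X j - X j.-1) (X j.+1 - X j) / ell - 2 * s.

Lemma clearance_gt0 : 0 < clearance.
Proof. by rewrite subr_gt0 ltr_pdivlMr// lt_min gap_left gap_right. Qed.

Lemma far_from_others x i : (1 <= i < K.+1)%N -> i != j ->
  `|x - X j| <= s * ell -> (s + clearance) * ell <= `|x - X i|.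
Proof.
move=> /andP[i1 iK] ij; rewrite ler_norml => /andP[h1 h2].
have -> : (s + clearance) * ell = Num.min (X j - X j.-1) (X j.+1 - X j) - s * ell.
  by rewrite /clearance; field; rewrite gt_eqF.
have ml : Num.min (X j - X j.-1) (X j.+1 - X j) <= X j - X j.-1 by rewrite ge_min lexx.
have mr : Num.min (X j - X j.-1) (X j.+1 - X j) <= X j.+1 - X j by rewrite ge_min lexx orbT.
have [ltij|ltji|eij] := ltngtP i j; last by rewrite eij eqxx in ij.
  have le1 : X i <= X j.-1.
    have : (i <= j.-1)%N by rewrite -ltnS jmS.
    rewrite leq_eqVlt => /orP[/eqP -> //|h]; apply: ltW; apply: position_lt => //.
    by case/andP: (index_left hj).
  by rewrite (le_trans _ (ler_norm _))//; lra.
have le1 : X j.+1 <= X i.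
  move: ltji; rewrite leq_eqVlt => /orP[/eqP <- //|h].
  by apply: ltW; apply: position_lt.
by rewrite distrC (le_trans _ (ler_norm _))//; lra.
Qed.

(** Between the middle well and b, only clump j.+1 can be felt. *)
Lemma right_of_well x i : (1 <= i < K.+1)%N -> i != j.+1 ->
  X j + s * ell < x -> x <= X j.+1 - alpha * ell -> s * ell < `|x - X i|.
Proof.
move=> /andP[i1 iK] ij h1 h2.
have al : 0 < alpha * ell by rewrite mulr_gt0.
have [ltij|ltji] := leqP i j.
  have le1 : X i <= X j.
    move: ltij; rewrite leq_eqVlt => /orP[/eqP -> //|h]; apply: ltW; apply: position_lt => //.
    by case/andP: (index_mid hj).
  by rewrite (lt_le_trans _ (ler_norm _))//; lra.
have jpi : (j.+1 < i)%N by rewrite ltn_neqAle eq_sym ij.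
have := separation (ltn0Sn j) jpi iK.
rewrite distrC => h3; rewrite (lt_le_trans _ (ler_norm _))//.
by have := sl0; lra.
Qed.

(** The mirror image of right_of_well. *)
Lemma left_of_well x i : (1 <= i < K.+1)%N -> i != j.-1 ->
  x < X j - s * ell -> X j.-1 + alpha * ell <= x -> s * ell < `|x - X i|.
Proof.
move=> /andP[i1 iK] ij h1 h2.
have al : 0 < alpha * ell by rewrite mulr_gt0.
have [ltij|ltji] := leqP j i.
  have le1 : X j <= X i.
    move: ltij; rewrite leq_eqVlt => /orP[/eqP -> //|h]; apply: ltW; apply: position_lt => //.
    by case/andP: (index_mid hj).
  by rewrite distrC (lt_le_trans _ (ler_norm _))//; lra.
have jpi : (i < j.-1)%N by rewrite ltn_neqAle ij -ltnS jmS.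
have := separation i1 jpi (andP (index_left hj)).2.
move=> h3; rewrite (lt_le_trans _ (ler_norm _))//.
by have := sl0; lra.
Qed.

End neighbours.

Lemma cvg_mul_expN_quadratic {R : realType} (A B : R) (t : nat -> R) : 0 < A ->
  (forall n, 1 <= t n) -> t n @[n --> \oo] --> +oo ->
  t n * expR (- (A * t n ^+ 2 - B * t n)) @[n --> \oo] --> 0.
Proof.
move=> A0 t1 ty.
have l : expR (- t n) @[n --> \oo] --> (0 : R).
  exact: (cvg_comp _ (fun y => expR (- y)) ty (@cvgr_expR R)).
apply: (@squeeze_cvgr _ _ _ _ (fun=> 0) (fun n => expR (- t n))); [|exact: cvg_cst|exact: l].
move/cvgryPge : ty => ty; near=> n.
have h : (`|B| + 2) / A <= t n by near: n; exact: ty.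
have t1n := t1 n.
rewrite mulr_ge0 ?expR_ge0 ?(le_trans ler01)//=.
have h2 : 2 * t n <= A * t n ^+ 2 - B * t n.
  by move: h; rewrite ler_pdivrMr// => h; have := ler_norm B; nra.
have h3 : t n <= expR (t n) by have := expR_ge1Dx (t n); lra.
rewrite (@le_trans _ _ (expR (t n) * expR (- (2 * t n))))//.
  by rewrite ler_pM ?expR_ge0// ?(le_trans ler01)// ler_expR lerN2.
by rewrite -expRD ler_expR; lra.
Unshelve. all: by end_near. Qed.

(** * Convergence of exp V *)

Section kramers.
Context {R : realType}.
Local Notation mu := (@lebesgue_measure R).
Variables (w : R -> R) (s L k : R) (cw : clump_well w s L k).
Hypothesis wk : derive1n 2 w 0 = k.
Variables (ell alpha : R) (K j : nat) (X m : nat -> R).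
Hypotheses (ell0 : 0 < ell) (m0 : forall i, (1 <= i < K.+1)%N -> 0 < m i)
  (hj : (2 <= j <= K.-1)%N) (al0 : 0 < alpha) (als : alpha < s)
  (gap : forall i, (1 <= i < K)%N -> 2 * s * ell < X i.+1 - X i).
Variable gam : nat -> R.
Hypotheses (gam1 : forall n, 1 <= gam n) (gamy : gam n @[n --> \oo] --> +oo).

Let s0 := cw_s cw.
Let gam0 n : 0 < gam n.
Proof. exact: lt_le_trans ltr01 (gam1 n). Qed.
Let jlK := index_left hj.
Let jK := index_mid hj.
Let jrK := index_right hj.
Let gl := gap_left hj gap.
Let gr := gap_right hj gap.
Let sl0 : 0 < s * ell. Proof. by rewrite mulr_gt0. Qed.
Let asl : 0 < alpha * ell < s * ell.
Proof. by rewrite mulr_gt0//= ltr_pM2r. Qed.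

Local Notation V n := (V_eff w ell K X m (gam n)).
Local Notation a := (X j.-1 + alpha * ell).
Local Notation b := (X j.+1 - alpha * ell).

Lemma V_eff_continuous n : continuous (V n).
Proof.
have [C [V1 [dV _ _ _]]] := V_eff_C11 cw wk X ell0 (gam0 n) m0.
exact: is_derive_continuous dV.
Qed.

Lemma expV_continuous n : continuous (fun x => expR (V n x)).
Proof.
by move=> x; apply: continuous_comp; [exact: V_eff_continuous|exact: continuous_expR].
Qed.

Lemma expNV_continuous n : continuous (fun x => expR (- V n x)).
Proof.
move=> x; apply: (@continuous_comp _ _ _ (fun x => - V n x) expR); last exact: continuous_expR.
by apply: cvgN; exact: V_eff_continuous.
Qed.

(** The limit of exp V on [a, b]. *)
Definition gap_indic (x : R) : R :=
  \1_(`]X j.-1 + s * ell, X j - s * ell[) x + \1_(`]X j + s * ell, X j.+1 - s * ell[) x.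

Lemma measurable_gap_indic : measurable_fun setT gap_indic.
Proof. by apply: measurable_funD; exact: measurable_indic. Qed.

(** Off the four end-points of the gaps, x is either at distance less than s * ell
    from one of the clumps j.-1, j, j.+1, or at distance more than s * ell from
    all the clumps. *)
Lemma expV_cvg x : a <= x <= b -> x != X j.-1 + s * ell -> x != X j - s * ell ->
  x != X j + s * ell -> x != X j.+1 - s * ell ->
  expR (V n x) @[n --> \oo] --> gap_indic x.
Proof.
move=> /andP[ax xb] n1 n2 n3 n4; case/andP: asl => as1 as2.
have well i : (1 <= i < K.+1)%N -> X i - s * ell < x -> x < X i + s * ell ->
    expR (V n x) @[n --> \oo] --> (0 : R).
  move=> iK h1 h2; apply: (expV_well cw wk ell0 m0 gam1 gamy iK).
  by rewrite ltr_norml; apply/andP; split; lra.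
have ltF (u v : R) : u <= v -> (v < u) = false by rewrite leNgt => /negbTE.
rewrite /gap_indic !indicE !mem_setE /= !in_itv/=.
move: gl gr sl0 => gl' gr' sl0'.
case: (ltgtP x (X j.-1 + s * ell)) n1 => //= c1 _.
  by rewrite ltF ?addr0; [apply: (well j.-1) => //; lra|lra].
case: (ltgtP x (X j - s * ell)) n2 => //= c2 _.
  rewrite ltF /= ?addr0; last lra.
  apply: (expV_gap cw wk ell0 m0 gam1 gamy) => i iK.
  have [->|ij] := eqVneq i j.-1; first by rewrite (lt_le_trans _ (ler_norm _))//; lra.
  exact: (left_of_well s0 ell0 hj al0 gap iK ij c2 ax).
case: (ltgtP x (X j + s * ell)) n3 => //= c3 _.
  by rewrite addr0; apply: (well j) => //; lra.
case: (ltgtP x (X j.+1 - s * ell)) n4 => //= c4 _.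
  rewrite add0r; apply: (expV_gap cw wk ell0 m0 gam1 gamy) => i iK.
  have [->|ij] := eqVneq i j.+1; first by rewrite distrC (lt_le_trans _ (ler_norm _))//; lra.
  exact: (right_of_well s0 ell0 hj al0 gap iK ij c3 xb).
by rewrite addr0; apply: (well j.+1) => //; lra.
Qed.

Lemma ae_expV_cvg : {ae mu, forall x, a <= x <= b ->
  expR (V n x) @[n --> \oo] --> gap_indic x}.
Proof.
pose N : set R := [set X j.-1 + s * ell] `|` [set X j - s * ell] `|`
  [set X j + s * ell] `|` [set X j.+1 - s * ell].
exists N; split.
- by rewrite /N; do !apply: measurableU => //; exact: measurable_set1.
- by apply: countable_lebesgue_measure0; apply: finite_set_countable; rewrite /N !finite_setU; do !split; exact: finite_set1.
- move=> x /= h; apply: contrapT => xN; apply: h => axb; apply: expV_cvg => //;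
  by apply/eqP => e; apply: xN; rewrite /N/=; tauto.
Qed.

Lemma continuous_integrable_itv (f : R -> R) (u v : R) : continuous f ->
  mu.-integrable `[u, v] (fun x => (f x)%:E).
Proof.
move=> cf; apply: continuous_compact_integrable; first exact: segment_compact.
exact: continuous_subspaceT.
Qed.

(** Dominated convergence, with exp V <= 1.  The scale function is the case
    c = 1; for the mean exit time c is the normalised speed mass. *)
Lemma expV_integral_cvg (c : nat -> R -> R) (h : R -> R) (C u v : R) :
  a <= u -> v <= b ->
  (forall n, measurable_fun `[u, v] (c n)) -> measurable_fun `[u, v] h ->
  (forall n x, u <= x <= v -> `|c n x| <= C) ->
  {ae mu, forall x, u <= x <= v -> c n x @[n --> \oo] --> h x} ->
  \int[mu]_(x in `[u, v]) (expR (V n x) * c n x) @[n --> \oo] -->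
  \int[mu]_(x in `[u, v]) (gap_indic x * h x).
Proof.
move=> au vb mc mh cC cvg_c.
have [||||| _] := @Rdominated_cvg _ _ R mu `[u, v] (fun n x => expR (V n x) * c n x)
  (fun x => gap_indic x * h x) (fun=> C) (measurable_itv _); last exact.
- move=> n; apply: measurable_funM; last exact: mc.
  apply: measurable_funTS.
  by apply: continuous_measurable_fun; exact: expV_continuous.
- exact (measurable_funM (measurable_funTS measurable_gap_indic) mh).
- apply: (@filterS2 _ _ (ae_filter_ringOfSetsType mu)) ae_expV_cvg cvg_c => x h1 h2; rewrite /= in_itv/= => /andP[ux xv].
  apply: cvgM; [apply: h1|apply: h2]; first by rewrite (le_trans au)//= (le_trans xv).
  by rewrite ux.
- by apply: (@continuous_integrable_itv (fun=> C)) => x; exact: cvg_cst.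
- apply: aeW => x n; rewrite /= in_itv/= => uxv.
  have /andP[e0 e1] := expV_le1 cw wk X ell0 m0 gam1 n x.
  rewrite normrM gtr0_norm// (le_trans _ (cC n x uxv))//.
  by rewrite ler_piMl.
Qed.

Definition Rgap : R := X j.+1 - X j - 2 * s * ell.
Definition Lgap : R := X j - X j.-1 - 2 * s * ell.

Lemma Rintegral_gap_indic (u v : R) : a <= u -> u <= X j.-1 + s * ell -> v <= b ->
  \int[mu]_(x in `[u, v]) gap_indic x =
   fine (mu (`]X j.-1 + s * ell, X j - s * ell[ `&` `[u, v])) +
   fine (mu (`]X j + s * ell, X j.+1 - s * ell[ `&` `[u, v])).
Proof.
move=> au ua vb; rewrite RintegralD//.
- by rewrite /Rintegral !integral_indic.
- by apply: integrableS (integrable_indic_itv _ _ _ _).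
- by apply: integrableS (integrable_indic_itv _ _ _ _).
Qed.

Lemma gap_integral_full : \int[mu]_(x in `[a, b]) gap_indic x = Lgap + Rgap.
Proof.
case/andP: asl => as1 as2; move: gl gr sl0 => gl' gr' sl0'.
rewrite Rintegral_gap_indic ?lexx//; last lra.
have -> : `]X j.-1 + s * ell, X j - s * ell[ `&` `[a, b] =
          `]X j.-1 + s * ell, X j - s * ell[%classic.
  by apply/seteqP; split => [x []//|x /= h]; split => //; move: h; rewrite !in_itv/= => /andP[h1 h2]; apply/andP; split; lra.
have -> : `]X j + s * ell, X j.+1 - s * ell[ `&` `[a, b] =
          `]X j + s * ell, X j.+1 - s * ell[%classic.
  by apply/seteqP; split => [x []//|x /= h]; split => //; move: h; rewrite !in_itv/= => /andP[h1 h2]; apply/andP; split; lra.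
rewrite !lebesgue_measure_itv/= !lte_fin !ifT; [|lra|lra].
by rewrite -!EFinB /= /Lgap /Rgap; lra.
Qed.

Lemma gap_integral_left x0 : X j - s * ell < x0 -> x0 < X j + s * ell ->
  \int[mu]_(x in `[a, x0]) gap_indic x = Lgap.
Proof.
move=> h1 h2; case/andP: asl => as1 as2; move: gl gr sl0 => gl' gr' sl0'.
rewrite Rintegral_gap_indic ?lexx//; [|lra|lra].
have -> : `]X j.-1 + s * ell, X j - s * ell[ `&` `[a, x0] =
          `]X j.-1 + s * ell, X j - s * ell[%classic.
  by apply/seteqP; split => [x []//|x /= h]; split => //; move: h; rewrite !in_itv/= => /andP[h3 h4]; apply/andP; split; lra.
have -> : `]X j + s * ell, X j.+1 - s * ell[ `&` `[a, x0] = set0.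
  by apply/seteqP; split => [x []/=|x []]; rewrite !in_itv/= => /andP[h3 h4] /andP[h5 h6]; lra.
rewrite measure0 addr0 lebesgue_measure_itv/= lte_fin ifT; last lra.
by rewrite -EFinB /= /Lgap; lra.
Qed.

End kramers.

(** * Laplace's method in the middle well *)

Section laplace.
Context {R : realType}.
Local Notation mu := (@lebesgue_measure R).
Local Notation std := (@normal_prob R 0 1).
Variables (w : R -> R) (s L k : R) (cw : clump_well w s L k).
Hypothesis wk : derive1n 2 w 0 = k.
Variables (ell alpha : R) (K j : nat) (X m : nat -> R).
Hypotheses (ell0 : 0 < ell) (m0 : forall i, (1 <= i < K.+1)%N -> 0 < m i)
  (hj : (2 <= j <= K.-1)%N) (al0 : 0 < alpha) (als : alpha < s)
  (gap : forall i, (1 <= i < K)%N -> 2 * s * ell < X i.+1 - X i).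
Variable gam : nat -> R.
Hypotheses (gam1 : forall n, 1 <= gam n) (gamy : gam n @[n --> \oo] --> +oo).

Let s0 := cw_s cw.
Let k0 := cw_k cw.
Let w00 := cw_w0 cw.
Local Notation eps n := (noise w ell m (gam n) j).
Hypotheses (massl : `|w alpha| * m j.-1 < - w 0 * m j)
  (massr : `|w alpha| * m j.+1 < - w 0 * m j).

Let gam0 n : 0 < gam n.
Proof. exact: lt_le_trans ltr01 (gam1 n). Qed.
Let jlK := index_left hj.
Let jK := index_mid hj.
Let jrK := index_right hj.
Let gl := gap_left hj gap.
Let gr := gap_right hj gap.
Let sl0 : 0 < s * ell. Proof. by rewrite mulr_gt0. Qed.
Let asl : 0 < alpha * ell < s * ell.
Proof. by rewrite mulr_gt0//= ltr_pM2r. Qed.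

Local Notation V n := (V_eff w ell K X m (gam n)).
Local Notation a := (X j.-1 + alpha * ell).
Local Notation b := (X j.+1 - alpha * ell).

Let eps0 n : 0 < eps n.
Proof. exact (noise_gt0 cw wk ell0 (gam0 n) m0 jK). Qed.

(** gamma * ell * Delta * m j, written in terms of the noise of the middle
    clump. *)
Definition well_depth n : R := - w 0 / (k * eps n ^+ 2).

(** The asymptotic mass of exp (- V) on [a, b]: a Gaussian of width ell * eps and
    height exp (well_depth - 1 / 2). *)
Definition kramers_const n : R :=
  Num.sqrt (2 * pi) * (ell * eps n) * expR (well_depth n - 1 / 2).

Lemma kramers_const_gt0 n : 0 < kramers_const n.
Proof.
apply: mulr_gt0; last exact: expR_gt0.
apply: mulr_gt0; last exact: mulr_gt0 ell0 (eps0 n).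
by rewrite sqrtr_gt0 mulr_gt0// pi_gt0.
Qed.

Lemma kramers_constE n : kramers_const n =
  Num.sqrt (2 * pi * ell / (gam n * k * m j)) * expR (gam n * ell * - w 0 * m j - 1 / 2).
Proof.
have e2 := noise_sqr cw wk ell0 (gam0 n) m0 jK; have mj := m0 jK.
rewrite /kramers_const /well_depth; congr (_ * expR (_ - _)); last first.
  by rewrite e2; field; rewrite !gt_eqF.
have -> : 2 * pi * ell / (gam n * k * m j) = (2 * pi) * (ell * eps n) ^+ 2.
  by rewrite exprMn e2; field; rewrite !gt_eqF.
rewrite (@sqrtrM _ (2 * pi)); last by rewrite mulr_ge0// pi_ge0.
by rewrite sqrtr_sqr gtr0_norm// mulr_gt0.
Qed.

Definition boltzmann n (x : R) : R := expR (- V n x) / kramers_const n.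

Lemma boltzmann_ge0 n x : 0 <= boltzmann n x.
Proof. by rewrite divr_ge0 ?expR_ge0// ltW// kramers_const_gt0. Qed.

Lemma boltzmann_continuous n : continuous (boltzmann n).
Proof.
move=> x; apply: cvgM; last exact: cvg_cst.
exact: (expNV_continuous cw wk ell0 m0 gam1).
Qed.

Lemma measurable_boltzmann n (D : set R) : measurable_fun D (boltzmann n).
Proof.
by apply: measurable_funTS; apply: continuous_measurable_fun; exact: boltzmann_continuous.
Qed.

Definition others n (x : R) : R :=
  \sum_(1 <= i < K.+1 | i != j) clump_term w ell X m (gam n) i x.

Lemma V_split n x : V n x =
  smoothing w ((x - X j) / ell) (eps n) / (k * eps n ^+ 2) + others n x.
Proof.
rewrite (V_eff_sum cw wk X ell0 m0 x (gam0 n)) /others.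
rewrite (bigD1_seq j) ?iota_uniq ?mem_index_iota//=.
by rewrite (clump_termE cw wk X ell0 m0 x (gam0 n) jK).
Qed.

(** Every point of the middle well is at a positive distance, bounded below by
    clearance * ell, from the supports of the other clumps. *)
Lemma others_bound : exists d : nat -> R, [/\ d n @[n --> \oo] --> 0,
  exists D, forall n, d n <= D &
  forall n x, `|x - X j| <= s * ell -> 0 <= - others n x <= d n].
Proof.
pose c0 := clearance s ell j X; have c00 : 0 < c0 := clearance_gt0 ell0 hj gap.
pose F := far_const w k c0; have F0 : 0 <= F := far_const_ge0 cw c00.
exists (fun n => \sum_(1 <= i < K.+1) F * noise w ell m (gam n) i); split.
- rewrite [X in _ --> X](_ : _ = \sum_(1 <= i < K.+1) (F * 0)); last first.
    by rewrite big1// => i _; rewrite mulr0.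
  apply: (@cvg_sum_seq _ _ _ (fun i n => F * noise w ell m (gam n) i)) => i.
  rewrite mem_index_iota => iK; apply: cvgM; first exact: cvg_cst.
  exact: (noise_cvg0 cw wk ell0 m0 gam1 gamy iK).
- exists (\sum_(1 <= i < K.+1) F * kap k ell m i) => n.
  rewrite big_seq [leRHS]big_seq; apply: ler_sum => i; rewrite mem_index_iota => iK.
  by apply: ler_wpM2l => //; exact: (noise_le cw wk ell0 m0 gam1 n iK).
- move=> n x xj; rewrite /others -sumrN; apply/andP; split.
    rewrite big_seq_cond sumr_ge0// => i; rewrite mem_index_iota => /andP[iK _].
    by rewrite oppr_ge0; exact: (clump_term_le0 cw X ell0 m0 x (gam0 n) iK).
  rewrite big_mkcond/= big_seq [leRHS]big_seq; apply: ler_sum => i.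
  rewrite mem_index_iota => iK; case: ifPn => ij.
    apply: (clump_term_far cw wk ell0 m0 (gam0 n) iK c00).
    exact: (far_from_others s0 ell0 hj gap iK ij xj).
  by rewrite mulr_ge0// ltW// (noise_gt0 cw wk ell0 (gam0 n) m0 iK).
Qed.

(** The normalised density exp (- V) in the natural scale of the well; it tends
    to the standard Gaussian density. *)
Definition scaled n (u : R) : R := (ell * eps n) * boltzmann n (ell * eps n * u + X j).

Lemma scaledE n u : scaled n u = normal_peak 1 *
  expR (1 / 2 - (smoothing w (eps n * u) (eps n) - w 0) / eps n ^+ 2 / k
        - others n (ell * eps n * u + X j)).
Proof.
have le0 : 0 < ell * eps n by rewrite mulr_gt0.
have p0 : Num.sqrt (2 * pi) != 0 :> R by rewrite gt_eqF// sqrtr_gt0 mulr_gt0// pi_gt0.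
have ZE : (kramers_const n)^-1 =
    (Num.sqrt (2 * pi))^-1 * (ell * eps n)^-1 * expR (- (well_depth n - 1 / 2)).
  rewrite /kramers_const expRN; set E := expR _.
  have E0 : E != 0 by rewrite gt_eqF// expR_gt0.
  by field; rewrite E0 p0 !gt_eqF.
rewrite /scaled /boltzmann V_split addrK ZE.
have -> : ell * eps n * u / ell = eps n * u by field; rewrite gt_eqF.
have -> : normal_peak 1 = (Num.sqrt (2 * pi))^-1 :> R.
  by rewrite /normal_peak expr1n mul1r mulr_natl.
set S := smoothing _ _ _; set O := others _ _.
have -> : 1 / 2 - (S - w 0) / eps n ^+ 2 / k - O =
    - (S / (k * eps n ^+ 2) + O) - (well_depth n - 1 / 2).
  by rewrite /well_depth; field; rewrite !gt_eqF.
rewrite expRD; set E1 := expR (- (S / _ + _)); set E2 := expR _.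
by field; rewrite p0 !gt_eqF.
Qed.

Lemma scaled_cvg u : scaled n u @[n --> \oo] --> normal_pdf 0 1 u.
Proof.
have [d [d0 _ hd]] := others_bound.
have [C [c [C0 c0 hC hc]]] := cw_quadratic cw.
have e0 := noise_cvg0 cw wk ell0 m0 gam1 gamy jK.
have wC x : 0 <= w x - w 0 <= C * x ^+ 2.
  by rewrite hC andbT subr_ge0; exact: cw_min cw x.
have l1 : (smoothing w (eps n * u) (eps n) - w 0) / eps n ^+ 2 @[n --> \oo] -->
    k / 2 * (u ^+ 2 + 1).
  exact (smoothing_laplace (u := u) (cw_measurable cw) (cw_bound cw) wC (cw_taylor cw) eps0 e0).
have lo : others n (ell * eps n * u + X j) @[n --> \oo] --> 0.
  apply: (@squeeze_cvgr _ _ _ _ (fun n => - d n) (fun=> 0)); [|by rewrite -oppr0; exact: cvgN|exact: cvg_cst].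
  have eu : `|ell * eps n * u| @[n --> \oo] --> 0.
    rewrite -(normr0 R); apply: cvg_norm; rewrite -[X in _ --> X](mul0r u).
    apply: cvgM; last exact: cvg_cst.
    by rewrite -[X in _ --> X](mulr0 ell); apply: cvgM => //; exact: cvg_cst.
  near=> n.
  have : `|ell * eps n * u + X j - X j| <= s * ell.
    rewrite addrK; near: n; move/cvgrPdist_le : eu => /(_ _ sl0).
    by apply: filterS => n; rewrite sub0r normrN normr_id.
  by move=> /(hd n _) /andP[h1 h2]; apply/andP; split; lra.
under eq_fun do rewrite scaledE.
have -> : normal_pdf 0 1 u = normal_peak 1 * expR (1 / 2 - k / 2 * (u ^+ 2 + 1) / k - 0).
  rewrite std_pdfE; congr (_ * expR _); field.
  by rewrite gt_eqF.
apply: cvgM; first exact: cvg_cst.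
apply: (cvg_comp _ expR _ (@continuous_expR R _)).
apply: cvgB => //; apply: cvgB; first exact: cvg_cst.
by apply: cvgM; [exact: l1|exact: cvg_cst].
Unshelve. all: by end_near. Qed.

(** smoothing_lower loses a factor 2 in the quadratic lower bound of w, which only
    affects the constant c. *)
Lemma scaled_dominated : exists C c, [/\ 0 < C, 0 < c & forall n u,
  `|eps n * u| <= s -> scaled n u <= C * expR (- (c * u ^+ 2))].
Proof.
have [d [_ [D hD] hd]] := others_bound.
have [C [c [C0 c0 hC hc]]] := cw_quadratic cw.
have p0 : 0 < normal_peak 1 :> R by rewrite normal_peak_gt0// oner_eq0.
exists (normal_peak 1 * expR (1 / 2 + D)), (c / 2 / k); split.
- by rewrite mulr_gt0// expR_gt0.
- by rewrite !divr_gt0.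
move=> n u us; rewrite scaledE -[leRHS]mulrA -expRD ler_pM2l// ler_expR.
have e2 : 0 < eps n ^+ 2 by rewrite exprn_gt0.
have : `|ell * eps n * u + X j - X j| <= s * ell.
  by rewrite addrK -mulrA normrM (gtr0_norm ell0) mulrC ler_pM2r.
move=> /(hd n _) /andP[_ h2]; have := hD n.
have h3 := smoothing_lower (eps n * u) (eps n) (cw_measurable cw) (cw_bound cw) (cw_mono cw).
have h4 := hc _ us.
suff : c / 2 * u ^+ 2 / k <= (smoothing w (eps n * u) (eps n) - w 0) / eps n ^+ 2 / k.
  rewrite (_ : c / 2 / k * u ^+ 2 = c / 2 * u ^+ 2 / k); last by ring.
  by move: h2; lra.
rewrite ler_pM2r ?invr_gt0// ler_pdivlMr//.
by move: h3 h4; rewrite exprMn; lra.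
Qed.

(** Outside the middle well a point of [a, b] feels at most one clump, j.-1 or
    j.+1, and it is at distance at least alpha * ell from its centre.  There V is
    at least - gamma ell m |w alpha| up to O(sqrt gamma), and the condition on the
    masses puts this above the bottom - gamma ell m j Delta of the middle well
    by a multiple of gamma. *)
Lemma boltzmann_rest : exists r : nat -> R, r n @[n --> \oo] --> 0 /\
  forall n x, a <= x <= b -> s * ell < `|x - X j| -> boltzmann n x <= r n.
Proof.
pose q := Num.max (m j.-1) (m j.+1) * `|w alpha|.
have mj := m0 jK.
have q1 : q < - w 0 * m j by rewrite /q /Num.max; case: ifP => _; rewrite mulrC.
pose Bi i := L * (m i * ell * kap k ell m i * \int[std]_x `|x|).
pose B := \sum_(1 <= i < K.+1) Bi i.
pose A := ell * (- w 0 * m j - q); have A0 : 0 < A by rewrite mulr_gt0// subr_gt0.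
pose t n := Num.sqrt (gam n).
have t1 n : 1 <= t n by rewrite -[leLHS]sqrtr1; exact: ler_wsqrtr.
have t2 n : t n ^+ 2 = gam n by rewrite sqr_sqrtr// ltW.
pose C0 := expR (1 / 2) / (Num.sqrt (2 * pi) * ell * kap k ell m j).
exists (fun n => C0 * (t n * expR (- (A * t n ^+ 2 - B * t n)))); split.
  rewrite -[X in _ --> X](mulr0 C0); apply: cvgM; first exact: cvg_cst.
  by apply: cvg_mul_expN_quadratic => //; exact: sqrt_cvgy gamy.
move=> n x axb far; case/andP: (axb) => ax xb; case/andP: asl => as1 as2.
pose z i := (x - X i) / ell.
have zout i : s * ell < `|x - X i| -> w (z i) = 0.
  move=> h; apply: (cw_out cw); rewrite normrM normfV (gtr0_norm ell0).
  by rewrite ler_pdivlMr// ltW.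
have zal i : alpha * ell <= `|x - X i| -> - w (z i) <= `|w alpha|.
  move=> h; rewrite ler0_norm ?(cw_le0 cw)// lerN2; apply: (cw_mono cw).
  by rewrite (gtr0_norm al0) /z normrM normfV (gtr0_norm ell0) ler_pdivlMr.
(* i0 is the neighbour of the middle clump on the side of x. *)
have [i0 [i0K zi0 other]] : exists i0, [/\ (1 <= i0 < K.+1)%N, m i0 * - w (z i0) <= q &
    forall i, (1 <= i < K.+1)%N -> i != i0 -> w (z i) = 0].
  have [xj|xj] := leP x (X j).
    exists j.-1; split => //.
      rewrite (@le_trans _ _ (m j.-1 * `|w alpha|))//.
        apply: ler_wpM2l; first exact: ltW (m0 jlK).
        by apply: zal; rewrite (le_trans _ (ler_norm _))//; lra.
      by rewrite ler_wpM2r// le_max lexx.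
    move=> i iK ij; apply: zout; apply: (left_of_well s0 ell0 hj al0 gap iK ij) => //.
    by move: far; rewrite ler0_norm ?subr_le0//; lra.
  exists j.+1; split => //.
    rewrite (@le_trans _ _ (m j.+1 * `|w alpha|))//.
      apply: ler_wpM2l; first exact: ltW (m0 jrK).
      by apply: zal; rewrite distrC (le_trans _ (ler_norm _))//; lra.
    by rewrite ler_wpM2r// le_max lexx orbT.
  move=> i iK ij; apply: zout; apply: (right_of_well s0 ell0 hj al0 gap iK ij) => //.
  by move: far; rewrite gtr0_norm ?subr_gt0//; lra.
have VB : - V n x <= gam n * ell * q + B * t n.
  rewrite (V_eff_sum cw wk X ell0 m0 x (gam0 n)) -sumrN /B.
  have : \sum_(1 <= i < K.+1) - clump_term w ell X m (gam n) i x <=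
      \sum_(1 <= i < K.+1) (m i * (gam n * ell * - w (z i)) + Bi i * t n).
    rewrite big_seq [leRHS]big_seq; apply: ler_sum => i; rewrite mem_index_iota => iK.
    have := clump_term_lipschitz cw wk X ell0 m0 x (gam0 n) iK.
    by rewrite -/(t n) -/(Bi i) -/(z i) ler_norml => /andP[]; lra.
  move=> /le_trans; apply; rewrite big_split/= -mulr_suml lerD2r.
  rewrite (bigD1_seq i0) ?iota_uniq ?mem_index_iota//= big_seq_cond big1 ?addr0; last first.
    by move=> i /andP[]; rewrite mem_index_iota => iK ii; rewrite other// oppr0 !mulr0.
  by rewrite mulrCA ler_wpM2l// mulr_ge0// ltW.
have p0 : 0 < Num.sqrt (2 * pi) :> R by rewrite sqrtr_gt0 mulr_gt0// pi_gt0.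
have tn0 : 0 < t n by exact: lt_le_trans ltr01 (t1 n).
have kj : 0 < kap k ell m j by exact (kap_gt0 cw ell0 m0 jK).
rewrite /boltzmann ler_pdivrMr ?kramers_const_gt0//.
have -> : C0 * (t n * expR (- (A * t n ^+ 2 - B * t n))) * kramers_const n =
    expR (gam n * ell * q + B * t n).
  have e2 : well_depth n = gam n * ell * - w 0 * m j.
    by rewrite /well_depth (noise_sqr cw wk ell0 (gam0 n) m0 jK); field; rewrite !gt_eqF.
  rewrite /kramers_const (noiseE cw wk ell0 m0 (gam0 n) jK) -/(t n) /C0 e2.
  have -> : gam n * ell * q + B * t n = (1 / 2) + (- (A * t n ^+ 2 - B * t n)) +
      (gam n * ell * - w 0 * m j - 1 / 2).
    by rewrite t2 /A; ring.
  rewrite [in RHS]expRD [in RHS]expRD.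
  set E1 := expR (1 / 2); set E2 := expR (- _); set E3 := expR (_ - 1 / 2).
  by field; rewrite !gt_eqF.
by rewrite ler_expR.
Qed.

Lemma integrable_gaussian (c : R) : 0 < c ->
  mu.-integrable setT (fun u => (expR (- (c * u ^+ 2)))%:E).
Proof.
move=> c0; pose sg := Num.sqrt (1 / (2 * c)).
have sg0 : 0 < sg by rewrite sqrtr_gt0 divr_gt0// mulr_gt0.
have p0 : normal_peak sg != 0 by rewrite gt_eqF// normal_peak_gt0// gt_eqF.
have := integrable_scaler measurableT (normal_peak sg)^-1 (@integrable_normal_pdf R 0 sg).
apply: eq_integrable => // u _; congr EFin; rewrite normal_pdfE ?gt_eqF//.
rewrite mulrA mulVf// mul1r /normal_fun subr0; congr expR.
rewrite sqr_sqrtr ?divr_ge0 ?mulr_ge0 ?ltW//.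
by rewrite -mulr_natl; field; rewrite gt_eqF.
Qed.

(** The part of the integral in the middle well, after the substitution
    x = ell * eps * u + X j, by dominated convergence.  The limit is 1 if the
    bottom X j of the well belongs to the interval of integration, else 0. *)
Lemma laplace_main y : a <= y <= b -> y != X j ->
  \int[mu]_x (boltzmann n x * \1_(`[X j - s * ell, X j + s * ell] `&` `[a, y]) x)
    @[n --> \oo] --> (((X j < y)%R : bool)%:R : R).
Proof.
move=> /andP[ay yb] yj; case/andP: asl => as1 as2; move: gl gr sl0 => gl' gr' sl0'.
pose D : set R := `[X j - s * ell, X j + s * ell] `&` `[a, y].
have mD : measurable D by apply: measurableI; exact: measurable_itv.
have mI : measurable_fun setT (\1_D : R -> R) by exact: measurable_indic.
pose h n u := scaled n u * \1_D (ell * eps n * u + X j).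
have hE n : \int[mu]_x (boltzmann n x * \1_D x) = \int[mu]_u h n u.
  have le0 : 0 < ell * eps n by rewrite mulr_gt0.
  have F0 x : (0 <= (boltzmann n x * \1_D x)%:E)%E.
    by rewrite lee_fin mulr_ge0 ?boltzmann_ge0// indicE.
  have mF : measurable_fun setT (fun x => (boltzmann n x * \1_D x)%:E).
    apply/measurable_EFinP; apply: measurable_funM; last exact: mI.
    exact: measurable_boltzmann.
  have a0 : ell * eps n != 0 by rewrite gt_eqF.
  rewrite /Rintegral (ge0_integral_affine (X j) a0 mF F0) (gtr0_norm le0); congr fine.
  rewrite -ge0_integralZl//; last by rewrite lee_fin ltW.
    by apply: eq_integral => u _; rewrite -EFinM /h /scaled mulrA.
  exact (measurableT_comp mF (measurable_affine _ _)).
under eq_fun do rewrite hE.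
have -> : ((X j < y)%R : bool)%:R = \int[mu]_u (((X j < y)%R : bool)%:R * normal_pdf 0 1 u).
  rewrite RintegralZl//; last exact: integrable_normal_pdf.
  by rewrite /Rintegral integral_normal_pdf mulr1.
have [C [c [C0 c0 hC]]] := scaled_dominated.
have maff n : measurable_fun setT (fun u : R => ell * eps n * u + X j) by exact: measurable_affine.
have [||||| _] := @Rdominated_cvg _ _ R mu setT h
  (fun u => ((X j < y)%R : bool)%:R * normal_pdf 0 1 u)
  (fun u => C * expR (- (c * u ^+ 2))) measurableT; last exact.
- move=> n; apply: measurable_funM; last exact (measurableT_comp mI (maff n)).
  apply: measurable_funM => //.
  exact (measurableT_comp (@measurable_boltzmann n setT) (maff n)).
- by apply: measurable_funM => //; exact: measurable_normal_pdf.
- apply: aeW => u _; rewrite mulrC; apply: cvgM; first exact: scaled_cvg.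
  have lx : ell * eps n * u + X j @[n --> \oo] --> X j.
    rewrite -[X in _ --> X]add0r; apply: cvgD; last exact: cvg_cst.
    rewrite -[X in _ --> X](mul0r u); apply: cvgM; last exact: cvg_cst.
    rewrite -[X in _ --> X](mulr0 ell); apply: cvgM; first exact: cvg_cst.
    exact: (noise_cvg0 cw wk ell0 m0 gam1 gamy jK).
  pose d := Num.min (`|y - X j| / 2) (s * ell).
  have d0 : 0 < d by rewrite lt_min sl0' andbT divr_gt0// normr_gt0 subr_eq0.
  have dy : d <= `|y - X j| / 2 by rewrite ge_min lexx.
  have ds : d <= s * ell by rewrite ge_min lexx orbT.
  move/cvgrPdist_le : lx => /(_ _ d0) lx.
  apply: cvg_near_cst; apply: filterS lx => n; set x := _ + X j.
  rewrite ler_norml => /andP[x1 x2]; rewrite indicE /D; congr (nat_of_bool _)%:R.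
  case: (ltgtP (X j) y) yj => // jy _.
    move: dy; rewrite gtr0_norm ?subr_gt0// => dy.
    by apply: mem_set; split; rewrite /= in_itv/=; apply/andP; split; lra.
  move: dy; rewrite ltr0_norm ?subr_lt0// => dy.
  by apply: memNset => -[_]; rewrite /= in_itv/= => /andP[_]; lra.
- by apply: integrable_scaler => //; exact: integrable_gaussian.
- apply: aeW => u n _; rewrite /h indicE; set x := _ + X j.
  have sc0 : 0 <= scaled n u by rewrite mulr_ge0 ?boltzmann_ge0// ltW// mulr_gt0.
  have [|] := boolP (x \in D); last first.
    by rewrite mulr0 normr0 mulr_ge0 ?expR_ge0// ltW.
  rewrite inE => -[/=]; rewrite in_itv/= => /andP[x1 x2] _.
  rewrite mulr1 ger0_norm//; apply: hC.
  have : ell * `|eps n * u| <= ell * s.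
    rewrite -{1}(gtr0_norm ell0) -normrM mulrA ler_norml.
    by move: x1 x2; rewrite /x => x1 x2; apply/andP; split; lra.
  by rewrite ler_pM2l.
Qed.

(** The rest of the interval is handled by boltzmann_rest. *)
Lemma laplace_cvg y : a <= y <= b -> y != X j ->
  \int[mu]_(x in `[a, y]) boltzmann n x @[n --> \oo] --> (((X j < y)%R : bool)%:R : R).
Proof.
move=> ayb yj; have /andP[ay yb] := ayb; case/andP: asl => as1 as2.
pose D1 : set R := `[X j - s * ell, X j + s * ell].
have mD1 : measurable D1 by exact: measurable_itv.
have ib n : mu.-integrable `[a, y] (fun x => (boltzmann n x)%:E).
  by apply: continuous_integrable_itv; exact: boltzmann_continuous.
have iM n (D : set R) : measurable D ->
    mu.-integrable `[a, y] (fun x => (boltzmann n x * \1_D x)%:E).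
  move=> mD; apply: (integrable_le_real _ _ (ib n)); first exact: measurable_itv.
    by apply: measurable_funM; [exact: measurable_boltzmann|exact: measurable_indic].
  move=> x _; rewrite normrM ger0_norm ?boltzmann_ge0// ler_piMr ?boltzmann_ge0//.
  by rewrite indicE; case: (_ \in _); rewrite /= ?normr1 ?normr0.
have e n : \int[mu]_(x in `[a, y]) boltzmann n x =
    \int[mu]_x (boltzmann n x * \1_(D1 `&` `[a, y]) x) +
    \int[mu]_(x in `[a, y]) (boltzmann n x * \1_(~` D1) x).
  transitivity (\int[mu]_(x in `[a, y]) (boltzmann n x * \1_D1 x + boltzmann n x * \1_(~` D1) x)).
    apply: eq_Rintegral => x _; rewrite -mulrDr !indicE in_setC.
    by case: (_ \in _); rewrite /= ?addr0 ?add0r mulr1.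
  rewrite RintegralD//; [|exact: iM|exact: iM (measurableC mD1)].
  congr (_ + _); rewrite Rintegral_mkcond; apply: eq_Rintegral => x _.
  rewrite patchE !indicE in_setI; case: (x \in `[a, y]%classic); rewrite ?andbT ?andbF//.
  by rewrite mulr0.
rewrite (funext e) -[X in _ --> X]addr0; apply: cvgD; first exact: laplace_main.
have [r [r0 hr]] := boltzmann_rest.
apply: (@squeeze_cvgr _ _ _ _ (fun=> 0) (fun n => r n * (y - a))); [|exact: cvg_cst|].
- apply: nearW => n; apply/andP; split.
    by apply: Rintegral_ge0 => x _; rewrite mulr_ge0 ?boltzmann_ge0// indicE.
  have -> : r n * (y - a) = \int[mu]_(x in `[a, y]) r n.
    rewrite Rintegral_cst//= lebesgue_measure_itv/= lte_fin; case: ltP => h.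
      by rewrite -EFinB.
    by have -> : y = a; [lra|rewrite subrr].
  have rn : 0 <= r n.
    apply: (le_trans (boltzmann_ge0 n b)); apply: hr.
      by rewrite lexx (le_trans ay yb).
    rewrite (lt_le_trans _ (ler_norm _))//; move: gr sl0 => gr' sl0'; lra.
  apply: le_Rintegral => //; first exact: iM (measurableC mD1).
    by apply: continuous_integrable_itv => x; exact: cvg_cst.
  move=> x; rewrite /= in_itv/= => /andP[ax xy]; rewrite indicE in_setC.
  have [xD|xD] := boolP (x \in D1); first by rewrite mulr0.
  rewrite mulr1; apply: hr; first by rewrite ax (le_trans xy).
  move: xD; rewrite notin_setE /D1 /= in_itv/= => xD; rewrite ltNge; apply/negP.
  by rewrite ler_norml => /andP[h1 h2]; apply: xD; apply/andP; split; lra.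
- by rewrite -[X in _ --> X](mul0r (y - a)); apply: cvgM; [exact: r0|exact: cvg_cst].
Qed.

End laplace.

(** * The exit functions and their limits *)

Section primitive.
Context {R : realType}.
Local Notation mu := (@lebesgue_measure R).

(** The oriented integral from c to x, so that a single function is a primitive
    on the whole line. *)
Definition prim (f : R -> R) (c x : R) : R :=
  \int[mu]_(y in `[c, x]) f y - \int[mu]_(y in `[x, c]) f y.

Lemma prim_ge (f : R -> R) c x : c <= x -> prim f c x = \int[mu]_(y in `[c, x]) f y.
Proof.
rewrite /prim le_eqVlt => /orP[/eqP ->|cx].
  by rewrite set_itv1 Rintegral_set1 subr0.
by rewrite [X in _ - X](_ : _ = 0) ?subr0// set_itv_ge ?Rintegral_set0// bnd_simp -ltNge.
Qed.

Lemma prim_base (f : R -> R) c : prim f c c = 0.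
Proof. by rewrite /prim subrr. Qed.

Lemma prim_shift (f : R -> R) c c' x : continuous f -> c' <= c -> c' <= x ->
  prim f c x = \int[mu]_(y in `[c', x]) f y - \int[mu]_(y in `[c', c]) f y.
Proof.
move=> cf cc cx.
have key u v : c' <= u -> u <= v ->
    \int[mu]_(y in `[c', v]) f y - \int[mu]_(y in `[c', u]) f y = \int[mu]_(y in `[u, v]) f y.
  move=> cu uv; rewrite Rintegral_itvB ?bnd_simp//; last first.
    exact: continuous_integrable_itv.
  rewrite Rintegral_itv_obnd_cbnd//.
  by apply: integrableS (continuous_integrable_itv u v cf) => //; apply: subset_itv; rewrite ?bnd_simp.
have [xc|xc] := leP c x; first by rewrite key// prim_ge.
rewrite -opprB key ?(ltW xc)// /prim.
rewrite [X in X - _](_ : _ = 0) ?sub0r// set_itv_ge ?Rintegral_set0// bnd_simp -ltNge//.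
Qed.

Lemma prim_is_derive (f : R -> R) c : continuous f ->
  forall x : R, is_derive x (1 : R) (prim f c) (f x).
Proof.
move=> cf x; pose c' := Num.min c x - 1.
have cc : c' < c by rewrite /c' ltrBlDr gt_min (_ : c < c + 1) ?ltrDl.
have cx : c' < x by rewrite /c' ltrBlDr gt_min (_ : x < x + 1) ?orbT ?ltrDl.
pose G z := \int[mu]_(y in `[c', z]) f y - \int[mu]_(y in `[c', c]) f y.
have [dF F'] := continuous_FTC1_closed (ltr_pwDr ltr01 (lexx x))
   (continuous_integrable_itv c' (x + 1) cf) cx (cf x).
have dG : is_derive x (1 : R) G (f x).
  have ? : is_derive x (1 : R) (fun z => \int[mu]_(y in `[c', z]) f y) (f x).
    by rewrite -F' derive1E; exact: DeriveDef.
  by apply: is_derive_eq; rewrite subr0.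
apply: (@near_eq_is_derive _ _ _ G) => //.
near=> z; rewrite /G (prim_shift cf (ltW cc))//.
by apply: ltW; near: z; exact: lt_nbhsr.
Unshelve. all: by end_near. Qed.

End primitive.

Section exit_functions.
Context {R : realType}.
Implicit Types (V : R -> R) (a b x : R).

Definition scale V a x : R := prim (fun y => expR (V y)) a x.
Definition speed V a x : R := prim (fun y => expR (- V y)) a x.

Definition scale_speed V a x : R := prim (fun y => expR (V y) * speed V a y) a x.

(** The solution of u'' - V' u' = - 1 that vanishes at a and b. *)
Definition mean_exit V a b x : R :=
  scale_speed V a b / scale V a b * scale V a x - scale_speed V a x.

(** The solution of u'' - V' u' = 0 with the values 1 at a and 0 at b. *)
Definition exit_left V a b x : R := 1 - scale V a x / scale V a b.

End exit_functions.

Section exit_limits.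
Context {R : realType}.
Local Notation mu := (@lebesgue_measure R).
Variables (w : R -> R) (s L k : R) (cw : clump_well w s L k).
Hypothesis wk : derive1n 2 w 0 = k.
Variables (ell alpha : R) (K j : nat) (X m : nat -> R).
Hypotheses (ell0 : 0 < ell) (m0 : forall i, (1 <= i < K.+1)%N -> 0 < m i)
  (hj : (2 <= j <= K.-1)%N) (al0 : 0 < alpha) (als : alpha < s)
  (gap : forall i, (1 <= i < K)%N -> 2 * s * ell < X i.+1 - X i).
Variable gam : nat -> R.
Hypotheses (gam1 : forall n, 1 <= gam n) (gamy : gam n @[n --> \oo] --> +oo).

Let s0 := cw_s cw.
Hypotheses (massl : `|w alpha| * m j.-1 < - w 0 * m j)
  (massr : `|w alpha| * m j.+1 < - w 0 * m j).

Let jlK := index_left hj.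
Let gl := gap_left hj gap.
Let gr := gap_right hj gap.
Let sl0 : 0 < s * ell. Proof. by rewrite mulr_gt0. Qed.
Let asl : 0 < alpha * ell < s * ell.
Proof. by rewrite mulr_gt0//= ltr_pM2r. Qed.

Local Notation V n := (V_eff w ell K X m (gam n)).
Local Notation a := (X j.-1 + alpha * ell).
Local Notation b := (X j.+1 - alpha * ell).

Variable x0 : R.
Hypothesis hx0 : X j - s * ell < x0 < X j + s * ell.

Local Notation Z n := (kramers_const w k ell j m gam n).
Local Notation Lg := (Lgap s ell j X).
Local Notation Rg := (Rgap s ell j X).

Let Z0 n : 0 < Z n.
Proof. exact (kramers_const_gt0 cw wk ell0 m0 hj gam1 n). Qed.

Let ax0b : a < x0 < b.
Proof.
by case/andP: asl hx0 => h1 h2 /andP[h3 h4]; move: gl gr => gl' gr'; apply/andP; split; lra.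
Qed.

Let cE n : continuous (fun x => expR (V n x)).
Proof. exact: (expV_continuous cw wk ell0 m0 gam1). Qed.

Let cN n : continuous (fun x => expR (- V n x)).
Proof. exact: (expNV_continuous cw wk ell0 m0 gam1). Qed.

Lemma Lgap_gt0 : 0 < Lg.
Proof. by rewrite subr_gt0. Qed.

Lemma Rgap_gt0 : 0 < Rg.
Proof. by rewrite subr_gt0. Qed.

Lemma scale_cvg v : a <= v <= b ->
  scale (V n) a v @[n --> \oo] --> \int[mu]_(x in `[a, v]) gap_indic s ell j X x.
Proof.
move=> /andP[av vb].
have c1 : {ae mu, forall x : R, a <= x <= v -> (fun=> 1 : R) n @[n --> \oo] --> (1 : R)}.
  by apply: aeW => x _; exact: cvg_cst.
have b1 (n : nat) (x : R) : a <= x <= v -> `|1 : R| <= 1 by rewrite normr1.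
have := expV_integral_cvg cw wk ell0 m0 hj al0 als gap gam1 gamy (lexx a) vb
  (fun n => @measurable_cst _ _ _ _ _ (1 : R)) (@measurable_cst _ _ _ _ _ (1 : R)) b1 c1.
under eq_fun do under eq_Rintegral do rewrite mulr1.
under [X in _ --> X -> _]eq_Rintegral do rewrite mulr1.
by under [X in _ -> X @ _ --> _]eq_fun do rewrite /scale prim_ge//.
Qed.

Lemma speed_boltzmann n x : a <= x ->
  speed (V n) a x / Z n = \int[mu]_(y in `[a, x]) boltzmann w k ell K j X m gam n y.
Proof.
move=> ax; rewrite /speed prim_ge// /boltzmann RintegralZr//.
exact: continuous_integrable_itv.
Qed.

(** The normalised speed mass tends to the indicator function of ]X j, +oo[ by
    Laplace's method, and exp V to that of the gaps.  The domination comes from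
    monotonicity: the mass on [a, x] is at most that on [a, b], a convergent
    sequence. *)
Lemma scale_speed_cvg v : a <= v <= b ->
  scale_speed (V n) a v / Z n @[n --> \oo] -->
  \int[mu]_(x in `[a, v]) (gap_indic s ell j X x * ((X j < x)%R : bool)%:R).
Proof.
move=> /andP[av vb].
have bX : b != X j.
  by case/andP: asl => h1 h2; move: gr sl0 => gr' sl0'; rewrite gt_eqF//; lra.
have ab : a <= b by case/andP: ax0b => h1 h2; lra.
have lab : a <= b <= b by rewrite ab lexx.
have cvgb := laplace_cvg cw wk ell0 m0 hj al0 als gap gam1 gamy massl massr lab bX.
have [M [Mr HM]] := cvg_seq_bounded (cvgP _ cvgb).
have bz x n : 0 <= boltzmann w k ell K j X m gam n x.
  exact (boltzmann_ge0 cw wk X ell0 m0 hj gam1 n x).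
have cb n : continuous (boltzmann w k ell K j X m gam n).
  exact: (boltzmann_continuous cw wk ell0 m0 gam1).
have bnd n x : a <= x <= v -> `|speed (V n) a x / Z n| <= `|M| + 1.
  move=> /andP[ax xv]; rewrite speed_boltzmann// ger0_norm ?Rintegral_ge0//.
  have := HM (`|M| + 1) (le_lt_trans (ler_norm M) (ltr_pwDr ltr01 (lexx _))) n I.
  apply: le_trans; apply: le_trans (ler_norm _).
  rewrite -subr_ge0 Rintegral_itvB ?bnd_simp ?Rintegral_ge0//.
    exact: continuous_integrable_itv.
  exact: le_trans xv vb.
have cs n : continuous (speed (V n) a).
  exact: is_derive_continuous (prim_is_derive a (@cN n)).
have mc n : measurable_fun `[a, v] (fun x => speed (V n) a x / Z n).
  apply: measurable_funM => //; apply: measurable_funTS.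
  exact: continuous_measurable_fun.
have mh : measurable_fun (`[a, v] : set R) (fun x => ((X j < x)%R : bool)%:R : R).
  rewrite (_ : (fun x => _) = \1_(`]X j, +oo[)); first exact: measurable_indic.
  apply/funext => x; rewrite indicE; congr (nat_of_bool _)%:R.
  by rewrite mem_setE/= in_itv/= andbT.
have ae : {ae mu, forall x, a <= x <= v ->
    speed (V n) a x / Z n @[n --> \oo] --> (((X j < x)%R : bool)%:R : R)}.
  exists [set X j]; split; [exact: measurable_set1|exact: lebesgue_measure_set1|].
  move=> x /= h; apply: contrapT => xX; apply: h => /andP[ax xv].
  have xX' : x != X j by apply/eqP.
  have axb : a <= x <= b by rewrite ax (le_trans xv vb).
  rewrite (_ : (fun n => _) = (fun n => \int[mu]_(y in `[a, x]) boltzmann w k ell K j X m gam n y)).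
    exact: (laplace_cvg cw wk ell0 m0 hj al0 als gap gam1 gamy massl massr axb xX').
  by apply/funext => n; exact: speed_boltzmann.
have := expV_integral_cvg cw wk ell0 m0 hj al0 als gap gam1 gamy (lexx a) vb mc mh bnd ae.
rewrite (_ : (fun n => _) = (fun n => scale_speed (V n) a v / Z n))//.
apply/funext => n; rewrite /scale_speed prim_ge// -RintegralZr//.
  by apply: eq_Rintegral => x _; rewrite mulrA.
apply: continuous_integrable_itv => x; apply: cvgM; [exact: cE|exact: cs].
Qed.

Lemma gap_integral_after v : X j <= v -> v <= b ->
  \int[mu]_(x in `[a, v]) (gap_indic s ell j X x * ((X j < x)%R : bool)%:R) =
  fine (mu (`]X j + s * ell, X j.+1 - s * ell[ `&` `[a, v])).
Proof.
move=> xv vb; have -> : fine (mu (`]X j + s * ell, X j.+1 - s * ell[ `&` `[a, v])) =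
    \int[mu]_(x in `[a, v]) \1_(`]X j + s * ell, X j.+1 - s * ell[) x.
  by rewrite /Rintegral integral_indic.
apply: eq_Rintegral => x _; rewrite /gap_indic !indicE !mem_setE /= !in_itv/=.
move: sl0 => sl0'; case: (ltP (X j) x) => h.
  by rewrite mulr1 (_ : (x < X j - s * ell) = false) ?andbF ?add0r//;
     apply/negbTE; rewrite -leNgt; lra.
by rewrite mulr0 (_ : (X j + s * ell < x) = false)//; apply/negbTE; rewrite -leNgt; lra.
Qed.

Lemma scale_speed_full : scale_speed (V n) a b / Z n @[n --> \oo] --> Rg.
Proof.
case/andP: asl hx0 ax0b => h1 h2 /andP[h3 h4] /andP[h5 h6]; move: gl gr => gl' gr'.
have := @scale_speed_cvg b; rewrite gap_integral_after//; last lra.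
rewrite (_ : _ `&` _ = `]X j + s * ell, X j.+1 - s * ell[%classic); last first.
  apply/seteqP; split => [x []//|x /= h]; split => //; move: h.
  by rewrite !in_itv/= => /andP[h7 h8]; apply/andP; split; lra.
rewrite lebesgue_measure_itv/= lte_fin ifT; last lra.
rewrite -EFinB /= (_ : X j.+1 - s * ell - (X j + s * ell) = Rg); last by rewrite /Rgap; ring.
by apply; rewrite lexx andbT; lra.
Qed.

Lemma scale_speed_start : scale_speed (V n) a x0 / Z n @[n --> \oo] --> 0.
Proof.
case/andP: asl hx0 ax0b => h1 h2 /andP[h3 h4] /andP[h5 h6]; move: gl gr => gl' gr'.
have ax0 : a <= x0 <= b by rewrite !ltW.
suff <- : \int[mu]_(x in `[a, x0]) (gap_indic s ell j X x * ((X j < x)%R : bool)%:R) = 0.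
  exact: scale_speed_cvg.
rewrite -[RHS](_ : \int[mu]_(x in `[a, x0]) 0 = 0); last first.
  by rewrite Rintegral_cst//= mul0r.
apply: eq_Rintegral => x; rewrite inE/= in_itv/= => /andP[ax xx0].
rewrite /gap_indic !indicE !mem_setE /= !in_itv/=.
move: sl0 => sl0'; rewrite (_ : (X j + s * ell < x) = false)/=; last first.
  by apply/negbTE; rewrite -leNgt; lra.
case: (ltP (X j) x) => h; last by rewrite mulr0.
by rewrite (_ : (x < X j - s * ell) = false) ?andbF ?addr0 ?mul0r//; apply/negbTE; rewrite -leNgt; lra.
Qed.

Lemma scale_full : scale (V n) a b @[n --> \oo] --> Lg + Rg.
Proof.
rewrite -(gap_integral_full cw ell0 hj al0 als gap); apply: scale_cvg.
by case/andP: ax0b => h1 h2; rewrite lexx andbT; lra.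
Qed.

Lemma scale_start : scale (V n) a x0 @[n --> \oo] --> Lg.
Proof.
case/andP: hx0 => h1 h2; rewrite -(gap_integral_left cw ell0 hj al0 als gap h1 h2).
by apply: scale_cvg; case/andP: ax0b => h3 h4; rewrite !ltW.
Qed.

Lemma mean_exit_cvg : mean_exit (V n) a b x0 / Z n @[n --> \oo] --> Rg * Lg / (Lg + Rg).
Proof.
have LR : Lg + Rg != 0 by rewrite gt_eqF// addr_gt0 ?Lgap_gt0 ?Rgap_gt0.
rewrite (_ : (fun n => _) = (fun n => scale_speed (V n) a b / Z n * (scale (V n) a b)^-1 *
    scale (V n) a x0 - scale_speed (V n) a x0 / Z n)); last first.
  by apply/funext => n; rewrite /mean_exit mulrBl; congr (_ - _); ring.
rewrite -[X in _ --> X]subr0; apply: cvgB; last exact: scale_speed_start.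
rewrite (_ : Rg * Lg / (Lg + Rg) = Rg * (Lg + Rg)^-1 * Lg); last by ring.
apply: cvgM; last exact: scale_start.
apply: cvgM; [exact: scale_speed_full|apply: cvgV => //; exact: scale_full].
Qed.

Lemma exit_left_cvg : exit_left (V n) a b x0 @[n --> \oo] --> Rg / (Lg + Rg).
Proof.
have LR : Lg + Rg != 0 by rewrite gt_eqF// addr_gt0 ?Lgap_gt0 ?Rgap_gt0.
rewrite (_ : Rg / (Lg + Rg) = 1 - Lg / (Lg + Rg)); last by field.
apply: cvgB; first exact: cvg_cst.
by apply: cvgM; [exact: scale_start|apply: cvgV => //; exact: scale_full].
Qed.

End exit_limits.

(** * Gaussian increments independent of the past *)

Section independent_gaussian.
Context {R : realType} d (Om : measurableType d) (P : probability Om R).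
Local Notation std := (@normal_prob R 0 1).
Variables (h : R) (Z xi : Om -> R).
Hypotheses (h0 : 0 < h) (mZ : measurable_fun setT Z) (mxi : measurable_fun setT xi).
Hypothesis law : forall C : set R, measurable C ->
  P (xi @^-1` C) = normal_prob 0 (Num.sqrt h) C.
Hypothesis indep : forall A C : set R, measurable A -> measurable C ->
  P (Z @^-1` A `&` xi @^-1` C) = (P (Z @^-1` A) * P (xi @^-1` C))%E.

Let sh0 : Num.sqrt h != 0. Proof. by rewrite gt_eqF// sqrtr_gt0. Qed.

Lemma ge0_integral_increment (f : R -> \bar R) : measurable_fun setT f ->
  (forall x, 0 <= f x)%E ->
  (\int[P]_w f (xi w) = \int[std]_u f (Num.sqrt h * u)%R)%E.
Proof.
move=> mf f0.
pose xi' : Om -> measurableTypeR R := xi.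
have mxi' : measurable_fun setT xi' by exact: mxi.
have e : (\int[normal_prob 0 (Num.sqrt h)]_x f x = \int[P]_w f (xi w))%E.
  rewrite (@eq_measure_integral _ _ _ _
    (measure_function_pushforward__canonical__measure_function_Measure P mxi')).
    by rewrite ge0_integral_pushforward.
  by move=> A mA _; apply/esym; exact: law.
rewrite -e (ge0_integral_normal_std 0 sh0 mf f0).
by apply: eq_integral => u _; rewrite addr0.
Qed.

Lemma integrable_increment (f : R -> R) : measurable_fun setT f ->
  std.-integrable setT (fun u => (f (Num.sqrt h * u))%:E) ->
  P.-integrable setT (fun w => (f (xi w))%:E).
Proof.
move=> mf fi; apply/integrableP; split.
  by apply/measurable_EFinP; exact (measurableT_comp mf mxi).
rewrite (ge0_integral_increment (f := fun x => `|(f x)%:E|%E))//.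
  by case/integrableP : fi.
by apply: measurableT_comp => //; exact/measurable_EFinP.
Qed.

Let Z' : Om -> measurableTypeR R := Z.
Let mZ' : measurable_fun setT Z'. Proof. exact: mZ. Qed.
Let Zfun : {mfun Om >-> measurableTypeR R} :=
  HB.pack Z' (isMeasurableFun.Build _ _ _ _ Z' mZ').

(** The joint law of (Z, xi) and the product of the laws agree on rectangles, hence
    are equal, and Fubini's theorem applies. *)
Lemma integral_independent_product (f : R -> R) (M : R) : measurable_fun setT f ->
  std.-integrable setT (fun u => (f (Num.sqrt h * u))%:E) ->
  (forall w, `|Z w| <= M) ->
  P.-integrable setT (fun w => (Z w * f (xi w))%:E) /\
  \int[P]_w (Z w * f (xi w)) = \int[P]_w Z w * \int[std]_u f (Num.sqrt h * u).
Proof.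
move=> mf fi ZM.
have fxi := integrable_increment mf fi.
have M0 : 0 <= M by apply: le_trans (ZM point).
have mfxi : measurable_fun setT (fun w => f (xi w)) by exact (measurableT_comp mf mxi).
have iZf : P.-integrable setT (fun w => (Z w * f (xi w))%:E).
  have := integrable_scaler measurableT M (integrable_normr fxi).
  move=> iM; apply: (integrable_le_real measurableT _ iM); first exact: measurable_funM.
  by move=> w _; rewrite normrM ler_wpM2r.
split; first exact: iZf.
pose T w : (measurableTypeR R * measurableTypeR R)%type := (Z w, xi w).
have mT : measurable_fun setT T by apply/measurable_fun_pairP.
pose N := normal_prob 0 (Num.sqrt h) : probability _ R.
pose m' := measure_function_pushforward__canonical__measure_function_Measure P mT.
have eqm A : measurable A -> (distribution P Zfun \x N)%E A = m' A.
  apply: product_measure_unique => A1 A2 mA1 mA2 /=.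
  rewrite /m' /= /pushforward -law// -indep//; congr (P _).
pose g (z : measurableTypeR R * measurableTypeR R) : \bar R := (z.1 * f z.2)%:E.
have mg : measurable_fun setT g.
  apply/measurable_EFinP; apply: measurable_funM; first exact: measurable_fst.
  exact (measurableT_comp mf (@measurable_snd _ _ (measurableTypeR R) (measurableTypeR R))).
have gi' : m'.-integrable setT g.
  by apply: (integrable_pushforward mT mg _ measurableT); exact: iZf.
have eint (k : measurableTypeR R * measurableTypeR R -> \bar R) :
    (\int[distribution P Zfun \x N]_z k z = \int[m']_z k z)%E.
  by apply: eq_measure_integral => A mA _; exact: eqm.
have gi : (distribution P Zfun \x N)%E.-integrable setT g.
  by apply/integrableP; split => //; rewrite eint; case/integrableP : gi'.
have fN : N.-integrable setT (fun x => (f x)%:E).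
  have [] := @integral_normal_affine R 0 (Num.sqrt h) (fun x => (f x)%:E) sh0.
  - exact/measurable_EFinP.
  - by apply: eq_integrable fi => // u _; rewrite addr0.
  - by move=> + _; apply.
have eN : (\int[N]_x (f x)%:E = (\int[std]_u f (Num.sqrt h * u))%:E)%E.
  rewrite /Rintegral fineK; last exact: integrable_fin_num.
  have [||_ ->] := @integral_normal_affine R 0 (Num.sqrt h) (fun x => (f x)%:E) sh0.
  - exact/measurable_EFinP.
  - by apply: eq_integrable fi => // u _; rewrite addr0.
  - by apply: eq_integral => u _; rewrite addr0.
have iZ : P.-integrable setT (fun w => (Z w)%:E).
  have iM : P.-integrable setT (fun=> M%:E) by exact: finite_measure_integrable_cst.
  by apply: (integrable_le_real measurableT mZ iM) => w _; exact: ZM.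
rewrite -RintegralZr// /Rintegral.
have -> : (\int[P]_w (Z w * f (xi w))%:E = \int[m']_z g z)%E.
  by rewrite integral_pushforward.
rewrite -eint -integral12_prod_meas1//; congr fine.
transitivity (\int[distribution P Zfun]_z (z * \int[std]_u f (Num.sqrt h * u))%:E)%E.
  apply: eq_integral => z _; rewrite /fubini_F /g /= EFinM -eN -integralZl//.
rewrite /distribution integral_pushforward//.
  by apply/measurable_EFinP; apply: measurable_funM.
by apply: eq_integrable (integrable_scaler measurableT (\int[std]_u f (Num.sqrt h * u)) iZ) => // w _; rewrite /= mulrC.
Qed.

End independent_gaussian.

(** * Continuous paths and hitting times *)

Section half_line_paths.
Context {R : realType}.
Implicit Types (f g : R -> R) (s t e : R).

(** Continuity on the half-line in a form free of subspace topologies. *)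
Definition path_continuous g : Prop := forall s, 0 <= s -> forall e, 0 < e ->
  exists2 d, 0 < d & forall s', 0 <= s' -> `|s' - s| < d -> `|g s' - g s| < e.

Lemma within_path_continuous g : {within `[0, +oo[, continuous g} -> path_continuous g.
Proof.
move=> /subspace_continuousP cg s s0 e e0.
have sD : `[0, +oo[%classic s by rewrite /= in_itv/= s0.
have /cvgrPdist_lt/(_ e e0) := cg s sD.
rewrite near_withinE => /nbhs_normP[d /= d0 hd]; exists d => // s' s'0 ss.
rewrite distrC; apply: hd; first by rewrite /= distrC.
by rewrite /= in_itv/= s'0.
Qed.

Lemma path_continuous_comp f g : continuous f -> path_continuous g ->
  path_continuous (fun s => f (g s)).
Proof.
move=> cf cg s s0 e e0.
have /cvgrPdist_lt/(_ e e0)/nbhs_normP[d /= d0 hd] := cf (g s).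
have [d' d'0 hd'] := cg s s0 d d0; exists d' => // s' s'0 ss.
by rewrite distrC; apply: hd; rewrite /= distrC; exact: hd'.
Qed.

Lemma path_continuous_within g t : path_continuous g -> {within `[0, t], continuous g}.
Proof.
move=> cg; apply/subspace_continuousP => s; rewrite /= in_itv/= => /andP[s0 st].
apply/cvgrPdist_lt => e e0; rewrite near_withinE.
have [d d0 hd] := cg s s0 e e0; apply/nbhs_normP; exists d => // s' /= ss.
by rewrite in_itv/= => /andP[s'0 _]; rewrite distrC; apply: hd => //; rewrite distrC.
Qed.

(** Heine's theorem on [0, t]. *)
Lemma path_unif_continuous g t e : path_continuous g -> 0 < e ->
  exists2 d, 0 < d & forall s s', 0 <= s <= t -> 0 <= s' <= t ->
    `|s' - s| < d -> `|g s' - g s| < e.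
Proof.
move=> cg e0.
pose Q (d s : R) := 0 <= s <= t -> forall s', 0 <= s' <= t ->
  `|s' - s| < d -> `|g s' - g s| < e.
have : \forall d \near (0 : R)^'+, `[0, t]%classic `<=` Q d.
  have nc := (compact_near_coveringP _).1 (@segment_compact R 0 t).
  apply: (nc R (0 : R)^'+ Q).
  move=> x; rewrite /= in_itv/= => /andP[x0 xt].
  have e20 : 0 < e / 2 by rewrite divr_gt0.
  have [d d0 hd] := cg x x0 _ e20.
  exists (ball x (d / 2), [set z | 0 < z < d / 2]).
    split; first by apply: nbhsx_ballx; rewrite divr_gt0.
    near=> z; apply/andP; split; near: z; [exact: nbhs_right_gt|].
    by apply: nbhs_right_lt; rewrite divr_gt0.
  move=> [y z] /= [xy /andP[z0 zd]] /andP[y0 yt] s' /andP[s'0 s't] ss.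
  have xy' : `|y - x| < d / 2 by rewrite distrC.
  have h1 : `|g y - g x| < e / 2 by apply: hd => //; lra.
  have h2 : `|g s' - g x| < e / 2.
    apply: hd => //; rewrite (_ : s' - x = (s' - y) + (y - x)); last by ring.
    by rewrite (le_lt_trans (ler_normD _ _))//; lra.
  rewrite (_ : g s' - g y = (g s' - g x) - (g y - g x)); last by ring.
  by rewrite (le_lt_trans (ler_normB _ _))//; lra.
move=> H.
have [d d0 hd] : exists2 d, 0 < d & `[0, t]%classic `<=` Q d.
  near (0 : R)^'+ => d; exists d; near: d; [exact: nbhs_right_gt|exact: H].
by exists d => // x y x0t y0t xy; apply: hd.
Unshelve. all: by end_near. Qed.

End half_line_paths.

Section exit_events.
Context {R : realType} d (Om : measurableType d).
Variables (F : R -> set (set Om)) (Y : R -> Om -> R).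
Hypotheses (hF : filtration F) (hYF : adapted F Y)
  (hYc : forall w, path_continuous (Y ^~ w)).
Implicit Types (f : R -> R) (t : R).

Lemma sigma_algebra_setC (G : set (set Om)) A : sigma_algebra setT G -> G A -> G (~` A).
Proof. by move=> [_ h _] /h; rewrite setTD. Qed.

Lemma sigma_algebra_setI (G : set (set Om)) A B : sigma_algebra setT G ->
  G A -> G B -> G (A `&` B).
Proof.
move=> sG GA GB; rewrite -[A `&` B]setCK setCI; apply: sigma_algebra_setC => //.
case: (sG) => G0 _ GU.
have -> : ~` A `|` ~` B = \bigcup_n (if n is 0%N then ~` A else ~` B).
  apply/seteqP; split => [w [h|h]|w [[|n] _ h]].
  - by exists 0%N.
  - by exists 1%N.
  - by left.
  - by right.
by apply: GU => -[|n]; exact: sigma_algebra_setC.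
Qed.

Lemma sigma_algebra_bigcap (G : set (set Om)) (A : nat -> set Om) :
  sigma_algebra setT G -> (forall n, G (A n)) -> G (\bigcap_n A n).
Proof.
move=> sG GA; rewrite -[\bigcap_n _]setCK setC_bigcap; apply: sigma_algebra_setC => //.
by case: (sG) => _ _; apply=> n; exact: sigma_algebra_setC.
Qed.

Definition stays f t : set Om := [set w | forall s, 0 <= s <= t -> 0 < f (Y s w)].

Lemma stays_sub f t t' : t <= t' -> stays f t' `<=` stays f t.
Proof. by move=> tt w h s /andP[s0 st]; apply: h; rewrite s0 (le_trans st). Qed.

(** By compactness of [0, t], staying positive means being at least 1 / (p + 1) for
    some p, and by continuity this can be tested at the times
    min (t, i / (q + 1)). *)
Lemma stays_event f t : continuous f -> 0 <= t -> F t (stays f t).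
Proof.
move=> cf t0; case: hF => sF mF monoF.
pose r (i q : nat) : R := Num.min t (i%:R / q.+1%:R).
have r0 i q : 0 <= r i q by rewrite le_min t0/= divr_ge0.
have rt i q : r i q <= t by rewrite ge_min lexx.
have -> : stays f t = \bigcup_p \bigcap_i \bigcap_q
    (Y (r i q) @^-1` (f @^-1` `[p.+1%:R^-1, +oo[)).
  apply/seteqP; split => [w hw|w [p _ hp] s /andP[s0 st]].
    have cfY := path_continuous_within (t := t) (path_continuous_comp cf (hYc w)).
    have [c + cmin] := EVT_min t0 cfY; rewrite in_itv/= => /hw c0.
    exists (Num.truncn (f (Y c w))^-1) => // i _ q _ /=.
    rewrite in_itv/= andbT (le_trans _ (cmin _ _))//; last by rewrite in_itv/= r0 rt.
    rewrite -[leRHS]invrK lef_pV2 ?posrE ?invr_gt0//.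
    by rewrite ltW// truncnS_gt.
  rewrite ltNge; apply/negP => fs.
  have p0 : 0 < p.+1%:R^-1 :> R by rewrite invr_gt0.
  have [e e0 he] := path_continuous_comp cf (hYc w) s0 p0.
  pose q := Num.truncn e^-1; pose i := Num.truncn (s * q.+1%:R).
  have sq0 : 0 <= s * q.+1%:R by rewrite mulr_ge0.
  have /andP[i1 i2] : i%:R <= s * q.+1%:R < i.+1%:R by exact: truncn_itv.
  have qe : q.+1%:R^-1 < e.
    by rewrite -[ltRHS]invrK ltf_pV2 ?posrE ?invr_gt0// truncnS_gt.
  have iqs : i%:R / q.+1%:R <= s by rewrite ler_pdivrMr.
  have rE : r i q = i%:R / q.+1%:R by rewrite /r min_r// (le_trans iqs).
  have sr : s < i%:R / q.+1%:R + q.+1%:R^-1.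
    by rewrite -[X in _ + X]mul1r -mulrDl ltr_pdivlMr// natr1.
  have hh : `|r i q - s| < e.
    rewrite rE distrC ger0_norm ?subr_ge0//; move: sr qe.
    set x := i%:R / _; set y := q.+1%:R^-1; lra.
  have : `|f (Y (r i q) w) - f (Y s w)| < p.+1%:R^-1 := he _ (r0 i q) hh.
  have := hp i I q I; rewrite /= in_itv/= andbT => h1.
  rewrite ltr_norml => /andP[_] h2.
  by move: h1 h2 fs; set x := p.+1%:R^-1; set u := f _; set v := f _; lra.
case: (sF t t0) => _ _; apply=> p; apply: sigma_algebra_bigcap; first exact: sF.
move=> i; apply: sigma_algebra_bigcap; first exact: sF.
move=> q; apply: (monoF (r i q) t) => //; apply: hYF => //.
rewrite -[_ @^-1` _]setTI; apply: (continuous_measurable_fun cf) => //.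
Qed.

Lemma stays_measurable f t : continuous f -> 0 <= t -> measurable (stays f t).
Proof. by move=> cf t0; case: hF => _ mF _; apply: (mF t t0); exact: stays_event. Qed.

Lemma hitting_time_ge0 A w : (0 <= hitting_time Y A w)%E.
Proof. by apply/ereal_infP => _ [t [t0 _] <-]; rewrite lee_fin. Qed.

(** The set where f <= 0 is closed: a path that is outside it on [0, t] stays
    outside a little longer. *)
Lemma stays_hitting f t w : continuous f -> 0 <= t ->
  stays f t w <-> (t%:E < hitting_time Y [set y | (f y <= 0)%R] w)%E.
Proof.
move=> cf t0; split => [hw|ht s /andP[s0 st]].
  have ft : 0 < f (Y t w) by apply: hw; rewrite t0/=.
  have [e e0 he] := path_continuous_comp cf (hYc w) t0 ft.
  apply: (@lt_le_trans _ _ (t + e)%:E); first by rewrite lte_fin ltrDl.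
  apply/ereal_infP => _ [s [s0 /= fs] <-]; rewrite lee_fin leNgt; apply/negP => ste.
  have ts : t < s by rewrite ltNge; apply/negP => st; move: fs; rewrite leNgt hw// s0.
  have := he s s0; rewrite gtr0_norm ?subr_gt0// ltrBlDl => /(_ ste).
  by rewrite ltr_norml => /andP[h _]; lra.
rewrite ltNge; apply/negP => fs.
have : (hitting_time Y [set y | (f y <= 0)%R] w <= s%:E)%E.
  by apply: ereal_inf_lbound; exists s.
by move=> /(lt_le_trans ht); rewrite lte_fin ltNge st.
Qed.

Lemma hitting_attained f t w : continuous f ->
  hitting_time Y [set y | (f y <= 0)%R] w = t%:E -> 0 <= t /\ f (Y t w) <= 0.
Proof.
move=> cf ht; have t0 : 0 <= t by rewrite -lee_fin -ht hitting_time_ge0.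
split => //; rewrite leNgt; apply/negP => ft.
have : stays f t w.
  move=> s /andP[s0 st]; move: st; rewrite le_eqVlt => /orP[/eqP -> //|st].
  have : stays f s w by apply/(stays_hitting _ cf s0); rewrite ht lte_fin.
  by apply; rewrite s0/=.
by move=> /(stays_hitting _ cf t0); rewrite ht ltxx.
Qed.

(** The strict inequality is witnessed by a rational time r: f has been reached by
    time r, and g has not. *)
Lemma measurable_hitting_lt (f g : R -> R) : continuous f -> continuous g ->
  measurable [set w | (hitting_time Y [set y | (f y <= 0)%R] w
                       < hitting_time Y [set y | (g y <= 0)%R] w)%E].
Proof.
move=> cf cg.
have -> : [set w | (hitting_time Y [set y | (f y <= 0)%R] w
                       < hitting_time Y [set y | (g y <= 0)%R] w)%E] =
    \bigcup_i \bigcup_q (~` stays f (i%:R / q.+1%:R) `&` stays g (i%:R / q.+1%:R)).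
  apply/seteqP; split => [w /= h|w [i _ [q _ [h1 h2]]]] /=.
    have := hitting_time_ge0 [set y | (f y <= 0)%R] w.
    case E: (hitting_time Y [set y | (f y <= 0)%R] w) h => [r| |] h; last 2 first.
    - by move: h; rewrite ltNge leey.
    - by [].
    rewrite lee_fin => r0.
    have [q hq] : exists q : nat, ((r + q.+1%:R^-1)%:E < hitting_time Y [set y | (g y <= 0)%R] w)%E.
      case E2: (hitting_time Y [set y | (g y <= 0)%R] w) h => [r'| |] //; last by exists 0%N; rewrite ltry.
        rewrite lte_fin => rr'; exists (Num.truncn (r' - r)^-1).
        have : (Num.truncn (r' - r)^-1).+1%:R^-1 < r' - r.
          by rewrite -[ltRHS]invrK ltf_pV2 ?posrE ?invr_gt0 ?subr_gt0// truncnS_gt.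
        by rewrite lte_fin -ltrBrDl.
    pose i := (Num.truncn (r * q.+1%:R)).+1.
    have rq0 : 0 <= r * q.+1%:R by rewrite mulr_ge0.
    have /andP[i1 i2] : (Num.truncn (r * q.+1%:R))%:R <= r * q.+1%:R < i%:R by exact: truncn_itv.
    have iq0 : 0 <= i%:R / q.+1%:R :> R by rewrite divr_ge0.
    exists i => //; exists q => //; split.
      move=> /(stays_hitting _ cf iq0); rewrite E lte_fin; apply/negP; rewrite -leNgt.
      by rewrite ler_pdivlMr// ltW.
    apply/(stays_hitting _ cg iq0); apply: le_lt_trans hq.
    rewrite lee_fin -[X in _ + X]mul1r ler_pdivrMr// mulrDl divfK//.
    by rewrite /i -natr1 lerD2r.
  have iq0 : 0 <= i%:R / q.+1%:R :> R by rewrite divr_ge0.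
  apply: (@le_lt_trans _ _ (i%:R / q.+1%:R)%:E).
    by rewrite leNgt; apply/negP => /(stays_hitting _ cf iq0).
  exact/(stays_hitting _ cg iq0).
apply: bigcup_measurable => i _; apply: bigcup_measurable => q _.
have iq0 : 0 <= i%:R / q.+1%:R :> R by rewrite divr_ge0.
by apply: measurableI; [apply: measurableC|]; exact: stays_measurable.
Qed.

End exit_events.

(** * One step of the grid *)

(** N i tells that step i is still performed; as N is nonincreasing, sums over the
    performed steps telescope up to the first k at which N fails. *)
Lemma grid_stopping {R : realType} (N : nat -> bool) (g : R -> R) (h : R) :
  (forall i, N i.+1 -> N i) -> forall m : nat, exists k : nat,
  [/\ (k <= m)%N, \sum_(0 <= i < m) h * (N i)%:R = k%:R * h,
    \sum_(0 <= i < m) (N i)%:R * (g (i.+1%:R * h) - g (i%:R * h)) = g (k%:R * h) - g 0,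
    (k = 0)%N \/ N k.-1 & k = m \/ ~~ N k].
Proof.
move=> Nd; elim=> [|m [k [km e1 e2 h1 h2]]].
  by exists 0%N; rewrite !big_geq// !mul0r subrr; split => //; left.
rewrite !big_nat_recr//= e1 e2; case: h2 => [ekm|Nk].
  rewrite ekm in e1 e2 h1 *; case Nm: (N m).
    exists m.+1; split => //=; [by rewrite mulr1 -natr1; ring|by rewrite mul1r; ring|by right|by left].
  by exists m; rewrite mulr0 mul0r !addr0; split => //; right; rewrite Nm.
have Nm : N m = false.
  apply/negbTE; apply: contra Nk => Nm.
  have : forall p, (k <= p)%N -> N p -> N k.
    by elim=> [|p IH]; [rewrite leqn0 => /eqP ->|rewrite leq_eqVlt => /orP[/eqP -> //|kp /Nd]; exact: IH].
  by move=> H; exact: (H m).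
by exists k; rewrite Nm mulr0 mul0r !addr0; split => //; [exact: leqW|right].
Qed.

Lemma ae_bounded_integral d (T : measurableType d) {R : realType}
  (P : {measure set T -> \bar R}) (g G : T -> R) : measurable_fun setT g ->
  P.-integrable setT (fun x => (G x)%:E) -> {ae P, forall x, `|g x| <= G x} ->
  P.-integrable setT (fun x => (g x)%:E) /\ `|\int[P]_x g x| <= \int[P]_x G x.
Proof.
move=> mg iG gG.
have mabs : measurable_fun setT (fun x => `|(g x)%:E|%E).
  by apply: measurableT_comp => //; exact/measurable_EFinP.
have mG := measurable_int _ iG.
have G0 : {ae P, forall x, setT x -> (`|(g x)%:E| <= `|(G x)%:E|)%E}.
  by apply: filterS gG => x h _; rewrite /= lee_fin (le_trans h)// ler_norm.
have le1 : (\int[P]_x `|(g x)%:E| <= \int[P]_x `|(G x)%:E|)%E.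
  by apply: ae_ge0_le_integral => //; exact: measurableT_comp.
have ig : P.-integrable setT (fun x => (g x)%:E).
  apply/integrableP; split; first exact/measurable_EFinP.
  by apply: le_lt_trans le1 _; case/integrableP : iG.
split; first exact: ig.
apply: (le_trans (le_normr_Rintegral _ _)) => //.
have nG : (\int[P]_x `|(G x)%:E| = \int[P]_x (G x)%:E)%E.
  apply: ae_eq_integral => //; first exact: measurableT_comp.
  apply: filterS gG => x h _; rewrite /= ger0_norm//.
  exact: le_trans (normr_ge0 _) h.
rewrite /Rintegral; apply: fine_le.
- by apply: integrable_fin_num => //; exact: integrable_normr.
- exact: integrable_fin_num.
- by rewrite -nG.
Qed.

(** In one step of length h the path moves by sqrt 2 xi - d, where xi is the
    increment of B and d = O(h) that of the drift.  Subtracting from the increment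
    T of the test function its compensator - c h and the quadrature error
    u1 (h v - d) leaves terms that will have mean zero, up to O(h ^ (3 / 2)) in
    mean. *)
Lemma taylor_step_bound {R : realType} (u1 u2 v c xi d h T L M C : R) :
  0 <= h -> 0 <= L -> 0 <= C -> `|u1| <= M -> `|u2| <= M -> `|d| <= C * h ->
  u2 - v * u1 = - c ->
  `|T - u1 * (Num.sqrt 2 * xi - d) - u2 / 2 * (Num.sqrt 2 * xi - d) ^+ 2|
     <= L * `|Num.sqrt 2 * xi - d| ^+ 3 ->
  `|T + c * h - u1 * (h * v - d) - (Num.sqrt 2 * u1 * xi + u2 * (xi ^+ 2 - h))|
   <= 12 * L * `|xi| ^+ 3 + 4 * L * C ^+ 3 * h ^+ 3
      + 2 * M * C * h * `|xi| + M * C ^+ 2 * h ^+ 2.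
Proof.
move=> h0 L0 C0 u1M u2M dC ec HT.
set r2 := Num.sqrt 2 in HT *.
have r22 : r2 ^+ 2 = 2 by rewrite sqr_sqrtr.
have r20 : 0 <= r2 by exact: sqrtr_ge0.
have r2le : r2 <= 3 / 2 by rewrite -(@ler_pXn2r _ 2)// ?nnegrE// r22; lra.
set k := r2 * xi - d in HT *.
have -> : T + c * h - u1 * (h * v - d) - (r2 * u1 * xi + u2 * (xi ^+ 2 - h)) =
   (T - u1 * k - u2 / 2 * k ^+ 2) + u2 / 2 * (d ^+ 2 - 2 * r2 * xi * d).
  have -> : c = v * u1 - u2 by lra.
  rewrite /k; have -> : (r2 * xi - d) ^+ 2 = r2 ^+ 2 * xi ^+ 2 - 2 * r2 * xi * d + d ^+ 2 by ring.
  by rewrite r22; field.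
set x := `|xi|; have x0 : 0 <= x by exact: normr_ge0.
set e := `|d| in dC; have e0 : 0 <= e by exact: normr_ge0.
have M0 : 0 <= M := le_trans (normr_ge0 _) u1M.
have kx : `|k| <= r2 * x + e.
  by rewrite /k (le_trans (ler_normB _ _))// normrM (ger0_norm r20).
(* (p + q) ^ 3 <= 4 (p ^ 3 + q ^ 3), and sqrt 2 ^ 3 <= 3. *)
have k3 : `|k| ^+ 3 <= 12 * x ^+ 3 + 4 * (C * h) ^+ 3.
  have s1 : `|k| ^+ 3 <= (r2 * x + e) ^+ 3 by rewrite lerXn2r ?nnegrE// addr_ge0// mulr_ge0.
  have rx : 0 <= r2 * x by exact: mulr_ge0.
  have s2 : (r2 * x + e) ^+ 3 <= 4 * ((r2 * x) ^+ 3 + e ^+ 3).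
    rewrite -subr_ge0 (_ : _ - _ = 3 * ((r2 * x + e) * (r2 * x - e) ^+ 2)); last by ring.
    apply: mulr_ge0 => //; apply: mulr_ge0; [exact: addr_ge0|exact: sqr_ge0].
  have s3 : e ^+ 3 <= (C * h) ^+ 3 by rewrite lerXn2r ?nnegrE// mulr_ge0.
  have s4 : (r2 * x) ^+ 3 <= 3 * x ^+ 3.
    rewrite exprMn ler_wpM2r ?exprn_ge0// exprS r22; lra.
  by lra.
have b2 : `|u2 / 2 * (d ^+ 2 - 2 * r2 * xi * d)| <= 2 * M * C * h * x + M * C ^+ 2 * h ^+ 2.
  rewrite normrM normrM (ger0_norm (_ : 0 <= 2^-1))//.
  have p1 : `|d ^+ 2 - 2 * r2 * xi * d| <= (C * h) ^+ 2 + 3 * x * (C * h).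
    rewrite (le_trans (ler_normB _ _))// lerD//.
      by rewrite normrX lerXn2r ?nnegrE// mulr_ge0.
    rewrite !normrM (ger0_norm r20) ger0_norm// -/x -/e.
    rewrite ler_pM// ?mulr_ge0//.
    by rewrite ler_wpM2r//; lra.
  have p2 : `|u2| * 2^-1 <= M / 2 by rewrite ler_pM2r.
  have A0 : 0 <= (C * h) ^+ 2 + 3 * x * (C * h) by rewrite addr_ge0 ?sqr_ge0// !mulr_ge0.
  rewrite (@le_trans _ _ (M / 2 * ((C * h) ^+ 2 + 3 * x * (C * h))))//.
    by rewrite ler_pM// mulr_ge0.
  rewrite -subr_ge0 (_ : _ - _ = M / 2 * (x * (C * h)) + M / 2 * (C * h) ^+ 2); last by field.
  by rewrite addr_ge0// !mulr_ge0// ?sqr_ge0// ?mulr_ge0.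
rewrite (le_trans (ler_normD _ _))//.
have := ler_wpM2l L0 k3; rewrite mulrDr exprMn => k3'.
by move: HT b2 k3'; lra.
Qed.

Section dynkin.
Context {R : realType} d (Om : measurableType d) (P : probability Om R).
Local Notation mu := (@lebesgue_measure R).
Local Notation std := (@normal_prob R 0 1).
Variables (F : R -> set (set Om)) (B Y : R -> Om -> R) (V V1 : R -> R) (C x0 : R).
Hypotheses (bV : bounded_C11 C V V1) (hY : langevin_solution P F B V x0 Y).

Lemma langevin_filtration : filtration F. Proof. by case: hY => -[]. Qed.
Lemma langevin_adapted : adapted F Y. Proof. by case: hY. Qed.
Lemma langevin_brownian : brownian_motion P F B. Proof. by case: hY => -[]. Qed.
Lemma langevin_path w : path_continuous (Y ^~ w).
Proof. by case: hY => _ _ cY _ _; exact: within_path_continuous. Qed.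

Let hF := langevin_filtration.
Let cY := langevin_path.

Lemma adapted_measurable (Z : R -> Om -> R) t : adapted F Z -> 0 <= t ->
  measurable_fun setT (Z t).
Proof.
move=> aZ t0 _ A mA; rewrite setTI; case: hF => _ mF _; apply: (mF t t0).
exact: aZ.
Qed.

Let mY t : 0 <= t -> measurable_fun setT (Y t).
Proof. exact: adapted_measurable langevin_adapted. Qed.

Let mB t : 0 <= t -> measurable_fun setT (B t).
Proof. by apply: adapted_measurable; case: langevin_brownian. Qed.

Let C0 : 0 <= C. Proof. by case: bV => _ h _ _; exact: le_trans (h 0). Qed.

Let cV1 : continuous V1.
Proof. by case: bV => _ _ _ h; exact: continuous_of_lipschitz h. Qed.

Let dV x : derive1 V x = V1 x.
Proof. by case: bV => h _ _ _; have := h x => ?; rewrite derive1E; exact: derive_val. Qed.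

(** The integral equation at all times, which holds almost surely and is then used
    path by path. *)
Definition good w : Prop := Y 0 w = x0 /\ forall t, 0 <= t ->
  Y t w = Y 0 w - \int[mu]_(s in `[0, t]) V1 (Y s w) + Num.sqrt 2 * B t w.

Lemma ae_good : {ae P, forall w, good w}.
Proof.
case: hY => _ _ _ h1 h2; apply: filterS2 h1 h2 => w e1 e2; split; first exact: e1.
move=> t t0; have [_ ->] := e2 t t0; congr (_ - _ + _).
by apply: eq_Rintegral => s _; rewrite dV.
Qed.

(** The integral of V1 (Y r) over [s, t], as the equation expresses it; in this
    form it is defined and measurable on all of Om. *)
Definition drift s t w : R := Num.sqrt 2 * (B t w - B s w) - (Y t w - Y s w).

(** The drift is the integral of V1 along the path, which stays within e of v. *)
Lemma drift_close w s t v e : good w -> 0 <= s -> s <= t ->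
  (forall r, s <= r <= t -> `|V1 (Y r w) - v| <= e) ->
  `|(t - s) * v - drift s t w| <= e * (t - s).
Proof.
move=> [_ hw] s0 st He; have t0 : 0 <= t := le_trans s0 st.
have iv t' : mu.-integrable `[0, t'] (fun r => (V1 (Y r w))%:E).
  apply: continuous_compact_integrable; first exact: segment_compact.
  exact: path_continuous_within (path_continuous_comp cV1 (cY w)).
have ist : mu.-integrable `[s, t] (fun r => (V1 (Y r w))%:E).
  by apply: integrableS (iv t) => //; apply: subset_itvr; rewrite bnd_simp.
have ie (x : R) : mu.-integrable `[s, t] (fun r => x%:E).
  by apply: (@continuous_integrable_itv _ (fun=> x)) => y; exact: cvg_cst.
have lst : fine (mu `[s, t]) = t - s.
  rewrite lebesgue_measure_itv/= lte_fin; case: ltP => h; first by rewrite -EFinB.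
  by have -> : t = s; [lra|rewrite subrr].
have -> : drift s t w = \int[mu]_(r in `[s, t]) V1 (Y r w).
  have ioc : mu.-integrable `]s, t] (fun r => (V1 (Y r w))%:E).
    by apply: integrableS ist => //; apply: subset_itvr; rewrite bnd_simp.
  rewrite -(Rintegral_itv_obnd_cbnd ioc) -(Rintegral_itvB (x := s) (iv t)) ?bnd_simp//.
  by rewrite /drift (hw t t0) (hw s s0); ring.
have -> : (t - s) * v = \int[mu]_(r in `[s, t]) v.
  by rewrite Rintegral_cst// lst mulrC.
rewrite -RintegralB//; last exact: ie.
have id : mu.-integrable `[s, t] (fun r => (v - V1 (Y r w))%:E).
  by apply: integrable_subr => //; exact: ie.
apply: (le_trans (le_normr_Rintegral _ id)) => //.
have -> : e * (t - s) = \int[mu]_(r in `[s, t]) e by rewrite Rintegral_cst// lst.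
apply: le_Rintegral => //.
- exact: integrable_normr.
- exact: ie.
- by move=> r; rewrite /= in_itv/= => hr; rewrite distrC; exact: He.
Qed.

Lemma drift_bound w s t : good w -> 0 <= s -> s <= t -> `|drift s t w| <= C * (t - s).
Proof.
move=> gw s0 st; rewrite -normrN -[- _]add0r -(mulr0 (t - s)).
by apply: drift_close => // r _; rewrite subr0; case: bV.
Qed.

Section increments.
Variables (s t : R) (A : set Om) (phi : R -> R) (M : R).
Hypotheses (s0 : 0 <= s) (st : s < t) (FA : F s A) (mphi : measurable_fun setT phi)
  (phiM : forall w, A w -> `|phi (Y s w)| <= M).

Let Z w : R := \1_A w * phi (Y s w).
Let xi w : R := B t w - B s w.
Let h0 : 0 < t - s. Proof. by rewrite subr_gt0. Qed.
Let t0 : 0 <= t. Proof. exact: le_trans s0 (ltW st). Qed.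

Let mA : measurable A. Proof. by case: hF => _ mF _; exact: mF FA. Qed.

Let ZM w : `|Z w| <= `|M|.
Proof.
rewrite /Z indicE; have [|] := boolP (w \in A).
  by rewrite inE => Aw; rewrite mul1r (le_trans (phiM Aw))// ler_norm.
by rewrite mul0r normr0.
Qed.

Let mphiY : measurable_fun setT (fun w => phi (Y s w)).
Proof. exact (measurableT_comp mphi (mY s0)). Qed.

Let mZ : measurable_fun setT Z.
Proof. by apply: measurable_funM => //; exact: measurable_indic. Qed.

Lemma measurable_increment : measurable_fun setT xi.
Proof. by apply: measurable_funB; exact: mB. Qed.

Let law (D : set R) : measurable D ->
  P (xi @^-1` D) = normal_prob 0 (Num.sqrt (t - s)) D.
Proof. by case: langevin_brownian => _ _ _ + _ => /(_ s t s0 st D). Qed.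

Let FZ (D : set R) : measurable D -> F s (Z @^-1` D).
Proof.
move=> mD; case: hF => sF _ _; have sFs := sF s s0.
have -> : Z @^-1` D = (A `&` Y s @^-1` (phi @^-1` D)) `|`
                      (~` A `&` [set w | D 0]).
  apply/seteqP; split => w /=; rewrite /Z indicE.
    have [|] := boolP (w \in A); rewrite ?inE ?notin_setE => Aw.
      by rewrite mul1r => Dp; left; split; [exact: Aw|exact: Dp].
    by rewrite mul0r => D0; right; split; [exact: Aw|exact: D0].
  move=> [[Aw h]|[Aw h]]; first by rewrite mem_set// mul1r.
  by rewrite memNset// mul0r.
have FU E1 E2 : F s E1 -> F s E2 -> F s (E1 `|` E2).
  move=> h1 h2; rewrite -[_ `|` _]setCK setCU; apply: sigma_algebra_setC => //.
  by apply: sigma_algebra_setI => //; exact: sigma_algebra_setC.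
have F0 : F s set0 by case: sFs.
apply: FU; apply: sigma_algebra_setI => //.
- apply: langevin_adapted => //.
  by rewrite -[_ @^-1` _]setTI; exact: mphi.
- exact: sigma_algebra_setC.
- have [D0|D0] := pselect (D 0).
    rewrite (_ : [set _ | _] = ~` set0); first exact: sigma_algebra_setC.
    by apply/seteqP; split => w /=; [move=> _ []|move=> _].
  by rewrite (_ : [set _ | _] = set0)//; apply/seteqP; split => w /=; [move=> /D0|case].
Qed.

Let indep (D E : set R) : measurable D -> measurable E ->
  P (Z @^-1` D `&` xi @^-1` E) = (P (Z @^-1` D) * P (xi @^-1` E))%E.
Proof.
move=> mD mE; case: langevin_brownian => _ _ _ _ /(_ s t s0 st _ E (FZ mD) mE).
exact.
Qed.

(** \1_A * phi (Y s) is known at time s, hence independent of the increment of B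
    after s; this lemma and the next one differ only in the Gaussian moment. *)
Lemma increment_mean : P.-integrable setT (fun w => (Z w * xi w)%:E) /\
  \int[P]_w (Z w * xi w) = 0.
Proof.
have i1 : std.-integrable setT (fun u => (Num.sqrt (t - s) * u)%:E).
  by apply: integrable_scaler => //; exact integrable_std_id.
have [i ->] := integral_independent_product h0 mZ measurable_increment law indep
   (@measurable_id _ R setT) i1 ZM.
split; first exact: i.
have := RintegralZl (Num.sqrt (t - s)) measurableT (@integrable_std_id R).
by rewrite std_mean0 mulr0 => ->; rewrite mulr0.
Qed.

Lemma increment_variance :
  P.-integrable setT (fun w => (Z w * (xi w ^+ 2 - (t - s)))%:E) /\
  \int[P]_w (Z w * (xi w ^+ 2 - (t - s))) = 0.
Proof.
have sq : Num.sqrt (t - s) ^+ 2 = t - s by rewrite sqr_sqrtr// ltW.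
have i2 := integrable_scaler measurableT (t - s) (@integrable_std_sqr R).
have i1 : std.-integrable setT (fun u => ((Num.sqrt (t - s) * u) ^+ 2 - (t - s))%:E).
  have := integrable_subr measurableT i2 (integrable_std_cst (t - s)).
  by apply: eq_integrable => // u _; rewrite exprMn sq.
have mf : measurable_fun setT (fun x : R => x ^+ 2 - (t - s)).
  by apply: measurable_funB => //; exact: exprn_measurable.
have [i ->] := integral_independent_product h0 mZ measurable_increment law indep mf i1 ZM.
split; first exact: i.
have -> : \int[std]_u ((Num.sqrt (t - s) * u) ^+ 2 - (t - s)) =
    \int[std]_u ((t - s) * u ^+ 2 - (t - s)).
  by apply: eq_Rintegral => u _; rewrite exprMn sq.
have -> := RintegralB measurableT i2 (integrable_std_cst (t - s)).
by rewrite RintegralZl//; [rewrite std_var1 std_int_cst mulr1 subrr mulr0|exact: integrable_std_sqr].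
Qed.

Lemma increment_abs (q : nat) : std.-integrable setT (fun u => (`|u| ^+ q)%:E) ->
  P.-integrable setT (fun w => (`|xi w| ^+ q)%:E) /\
  \int[P]_w (`|xi w| ^+ q) = Num.sqrt (t - s) ^+ q * \int[std]_u (`|u| ^+ q).
Proof.
move=> iq; have iq' := integrable_scaler measurableT (Num.sqrt (t - s) ^+ q) iq.
have e u : `|Num.sqrt (t - s) * u| ^+ q = Num.sqrt (t - s) ^+ q * `|u| ^+ q.
  by rewrite normrM exprMn ger0_norm ?sqrtr_ge0.
have mf : measurable_fun setT (fun x : R => `|x| ^+ q).
  by apply: measurable_funX; exact: normr_measurable.
split.
  apply: (integrable_increment h0 measurable_increment law mf).
  by apply: eq_integrable iq' => // u _; rewrite e.
rewrite -RintegralZl// /Rintegral.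
rewrite (ge0_integral_increment h0 measurable_increment law (f := fun x => (`|x| ^+ q)%:E)).
- by congr fine; apply: eq_integral => u _; rewrite e.
- exact/measurable_EFinP.
- by move=> x; rewrite lee_fin exprn_ge0.
Qed.

End increments.
End dynkin.

(** * Exit time and grid approximation *)

Section exit_time.
Context {R : realType} d (Om : measurableType d) (P : probability Om R).
Variables (F : R -> set (set Om)) (B Y : R -> Om -> R) (V V1 : R -> R) (C x0 : R).
Hypotheses (bV : bounded_C11 C V V1) (hY : langevin_solution P F B V x0 Y).
Variables (a b : R).

Let hF := langevin_filtration hY.
Let aY := langevin_adapted hY.
Let cY := langevin_path hY.

(** Positive exactly on ]a, b[, so that the exit time is the hitting time of a
    sublevel set. *)
Definition inside (y : R) : R := Num.min (y - a) (b - y).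

Lemma inside_continuous : continuous inside.
Proof.
apply: (@continuous_of_lipschitz _ _ 1) => x y; rewrite mul1r /inside.
have h := ler_norm (x - y); have h' := ler_norm (- (x - y)); rewrite normrN in h'.
have [h1|h1] := leP (x - a) (b - x); have [h2|h2] := leP (y - a) (b - y);
  by rewrite ler_norml; apply/andP; split; lra.
Qed.

Lemma inside_gt0 y : (0 < inside y) = (a < y < b).
Proof. by rewrite /inside lt_min !subr_gt0. Qed.

Lemma exit_setE : `]-oo, a] `|` `[b, +oo[ = [set y | (inside y <= 0)%R].
Proof.
apply/seteqP; split => y /=; rewrite !in_itv/= andbT [inside y <= 0]leNgt inside_gt0.
  move=> [h|h]; apply/negP => /andP[h1 h2].
    by have := lt_le_trans h1 h; rewrite ltxx.
  by have := lt_le_trans h2 h; rewrite ltxx.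
by rewrite negb_and -!leNgt => /orP[h|h]; [left|right].
Qed.

Definition exit_time w : \bar R := hitting_time Y (`]-oo, a] `|` `[b, +oo[) w.

Local Notation alive t := (stays Y inside t).

Lemma alive_exit t w : 0 <= t -> alive t w <-> (t%:E < exit_time w)%E.
Proof.
by move=> t0; rewrite /exit_time exit_setE; apply: stays_hitting => //; exact: inside_continuous.
Qed.

Lemma exit_time_ge0 w : (0 <= exit_time w)%E.
Proof. exact: hitting_time_ge0. Qed.

(** The minimum is finite, although the exit time may not be. *)
Definition stopped t w : R := fine (Order.min (exit_time w) t%:E).

Lemma stoppedE t w : 0 <= t -> ((stopped t w)%:E = Order.min (exit_time w) t%:E)%E.
Proof.
move=> t0; rewrite /stopped fineK// fin_numE; have := exit_time_ge0 w.
rewrite /Order.min; case: ifP => // h e0; apply/andP; split.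
  by apply/eqP => e; move: e0; rewrite e.
by apply/eqP => e; move: h; rewrite e ltNge leey.
Qed.

Lemma stopped_ge0 t w : 0 <= t -> 0 <= stopped t w.
Proof. by move=> t0; rewrite -lee_fin stoppedE// le_min exit_time_ge0 lee_fin. Qed.

Lemma stopped_le t w : 0 <= t -> stopped t w <= t.
Proof. by move=> t0; rewrite -lee_fin stoppedE// ge_min lexx orbT. Qed.

(** G is the first grid time, at most t, at which the path is known to have left
    ]a, b[.  It overshoots the exit time by at most h, and the increments of
    U (Y) over the performed steps telescope. *)
Lemma grid_close t n w (U : R -> R) : 0 < t ->
  let h := t / n.+1%:R in
  let G := \sum_(0 <= i < n.+1) h * \1_(alive (i%:R * h)) w in
  [/\ 0 <= G, G <= t, `|G - stopped t w| <= h &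
   \sum_(0 <= i < n.+1) \1_(alive (i%:R * h)) w *
      (U (Y (i.+1%:R * h) w) - U (Y (i%:R * h) w)) = U (Y G w) - U (Y 0 w)].
Proof.
move=> t0 h G; have h0 : 0 < h by rewrite divr_gt0.
have ht : n.+1%:R * h = t by rewrite /h mulrC divfK.
pose N i := w \in alive (i%:R * h).
have ih0 (i : nat) : 0 <= i%:R * h by rewrite mulr_ge0// ltW.
have Nd i : N i.+1 -> N i.
  rewrite /N !inE; apply: stays_sub; rewrite ler_pM2r// ler_nat//.
have [k [kn e1 e2 h1 h2]] := grid_stopping (fun s => U (Y s w)) h Nd n.+1.
have GE : G = k%:R * h by rewrite -e1; apply: eq_bigr => i _; rewrite indicE.
have kt : k%:R * h <= t by rewrite -ht ler_pM2r// ler_nat.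
split.
- by rewrite GE.
- by rewrite GE.
- have NP i : N i -> ((i%:R * h)%:E < exit_time w)%E by rewrite /N inE => /(alive_exit _ (ih0 i)).
  have NNP i : ~~ N i -> (exit_time w <= (i%:R * h)%:E)%E.
    by move=> Ni; rewrite leNgt; apply: contra Ni => /(alive_exit _ (ih0 i)); rewrite /N inE.
  have up : stopped t w <= G + h.
    rewrite GE; case: h2 => [->|/NNP h2].
      by rewrite ht (le_trans (stopped_le w (ltW t0)))// lerDl ltW.
    rewrite (@le_trans _ _ (k%:R * h))//; last by rewrite lerDl ltW.
    by rewrite -lee_fin stoppedE ?(ltW t0)// ge_min h2.
  have low : G - h <= stopped t w.
    rewrite GE; case: h1 => [->|].
      by rewrite mul0r sub0r (le_trans _ (stopped_ge0 w (ltW t0)))// oppr_le0 ltW.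
    case: k {e1 e2 h2 GE} kn kt => [|k] kn kt h1.
      by rewrite mul0r sub0r (le_trans _ (stopped_ge0 w (ltW t0)))// oppr_le0 ltW.
    have -> : k.+1%:R * h - h = k%:R * h by rewrite -natr1; ring.
    rewrite -lee_fin stoppedE ?(ltW t0)// le_min ltW ?NP//= lee_fin.
    by rewrite (le_trans _ kt)// ler_pM2r// ler_nat.
  by rewrite ler_norml; apply/andP; split; lra.
- by rewrite GE -e2; apply: eq_bigr => i _; rewrite indicE.
Qed.

Lemma path_cvg (g : R -> R) (r : nat -> R) (s : R) : path_continuous g -> 0 <= s ->
  (forall n, 0 <= r n) -> r n @[n --> \oo] --> s -> g (r n) @[n --> \oo] --> g s.
Proof.
move=> cg s0 r0 /cvgrPdist_lt rs; apply/cvgrPdist_lt => e e0.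
have [dl dl0 hd] := cg s s0 e e0; apply: filterS (rs _ dl0) => n h.
by rewrite distrC; apply: hd => //; rewrite distrC.
Qed.

Lemma mesh_cvg0 (t : R) : t / n.+1%:R @[n --> \oo] --> 0.
Proof.
rewrite -[X in _ --> X](mulr0 t); apply: cvgM; first exact: cvg_cst.
exact: cvg_harmonic.
Qed.

Lemma grid_sum_cvg t w : 0 < t ->
  \sum_(0 <= i < n.+1) t / n.+1%:R * \1_(alive (i%:R * (t / n.+1%:R))) w
    @[n --> \oo] --> stopped t w.
Proof.
move=> t0; apply/cvgrPdist_lt => e e0.
have /cvgrPdist_lt/(_ _ e0) := mesh_cvg0 t; apply: filterS => n.
rewrite sub0r normrN ger0_norm ?divr_ge0 ?ltW// => he.
have [_ _ h _] := @grid_close t n w id t0.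
by rewrite distrC; exact: le_lt_trans h he.
Qed.

Lemma alive_measurable t : 0 <= t -> measurable (alive t).
Proof. by move=> t0; apply: (stays_measurable hF aY cY inside_continuous). Qed.

Lemma measurable_stopped t : 0 < t -> measurable_fun setT (stopped t).
Proof.
move=> t0; apply: (@measurable_fun_cvg _ _ _ _ (fun n w =>
  \sum_(0 <= i < n.+1) t / n.+1%:R * \1_(alive (i%:R * (t / n.+1%:R))) w)).
  move=> n; apply: measurable_sum => i; apply: measurable_funM => //.
  apply: measurable_indic; apply: alive_measurable.
  by rewrite mulr_ge0// divr_ge0// ltW.
by move=> w _; exact: grid_sum_cvg.
Qed.

End exit_time.

(** * Dynkin's formula *)

Section dynkin_formula.
Context {R : realType} d (Om : measurableType d) (P : probability Om R).
Local Notation std := (@normal_prob R 0 1).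
Variables (F : R -> set (set Om)) (B Y : R -> Om -> R) (V V1 : R -> R) (C x0 : R).
Hypotheses (bV : bounded_C11 C V V1) (hY : langevin_solution P F B V x0 Y).
Variables (a b : R) (U U1 U2 : R -> R) (M L c : R).
Hypotheses (M0 : 0 <= M) (L0 : 0 <= L) (cU : continuous U) (UM : forall y, `|U y| <= M)
  (mU1 : measurable_fun setT U1) (mU2 : measurable_fun setT U2)
  (U1M : forall y, a < y < b -> `|U1 y| <= M)
  (U2M : forall y, a < y < b -> `|U2 y| <= M)
  (UT : forall y k, a < y < b ->
    `|U (y + k) - U y - U1 y * k - U2 y / 2 * k ^+ 2| <= L * `|k| ^+ 3)
  (UL : forall y, a < y < b -> U2 y - V1 y * U1 y = - c).

Let hF := langevin_filtration hY.
Let aY := langevin_adapted hY.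
Let cY := langevin_path hY.
Let C0 : 0 <= C. Proof. by case: bV => _ h _ _; exact: le_trans (h 0). Qed.
Let cV1 : continuous V1.
Proof. by case: bV => _ _ _ h; exact: continuous_of_lipschitz h. Qed.
Let mY t : 0 <= t -> measurable_fun setT (Y t).
Proof. exact: (adapted_measurable hY aY). Qed.
Let mU : measurable_fun setT U. Proof. exact: continuous_measurable_fun. Qed.
Let mV1 : measurable_fun setT V1. Proof. exact: continuous_measurable_fun. Qed.

Local Notation alive t := (stays Y (inside a b) t).

Let alive_in t w : 0 <= t -> alive t w -> a < Y t w < b.
Proof. by move=> t0 h; rewrite -inside_gt0; apply: h; rewrite t0/=. Qed.

(** The increment of c t + U (Y t) on [s, t], without its quadrature error
    U1 (Y s) ((t - s) V1 (Y s) - drift): the latter is O(t - s) only, and tends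
    to 0 path by path, by uniform continuity of the path, once summed over the
    grid. *)
Definition euler_step s t w : R := \1_(alive s) w *
  (U (Y t w) - U (Y s w) + c * (t - s) - U1 (Y s w) * ((t - s) * V1 (Y s w) - drift B Y s t w)).

Definition step_error (h : R) : R :=
  12 * L * (Num.sqrt h ^+ 3 * \int[std]_u `|u| ^+ 3) + 4 * L * C ^+ 3 * h ^+ 3
  + 2 * M * C * h * (Num.sqrt h ^+ 1 * \int[std]_u `|u| ^+ 1) + M * C ^+ 2 * h ^+ 2.

(** The event that the path has not left ]a, b[ before s belongs to F s.  So the
    second order expansion of the step has mean zero, and the error is that of
    taylor_step_bound, the moments of the increment being those of
    sqrt (t - s) N. *)
Lemma euler_step_mean s t : 0 <= s -> s < t ->
  P.-integrable setT (fun w => (euler_step s t w)%:E) /\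
  `|\int[P]_w euler_step s t w| <= step_error (t - s).
Proof.
move=> s0 st; have t0 : 0 <= t := le_trans s0 (ltW st).
have h0 : 0 <= t - s by rewrite subr_ge0 ltW.
have FA : F s (alive s) by apply: (stays_event hF aY cY) => //; exact: inside_continuous.
have mA : measurable (alive s) by exact: (alive_measurable hY).
have b1 w : alive s w -> `|U1 (Y s w)| <= M by move=> /(alive_in s0); exact: U1M.
have b2 w : alive s w -> `|U2 (Y s w)| <= M by move=> /(alive_in s0); exact: U2M.
have [i1 e1] := increment_mean hY s0 st FA mU1 b1.
have [i2 e2] := increment_variance hY s0 st FA mU2 b2.
have i1s : std.-integrable setT (fun u => (`|u| ^+ 1)%:E) by exact integrable_std_abs.
have [ia3 ea3] := increment_abs hY s0 st integrable_std_abs3.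
have [ia1 ea1] := increment_abs hY s0 st i1s.
have mxi := measurable_increment hY s0 st.
cbv beta in i1, e1, i2, e2, ia3, ea3, ia1, ea1.
pose mart w := Num.sqrt 2 * (\1_(alive s) w * U1 (Y s w) * (B t w - B s w))
   + \1_(alive s) w * U2 (Y s w) * ((B t w - B s w) ^+ 2 - (t - s)).
pose err w := (12 * L) * `|B t w - B s w| ^+ 3 + 4 * L * C ^+ 3 * (t - s) ^+ 3
   + (2 * M * C * (t - s)) * `|B t w - B s w| ^+ 1 + M * C ^+ 2 * (t - s) ^+ 2.
have is1 := integrable_scaler measurableT (Num.sqrt 2) i1.
have im : P.-integrable setT (fun w => (mart w)%:E) by exact: integrable_addr.
have m0 : \int[P]_w mart w = 0.
  by rewrite RintegralD// RintegralZl// e1 e2 mulr0 addr0.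
have icst (x : R) : P.-integrable setT (fun _ : Om => x%:E).
  exact: finite_measure_integrable_cst.
have cstE (x : R) : \int[P]_w x = x.
  by have := probability_setT P => h; rewrite Rintegral_cst// [X in fine X]h mulr1.
have j1 := integrable_scaler measurableT (12 * L) ia3.
have j2 := integrable_addr measurableT j1 (icst (4 * L * C ^+ 3 * (t - s) ^+ 3)).
have j3 := integrable_scaler measurableT (2 * M * C * (t - s)) ia1.
have j4 := integrable_addr measurableT j2 j3.
have ie : P.-integrable setT (fun w => (err w)%:E).
  by exact: (integrable_addr measurableT j4 (icst (M * C ^+ 2 * (t - s) ^+ 2))).
have eE : \int[P]_w err w = step_error (t - s).
  rewrite (RintegralD measurableT j4 (icst _)) (RintegralD measurableT j2 j3).
  rewrite (RintegralD measurableT j1 (icst _)) !cstE.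
  by rewrite (RintegralZl _ measurableT ia3) (RintegralZl _ measurableT ia1) ea3 ea1.
have me : measurable_fun setT (euler_step s t).
  apply: measurable_funM; first exact: measurable_indic.
  have p1 : measurable_fun setT (fun w => U (Y t w)) by exact (measurableT_comp mU (mY t0)).
  have p2 : measurable_fun setT (fun w => U (Y s w)) by exact (measurableT_comp mU (mY s0)).
  have p3 : measurable_fun setT (fun w => U1 (Y s w)) by exact (measurableT_comp mU1 (mY s0)).
  have p4 : measurable_fun setT (fun w => V1 (Y s w)) by exact (measurableT_comp mV1 (mY s0)).
  apply: measurable_funB.
    by apply: measurable_funD => //; apply: measurable_funB.
  apply: measurable_funM => //; apply: measurable_funB; first exact: measurable_funM.
  apply: measurable_funB; first exact: measurable_funM.
  by apply: measurable_funB; apply: mY.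
have mm : measurable_fun setT mart by exact/measurable_EFinP/(measurable_int _ im).
have close : {ae P, forall w, `|euler_step s t w - mart w| <= err w}.
  apply: filterS (ae_good bV hY) => w gw.
  have err0 : 0 <= err w.
    by rewrite /err !addr_ge0// !mulr_ge0// ?exprn_ge0.
  rewrite /euler_step /mart indicE; case: (boolP (w \in alive s)) => [|_]; last first.
    by rewrite !mul0r mulr0 addr0 subr0 normr0.
  rewrite inE => Aw; rewrite !mul1r; have Yab := alive_in s0 Aw.
  have db := drift_bound bV hY gw s0 (ltW st).
  have YE : Y t w = Y s w + (Num.sqrt 2 * (B t w - B s w) - drift B Y s t w).
    by rewrite /drift; ring.
  have HT := UT (Num.sqrt 2 * (B t w - B s w) - drift B Y s t w) Yab.
  rewrite -YE in HT.
  have := taylor_step_bound h0 L0 C0 (U1M Yab) (U2M Yab) db (UL Yab) HT.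
  by rewrite /err expr1; congr (`|_| <= _); rewrite -mulrA.
have [id hd] := ae_bounded_integral (measurable_funB me mm) ie close.
have iE : P.-integrable setT (fun w => (euler_step s t w)%:E).
  have := integrable_addr measurableT id im.
  by apply: eq_integrable => // w _ /=; rewrite subrK.
split; first exact: iE.
by move: hd; rewrite RintegralB// m0 subr0 eE.
Qed.

(** step_error h is O(h ^ (3 / 2)) and there are t / h steps. *)
Lemma total_step_error_cvg t : 0 < t ->
  n.+1%:R * step_error (t / n.+1%:R) @[n --> \oo] --> 0.
Proof.
move=> t0.
set m3 := \int[std]_u `|u| ^+ 3; set m1 := \int[std]_u `|u| ^+ 1.
pose eta h := (12 * L * m3 + 2 * M * C * m1) * Num.sqrt h + 4 * L * C ^+ 3 * h ^+ 2
   + M * C ^+ 2 * h.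
have -> : (fun n : nat => n.+1%:R * step_error (t / n.+1%:R)) = (fun n : nat => t * eta (t / n.+1%:R)).
  apply/funext => n; set h := t / _.
  have h0 : 0 <= h by rewrite divr_ge0// ltW.
  have -> : step_error h = h * eta h.
    rewrite /step_error -/m3 -/m1 /eta.
    have -> : Num.sqrt h ^+ 3 = h * Num.sqrt h by rewrite exprSr sqr_sqrtr.
    by rewrite expr1; ring.
  by rewrite mulrA [_ * h]mulrC /h divfK.
have hc := mesh_cvg0 t.
have sc : Num.sqrt (t / n.+1%:R) @[n --> \oo] --> (0 : R).
  by rewrite -[X in _ --> X]sqrtr0; exact: (cvg_comp _ _ hc (@sqrt_continuous R 0)).
have h2c : (t / n.+1%:R) ^+ 2 @[n --> \oo] --> (0 : R).
  by rewrite -[X in _ --> X](expr0n R 2); exact: (cvg_comp _ _ hc (@exprn_continuous R 2 0)).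
rewrite -[X in _ --> X](mulr0 t); apply: cvgM; first exact: cvg_cst.
rewrite (_ : 0 = (12 * L * m3 + 2 * M * C * m1) * 0 + 4 * L * C ^+ 3 * 0 + M * C ^+ 2 * 0); last by ring.
by apply: cvgD; [apply: cvgD|]; apply: cvgM => //; exact: cvg_cst.
Qed.

Lemma measurable_stopped_value t : 0 < t ->
  measurable_fun setT (fun w => U (Y (stopped Y a b t w) w)).
Proof.
move=> t0; pose G n w := \sum_(0 <= i < n.+1) t / n.+1%:R * \1_(alive (i%:R * (t / n.+1%:R))) w.
have ih0 n (i : nat) : 0 <= i%:R * (t / n.+1%:R) by rewrite mulr_ge0// divr_ge0// ltW.
apply: (@measurable_fun_cvg _ _ _ _ (fun n w => U (Y (G n w) w))) => [n|w _].
  rewrite (_ : (fun w => _) = (fun w => (U (Y (G n w) w) - U (Y 0 w)) + U (Y 0 w))); last first.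
    by apply/funext => w; rewrite subrK.
  have p0 : measurable_fun setT (fun w => U (Y 0 w)) by exact (measurableT_comp mU (mY (lexx 0))).
  apply: measurable_funD => //.
  rewrite (_ : (fun w => _) = (fun w => \sum_(0 <= i < n.+1) \1_(alive (i%:R * (t / n.+1%:R))) w *
      (U (Y (i.+1%:R * (t / n.+1%:R)) w) - U (Y (i%:R * (t / n.+1%:R)) w)))); last first.
    by apply/funext => w; have [_ _ _ ->] := grid_close hY a b n w U t0.
  apply: measurable_sum => i; apply: measurable_funM.
    by apply: measurable_indic; exact: (alive_measurable hY).
  by apply: measurable_funB; exact (measurableT_comp mU (mY (ih0 _ _))).
apply: (path_cvg (path_continuous_comp cU (cY w))).
- exact: stopped_ge0 (ltW t0).
- by move=> n; have [h _ _ _] := grid_close hY a b n w U t0.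
- exact: (grid_sum_cvg hY).
Qed.

(** The sum f n of the steps has a mean that tends to 0; it is bounded, and
    converges path by path to c * stopped + U (Y stopped) - U (Y 0). *)
Theorem dynkin_formula t : 0 < t ->
  P.-integrable setT (fun w => (c * stopped Y a b t w + U (Y (stopped Y a b t w) w))%:E) /\
  \int[P]_w (c * stopped Y a b t w + U (Y (stopped Y a b t w) w)) = U x0.
Proof.
move=> t0; pose h n : R := t / n.+1%:R.
have h0 n : 0 < h n by rewrite divr_gt0.
have ih0 n (i : nat) : 0 <= i%:R * h n by rewrite mulr_ge0// ltW.
have ihS n (i : nat) : i.+1%:R * h n - i%:R * h n = h n by rewrite -natr1; ring.
have ihlt n (i : nat) : i%:R * h n < i.+1%:R * h n by rewrite -subr_gt0 ihS.
have hn n : n.+1%:R * h n = t by rewrite /h mulrC divfK.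
pose f n w := \sum_(0 <= i < n.+1) euler_step (i%:R * h n) (i.+1%:R * h n) w.
(* A n collects the quadrature errors. *)
pose A n w := \sum_(0 <= i < n.+1) \1_(alive (i%:R * h n)) w * (U1 (Y (i%:R * h n) w) *
  (h n * V1 (Y (i%:R * h n) w) - drift B Y (i%:R * h n) (i.+1%:R * h n) w)).
pose G n w := \sum_(0 <= i < n.+1) h n * \1_(alive (i%:R * h n)) w.
have fE n w : f n w = U (Y (G n w) w) - U (Y 0 w) + c * G n w - A n w.
  have [_ _ _ <-] := grid_close hY a b n w U t0.
  rewrite /A /G mulr_sumr -big_split/= -sumrB; apply: eq_bigr => i _.
  by rewrite /euler_step ihS; set p := \1_(_) w; rewrite -/(h n); ring.
have fint n : P.-integrable setT (fun w => (f n w)%:E) /\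
    `|\int[P]_w f n w| <= n.+1%:R * step_error (h n).
  have ist i : P.-integrable setT (fun w => (euler_step (i%:R * h n) (i.+1%:R * h n) w)%:E).
    by have [] := euler_step_mean (ih0 n i) (ihlt n i).
  have [i ->] := Rintegral_sum measurableT (r := index_iota 0 n.+1)
    (F := fun i w => euler_step (i%:R * h n) (i.+1%:R * h n) w) (fun i _ => ist i).
  split; first exact: i.
  apply: (le_trans (ler_norm_sum _ _ _)).
  have -> : n.+1%:R * step_error (h n) = \sum_(0 <= i < n.+1) step_error (h n).
    by rewrite big_const_nat iter_addr addr0 subn0 mulr_natl.
  apply: ler_sum => k _; have [_] := euler_step_mean (ih0 n k) (ihlt n k).
  by rewrite ihS.
have Abound n w e : 0 <= e -> good B Y V1 x0 w ->
   (forall i, (i < n.+1)%N -> `|h n * V1 (Y (i%:R * h n) w) - drift B Y (i%:R * h n) (i.+1%:R * h n) w| <= e * h n) ->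
   `|A n w| <= M * e * t.
  move=> e0 gw H; apply: (le_trans (ler_norm_sum _ _ _)).
  have -> : M * e * t = \sum_(0 <= i < n.+1) M * (e * h n).
    by rewrite big_const_nat iter_addr addr0 subn0 -mulr_natl -(hn n); ring.
  apply: ler_sum_nat => i /andP[_ iN]; rewrite normrM indicE.
  have Meh : 0 <= M * (e * h n) by rewrite !mulr_ge0// ltW.
  case: (boolP (w \in _)) => [|_]; last by rewrite normr0 mul0r.
  rewrite inE => Aw; rewrite normr1 mul1r normrM ler_pM//; last exact: H.
  exact: U1M (alive_in (ih0 n i) Aw).
have Gcvg w : G n w @[n --> \oo] --> stopped Y a b t w by exact: (grid_sum_cvg hY).
have Gprop n w : 0 <= G n w <= t.
  by have [p1 p2 _ _] := grid_close hY a b n w U t0; apply/andP; split.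
(* The modulus of continuity of V1 (Y) on [0, t] bounds each quadrature error by
   e / (M t + 1) * h. *)
have Acvg w : good B Y V1 x0 w -> A n w @[n --> \oo] --> (0 : R).
  move=> gw; apply/cvgr0Pnorm_le => e e0.
  have Mt0 : 0 < M * t + 1 by rewrite ltr_wpDl// mulr_ge0// ltW.
  have [dl dl0 hdl] := path_unif_continuous t
     (path_continuous_comp cV1 (cY w)) (divr_gt0 e0 Mt0).
  have /cvgrPdist_lt/(_ _ dl0) := mesh_cvg0 t; apply: filterS => n.
  rewrite sub0r normrN -/(h n) gtr0_norm// => hd.
  have eM0 : 0 <= e / (M * t + 1) by rewrite divr_ge0// ltW.
  apply: (le_trans (Abound n w _ eM0 gw _)).
    move=> i iN; rewrite -[X in X * V1 _](ihS n i) -[X in _ <= _ * X](ihS n i).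
    apply: (drift_close bV hY gw (ih0 n i) (ltW (ihlt n i))) => r /andP[r1 r2].
    have it : i.+1%:R * h n <= t by rewrite -(hn n) ler_pM2r// ler_nat.
    have i0 := ih0 n i; have iS := ihS n i.
    by apply/ltW/hdl; [apply/andP; split; lra|apply/andP; split; lra|rewrite ger0_norm; lra].
  rewrite (_ : M * (e / (M * t + 1)) * t = e * (M * t / (M * t + 1))); last by ring.
  by rewrite ler_piMr ?ltW// ltr_pdivrMr// mul1r ltrDl.
pose lim w := c * stopped Y a b t w + U (Y (stopped Y a b t w) w) - U (Y 0 w).
have mst := measurable_stopped hY a b t0.
have mU0 : measurable_fun setT (fun w => U (Y 0 w)) by exact (measurableT_comp mU (mY (lexx 0))).
have mlim : measurable_fun setT lim.
  apply: measurable_funB => //; apply: measurable_funD; last exact: measurable_stopped_value.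
  exact: measurable_funM.
have bnd : {ae P, forall w, forall n, setT w -> `|f n w| <= 2 * M + `|c| * t + M * (2 * C) * t}.
  apply: filterS (ae_good bV hY) => w gw n _; rewrite fE.
  have a1 : `|A n w| <= M * (2 * C) * t.
    apply: Abound => //; first by rewrite mulr_ge0.
    move=> i _; rewrite (le_trans (ler_normB _ _))//.
    have := drift_bound bV hY gw (ih0 n i) (ltW (ihlt n i)); rewrite ihS => db.
    have vb : `|V1 (Y (i%:R * h n) w)| <= C by case: bV.
    rewrite normrM gtr0_norm//.
    have := ler_wpM2l (ltW (h0 n)) vb; lra.
  have a2 := UM (Y (G n w) w); have a3 := UM (Y 0 w).
  have a4 : `|c * G n w| <= `|c| * t.
    have /andP[g1 g2] := Gprop n w.
    by rewrite normrM (ger0_norm g1) ler_wpM2l.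
  rewrite (le_trans (ler_normB _ _))// lerD//.
  rewrite (le_trans (ler_normD _ _))// lerD//.
  rewrite (le_trans (ler_normB _ _))//; lra.
have ae_lim : {ae P, forall w, setT w -> f n w @[n --> \oo] --> lim w}.
  apply: filterS (ae_good bV hY) => w gw _.
  rewrite (_ : (fun n => f n w) = (fun n => U (Y (G n w) w) - U (Y 0 w) + c * G n w - A n w)); last first.
    by apply/funext => n; exact: fE.
  rewrite (_ : lim w = U (Y (stopped Y a b t w) w) - U (Y 0 w) + c * stopped Y a b t w - 0); last first.
    by rewrite /lim; ring.
  apply: cvgB; last exact: Acvg.
  apply: cvgD; last by apply: cvgM => //; exact: cvg_cst.
  apply: cvgB; last exact: cvg_cst.
  apply: (path_cvg (path_continuous_comp cU (cY w))) => //.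
  - exact: stopped_ge0 (ltW t0).
  - by move=> n; case/andP: (Gprop n w).
have ib : P.-integrable setT (EFin \o (fun _ : Om => 2 * M + `|c| * t + M * (2 * C) * t)).
  exact: finite_measure_integrable_cst.
have mf n : measurable_fun setT (f n) by have [i _] := fint n; exact/measurable_EFinP/(measurable_int _ i).
have [il cl] := Rdominated_cvg measurableT mf mlim ae_lim ib bnd.
have l0 : \int[P]_w lim w = 0.
  have z : \int[P]_w f n w @[n --> \oo] --> (0 : R).
    apply: norm_cvg0; apply: (@squeeze_cvgr _ _ _ _ (fun=> 0) (fun n : nat => n.+1%:R * step_error (h n))).
    - by near=> n; rewrite normr_ge0/=; have [_] := fint n.
    - exact: cvg_cst.
    - exact: total_step_error_cvg.
  exact: (cvg_unique _ cl z).
have y0 : {ae P, forall w, U (Y 0 w) = U x0} by apply: filterS (ae_good bV hY) => w [-> _].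
have icst : P.-integrable setT (fun _ : Om => (U x0)%:E) by exact: finite_measure_integrable_cst.
have iY0 : P.-integrable setT (fun w => (U (Y 0 w))%:E).
  have := ae_bounded_integral mU0 (G := fun=> M) (P := P).
  case; [exact: finite_measure_integrable_cst|exact: aeW|by []].
have iE : P.-integrable setT (fun w => (c * stopped Y a b t w + U (Y (stopped Y a b t w) w))%:E).
  have := integrable_addr measurableT il iY0.
  by apply: eq_integrable => // w _; rewrite /lim subrK.
split; first exact: iE.
have e0 : \int[P]_w U (Y 0 w) = U x0.
  rewrite /Rintegral (ae_eq_integral (fun=> (U x0)%:E))//.
  - by have := probability_setT P => h'; rewrite integral_cst// [X in (_ * X)%E]h' mule1.
  - exact/measurable_EFinP.
  - by apply: filterS y0 => w -> _.
by move: l0; rewrite /lim RintegralB// e0 => /eqP; rewrite subr_eq0 => /eqP.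
Unshelve. all: by end_near. Qed.

End dynkin_formula.

(** * Freezing a test function outside a neighbourhood of [a, b] *)

Section cutoff.
Context {R : realType}.
Implicit Types (f df : R -> R).

(** The mean value theorem, once for the remainder and once for df. *)
Lemma taylor2 f df d2f (y k L : R) : 0 <= L ->
  (forall x, is_derive x (1 : R) f (df x)) ->
  (forall x, is_derive x (1 : R) df (d2f x)) ->
  (forall x, `|x - y| <= `|k| -> `|d2f x - d2f y| <= L * `|x - y|) ->
  `|f (y + k) - f y - df y * k - d2f y / 2 * k ^+ 2| <= L * `|k| ^+ 3.
Proof.
move=> L0 fd dfd hL.
pose r z := f z - df y * (z - y) - d2f y / 2 * (z - y) ^+ 2.
have dr (z : R) : is_derive z (1 : R) r (df z - df y - d2f y * (z - y)).
  have := fd z => ?; apply: is_derive_eq.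
  by rewrite /GRing.scale /= ?scaler0; field.
have yk : y + k - y = k by ring.
have [z [zy _ e]] := mean_value dr y (y + k); rewrite yk in zy e.
have [x [xz _ e']] := mean_value dfd y z.
have -> : f (y + k) - f y - df y * k - d2f y / 2 * k ^+ 2 = r (y + k) - r y.
  by rewrite /r; field.
have -> : r (y + k) - r y = (d2f x - d2f y) * (z - y) * k by rewrite e e'; ring.
rewrite !normrM.
have h1 := hL _ (le_trans xz zy).
have h2 : `|d2f x - d2f y| <= L * `|k|.
  by rewrite (le_trans h1)// ler_wpM2l// (le_trans xz).
rewrite (@le_trans _ _ (L * `|k| * `|k| * `|k|))//; last first.
  by rewrite !exprS expr0 mulr1 !mulrA.
rewrite ler_wpM2r// ler_pM//.
Qed.

Lemma continuous_bounded_itv f (a b : R) : continuous f ->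
  exists2 M, 0 <= M & forall x, a <= x <= b -> `|f x| <= M.
Proof.
move=> cf; have [ab|ab] := leP a b; last first.
  by exists 0 => // x /andP[h1 h2]; have := le_trans h1 h2; rewrite leNgt ab.
have cn : {within `[a, b], continuous (fun x => `|f x|)}.
  by apply: continuous_subspaceT => x; apply: continuous_comp; [exact: cf|exact: norm_continuous].
have [c cab hc] := EVT_max ab cn.
by exists `|f c| => // x xab; apply: hc; rewrite in_itv.
Qed.

Definition clip (a b x : R) : R := Num.max a (Num.min x b).

Lemma clip_id a b x : a <= x <= b -> clip a b x = x.
Proof. by move=> /andP[ax xb]; rewrite /clip (min_l xb) (max_r ax). Qed.

Lemma clip_itv a b x : a <= b -> a <= clip a b x <= b.
Proof. by move=> ab; rewrite /clip le_max lexx/= ge_max ab ge_min lexx orbT. Qed.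

Lemma clip_lipschitz a b x y : a <= b -> `|clip a b x - clip a b y| <= 1 * `|x - y|.
Proof.
move=> ab; rewrite mul1r /clip.
have h := ler_norm (x - y); have h' := ler_norm (- (x - y)); rewrite normrN in h'.
have [h1|h1] := leP x b; have [h2|h2] := leP y b;
  repeat match goal with |- context [Num.max ?u ?v] => have [?|?] := leP u v end;
  rewrite ler_norml; apply/andP; split; lra.
Qed.

(** The functions to which the martingale argument applies have to be bounded
    on the whole line, because the increments of the path are unbounded:
    freezing a C^2 function outside a neighbourhood of [a, b] provides one, and
    the cubic Taylor remainder survives, as steps leaving this neighbourhood
    are longer than 1. *)
Lemma cutoff_exists f df d2f (a b L : R) : a <= b -> 0 <= L ->
  (forall x, is_derive x (1 : R) f (df x)) ->
  (forall x, is_derive x (1 : R) df (d2f x)) -> continuous d2f ->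
  (forall x y, a - 1 <= x <= b + 1 -> a - 1 <= y <= b + 1 ->
     `|d2f x - d2f y| <= L * `|x - y|) ->
  exists U M L', [/\ 0 <= M, 0 <= L', continuous U, forall y, `|U y| <= M &
   [/\ forall y, a <= y <= b -> U y = f y,
       forall y, a < y < b -> `|df y| <= M,
       forall y, a < y < b -> `|d2f y| <= M &
       forall y k, a < y < b ->
    `|U (y + k) - U y - df y * k - d2f y / 2 * k ^+ 2| <= L' * `|k| ^+ 3]].
Proof.
move=> ab L0 fd dfd cd2 lip; set a' := a - 1; set b' := b + 1.
have a'b' : a' <= b' by rewrite /a' /b'; lra.
have cf := is_derive_continuous fd; have cdf := is_derive_continuous dfd.
have [M1 M10 h1] := continuous_bounded_itv a' b' cf.
have [M2 M20 h2] := continuous_bounded_itv a' b' cdf.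
have [M3 M30 h3] := continuous_bounded_itv a' b' cd2.
pose M := M1 + M2 + M3.
have M0 : 0 <= M by rewrite /M !addr_ge0.
have ab' y : a <= y <= b -> a' <= y <= b' by rewrite /a' /b'; lra.
have abw y : a < y < b -> a <= y <= b by move=> /andP[p q]; rewrite !ltW.
have b1 y : a <= y <= b -> `|df y| <= M.
  by move=> /ab' /h2 h; rewrite (le_trans h)// /M; lra.
have b2 y : a <= y <= b -> `|d2f y| <= M.
  by move=> /ab' /h3 h; rewrite (le_trans h)// /M; lra.
have bU y : `|f (clip a' b' y)| <= M.
  by rewrite (le_trans (h1 _ (clip_itv y a'b')))// /M; lra.
exists (fun y => f (clip a' b' y)), M, (L + 4 * M); split => //.
- by rewrite addr_ge0// mulr_ge0.
- move=> y; apply: continuous_comp; last exact: cf.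
  by apply: (@continuous_of_lipschitz _ _ 1) => u v; exact: clip_lipschitz.
- split => [y yab|y /abw|y /abw|y k yab0]; [by rewrite clip_id// ab'|exact: b1|exact: b2|].
  have yab := abw _ yab0.
  have yE : clip a' b' y = y by rewrite clip_id// ab'.
  have k3 : 0 <= `|k| ^+ 3 by rewrite exprn_ge0.
  have [k1|k1] := leP `|k| 1.
    have ky x : `|x - y| <= `|k| -> a' <= x <= b'.
      move=> xk; have := le_trans xk k1; rewrite ler_norml /a' /b' => /andP[p q].
      by move: yab => /andP[p' q']; apply/andP; split; lra.
    have ky' : clip a' b' (y + k) = y + k by rewrite clip_id// ky// addrAC subrr add0r.
    rewrite ky' yE (le_trans (taylor2 L0 fd dfd _))//.
      by move=> x /ky xab; apply: lip => //; exact: ab'.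
    by rewrite ler_wpM2r// lerDl mulr_ge0.
  (* For |k| > 1 all the terms of the expansion are bounded multiples of
     |k| ^ 3. *)
  have u1 := bU (y + k); have u2 := bU y; have u3 := b1 _ yab; have u4 := b2 _ yab.
  set x := `|k| in k1 k3 *.
  have x0 : 0 <= x by rewrite /x.
  have x1 : 1 <= x by exact: ltW.
  have xx : x <= x ^+ 3 by rewrite -[leLHS]expr1; exact: ler_weXn2l.
  have x2 : x ^+ 2 <= x ^+ 3 by exact: ler_weXn2l.
  have x3 : 1 <= x ^+ 3 by exact: exprn_ege1.
  have v3 : `|df y * k| <= M * x by rewrite normrM ler_wpM2r.
  have v4 : `|d2f y / 2 * k ^+ 2| <= M / 2 * x ^+ 2.
    rewrite !normrM -expr2 (ger0_norm (_ : 0 <= 2^-1))// ler_wpM2r ?sqr_ge0//.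
    by rewrite ler_wpM2r.
  rewrite (le_trans (ler_normB _ _))// (le_trans (lerD (ler_normB _ _) (lexx _)))//.
  have := ler_normB (f (clip a' b' (y + k))) (f (clip a' b' y)).
  have w1 := ler_wpM2l M0 xx; have w2 := ler_wpM2l M0 x2; have w3 := ler_wpM2l M0 x3.
  have w4 : 0 <= L * x ^+ 3 by rewrite mulr_ge0.
  rewrite mulr1 in w3; lra.
Qed.

End cutoff.

(** * Solutions of the generator equation *)

Section generator_solution.
Context {R : realType} d (Om : measurableType d) (P : probability Om R).
Local Notation mu := (@lebesgue_measure R).
Variables (F : R -> set (set Om)) (B Y : R -> Om -> R) (V V1 : R -> R) (C x0 : R).
Hypotheses (bV : bounded_C11 C V V1) (hY : langevin_solution P F B V x0 Y).
Variables (a b : R) (ab : a < b).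

Let C0 : 0 <= C. Proof. by case: bV => _ h _ _; exact: le_trans (h 0). Qed.
Let dV x : is_derive x (1 : R) V (V1 x). Proof. by case: bV => h _ _ _. Qed.
Let cV : continuous V. Proof. exact: is_derive_continuous dV. Qed.
Let cV1 : continuous V1.
Proof. by case: bV => _ _ _ h; exact: continuous_of_lipschitz h. Qed.
Let cexp (f : R -> R) : continuous f -> continuous (fun y => expR (f y)).
Proof. by move=> cf x; apply: continuous_comp; [exact: cf|exact: continuous_expR]. Qed.
Let ceV : continuous (fun y => expR (V y)). Proof. exact: cexp. Qed.
Let ceNV : continuous (fun y => expR (- V y)).
Proof. by apply: cexp => x; apply: continuousN; exact: cV. Qed.
Let dspeed x : is_derive x (1 : R) (speed V a) (expR (- V x)).
Proof. exact: prim_is_derive. Qed.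
Let cspeed : continuous (speed V a). Proof. exact: is_derive_continuous dspeed. Qed.

Variables (u0 A kap : R).

(* The derivative of the solution; it satisfies p' = V1 p - kap. *)
Let p y := expR (V y) * (A - kap * speed V a y).
Let q y := V1 y * p y - kap.

Let dp x : is_derive x (1 : R) p (q x).
Proof.
have := dV x => ?; have := dspeed x => ?.
have e1 : is_derive x (1 : R) (fun y => expR (V y)) (V1 x * expR (V x)).
  by apply: is_derive_eq; rewrite /GRing.scale /= mulrC.
apply: is_derive_eq; rewrite /q /p /GRing.scale /= ?mul0r expRN.
by field; rewrite gt_eqF// expR_gt0.
Qed.

Let cp : continuous p. Proof. exact: is_derive_continuous dp. Qed.
Let u y := u0 + prim p a y.

Let du x : is_derive x (1 : R) u (p x).
Proof.
have h := is_deriveD (is_derive_cst u0 x (1 : R)) (prim_is_derive a cp x).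
by rewrite add0r in h.
Qed.

Let cq : continuous q.
Proof.
move=> x; apply: cvgB; last exact: cvg_cst.
by apply: cvgM; [exact: cV1|exact: cp].
Qed.

Lemma generator_solutionE x : a <= x ->
  u x = u0 + A * scale V a x - kap * scale_speed V a x.
Proof.
move=> ax; rewrite /u /scale /scale_speed !prim_ge// -addrA; congr (_ + _).
have i1 : mu.-integrable `[a, x] (fun y => (expR (V y))%:E) by exact: continuous_integrable_itv.
have i2 : mu.-integrable `[a, x] (fun y => (expR (V y) * speed V a y)%:E).
  apply: (@continuous_integrable_itv _ (fun y => expR (V y) * speed V a y)) => y.
  by apply: cvgM; [exact: ceV|exact: cspeed].
have mI : measurable `[a, x] by exact: measurable_itv.
rewrite -RintegralZl// -RintegralZl// -RintegralB//.
- by apply: eq_Rintegral => y _; rewrite /p; ring.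
- exact: integrable_scaler.
- exact: integrable_scaler.
Qed.

(** On ]a, b[ the function u0 + A * scale - kap * scale_speed solves
    u'' - V' u' = - kap. *)
Lemma generator_martingale : exists U M, [/\ continuous U, forall y, `|U y| <= M,
   forall y, a <= y <= b -> U y = u0 + A * scale V a y - kap * scale_speed V a y
  & forall t, 0 < t ->
    P.-integrable setT (fun w => (kap * stopped Y a b t w + U (Y (stopped Y a b t w) w))%:E) /\
    \int[P]_w (kap * stopped Y a b t w + U (Y (stopped Y a b t w) w)) = U x0].
Proof.
have [M1 M10 h1] := continuous_bounded_itv (a - 1) (b + 1) cp.
have [M2 M20 h2] := continuous_bounded_itv (a - 1) (b + 1) cq.
have lip x y : a - 1 <= x <= b + 1 -> a - 1 <= y <= b + 1 ->
   `|q x - q y| <= (C * M1 + C * M2) * `|x - y|.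
  move=> xI yI; have [z [_ /andP[z1 z2] e]] := mean_value dp y x.
  have zI : a - 1 <= z <= b + 1.
    move: xI yI z1 z2 => /andP[x1 x2] /andP[y1 y2]; rewrite ge_min le_max => z1 z2.
    by apply/andP; split; [case/orP: z1 => ?|case/orP: z2 => ?]; lra.
  have -> : q x - q y = (V1 x - V1 y) * p x + V1 y * (p x - p y) by rewrite /q; ring.
  have [_ _ v1 v2] := bV.
  rewrite (le_trans (ler_normD _ _))// [leRHS]mulrDl e lerD//.
    rewrite normrM [leRHS](_ : _ = (C * `|x - y|) * M1); last by ring.
    by apply: ler_pM => //; exact: h1.
  rewrite (normrM (V1 y)) (normrM (q z)) -mulrA.
  by apply: ler_pM; rewrite ?mulr_ge0// ler_wpM2r// h2.
have L0 : 0 <= C * M1 + C * M2 by rewrite addr_ge0// mulr_ge0.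
have [U [M [L' [M0 L'0 cU bU [Uu b1 b2 UT]]]]] := cutoff_exists (ltW ab) L0 du dp cq lip.
exists U, M; split => // [y yab|t t0].
  by rewrite Uu// generator_solutionE//; case/andP: yab.
apply: (dynkin_formula bV hY M0 L'0 cU bU _ _ b1 b2 UT) => //.
- exact: continuous_measurable_fun.
- exact: continuous_measurable_fun.
- by move=> y _; rewrite /q; ring.
Qed.

End generator_solution.

(** * Mean exit time and exit probability *)

Section exit_statistics.
Context {R : realType} d (Om : measurableType d) (P : probability Om R).
Local Notation mu := (@lebesgue_measure R).
Variables (F : R -> set (set Om)) (B Y : R -> Om -> R) (V V1 : R -> R) (C x0 : R).
Hypotheses (bV : bounded_C11 C V V1) (hY : langevin_solution P F B V x0 Y).
Variables (a b : R) (ax0b : a < x0 < b).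

Let hF := langevin_filtration hY.
Let aY := langevin_adapted hY.
Let cY := langevin_path hY.
Let ab : a < b. Proof. by case/andP: ax0b => /lt_trans; apply. Qed.
Let x0ab : a <= x0 <= b. Proof. by case/andP: ax0b => *; rewrite !ltW. Qed.
Local Notation tau := (exit_time Y a b).
Local Notation stop n := (stopped Y a b n.+1%:R).

Let ae_start : {ae P, forall w, Y 0 w = x0}. Proof. by case: hY. Qed.

Let alive_before r s w : tau w = r%:E -> 0 <= s -> s < r -> a < Y s w < b.
Proof.
move=> tr s0 sr; rewrite -inside_gt0.
have /(alive_exit hY _ _ _ s0) : (s%:E < tau w)%E by rewrite tr lte_fin.
by apply; rewrite s0/=.
Qed.

(** By continuity the path is in [a, b] up to the exit time, and a path that starts
    in ]a, b[ does not leave it at time 0. *)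
Lemma exit_edge r w : Y 0 w = x0 -> tau w = r%:E -> 0 <= r /\ (Y r w = a \/ Y r w = b).
Proof.
move=> y0 tr.
have [r0 ir] : 0 <= r /\ inside a b (Y r w) <= 0.
  apply: (hitting_attained cY) => //; first exact: inside_continuous.
  by rewrite -exit_setE.
split => //.
suff i0 : 0 <= inside a b (Y r w).
  have e : inside a b (Y r w) = 0 by apply/eqP; rewrite eq_le ir i0.
  move: e; rewrite /inside; have [h|h] := leP (Y r w - a) (b - Y r w) => e.
    by left; lra.
  by right; lra.
rewrite leNgt; apply/negP => iN.
move: r0; rewrite le_eqVlt => /orP[/eqP re|r0].
  by move: iN; rewrite -re y0 ltNge ltW// inside_gt0.
have iN' : 0 < - inside a b (Y r w) by rewrite oppr_gt0.
have [dl dl0 hdl] := path_continuous_comp (@inside_continuous _ a b) (cY w) (ltW r0) iN'.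
pose s := Num.max 0 (r - dl / 2).
have s0 : 0 <= s by rewrite /s le_max lexx.
have sr : s < r by rewrite /s gt_max r0/= ltrBlDr ltrDl divr_gt0.
have rs : r - dl / 2 <= s by rewrite /s le_max lexx orbT.
have sd : `|s - r| < dl by rewrite ltr0_norm ?subr_lt0//; lra.
have := hdl s s0 sd; rewrite ltr_norml => /andP[_].
have : 0 < inside a b (Y s w) by rewrite inside_gt0; exact: (alive_before tr).
by set u := inside _ _ _; set v := inside _ _ _; lra.
Qed.

Lemma stopped_eventually r w : tau w = r%:E -> \forall n \near \oo, stop n w = r.
Proof.
move=> tr; exists (Num.truncn `|r|) => // n /= hn; apply: EFin_inj.
rewrite stoppedE// tr min_l// lee_fin (le_trans (ler_norm r))//.
by rewrite (le_trans (ltW (truncnS_gt _)))// ler_nat.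
Qed.

Lemma stopped_cvg w : (stop n w)%:E @[n --> \oo] --> tau w.
Proof.
case tw : (tau w) => [r| |].
- apply: cvg_near_cst; apply: filterS (stopped_eventually tw) => n -> //.
- apply/cvgeyPge => A; exists (Num.truncn `|A|) => // n /= hn.
  rewrite stoppedE// tw /= min_r ?leey// lee_fin (le_trans (ler_norm A))//.
  by rewrite (le_trans (ltW (truncnS_gt _)))// ler_nat.
- by have := exit_time_ge0 Y a b w; rewrite tw.
Qed.

Let mstop n : measurable_fun setT (stop n).
Proof. exact: (measurable_stopped hY). Qed.

Lemma measurable_exit_time : measurable_fun setT tau.
Proof.
apply: (@emeasurable_fun_cvg _ _ _ _ (fun n w => (stop n w)%:E)) => [n|w _].
  exact/measurable_EFinP.
exact: stopped_cvg.
Qed.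

Let istop n : P.-integrable setT (fun w => (stop n w)%:E).
Proof.
apply: (@integrable_le_real _ _ _ _ _ measurableT _ (fun=> n.+1%:R)) => //.
  exact: finite_measure_integrable_cst.
by move=> w _; rewrite ger0_norm ?stopped_ge0//; exact: stopped_le.
Qed.

Lemma exit_time_integral_cvg :
  (\int[P]_w stop n w)%:E @[n --> \oo] --> (\int[P]_w tau w)%E.
Proof.
have -> : (fun n => (\int[P]_w stop n w)%:E) = (fun n => \int[P]_w (stop n w)%:E)%E.
  by apply/funext => n; rewrite /Rintegral fineK//; exact: integrable_fin_num.
have -> : (\int[P]_w tau w = \int[P]_w limn (fun n => (stop n w)%:E))%E.
  by apply: eq_integral => w _; apply/esym/cvg_lim => //; exact: stopped_cvg.
apply: (cvg_monotone_convergence measurableT (g' := fun n w => (stop n w)%:E)).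
- by move=> n; exact/measurable_EFinP.
- by move=> n w _; rewrite lee_fin stopped_ge0.
- move=> w _ n m nm /=; rewrite !stoppedE// le_min ge_min lexx/= ge_min lee_fin ler_nat ltnS nm.
  by rewrite orbT.
Qed.

Section limit.
Variables (U : R -> R) (M c : R).
Hypotheses (cU : continuous U) (UM : forall y, `|U y| <= M)
  (mart : forall t, 0 < t ->
    P.-integrable setT (fun w => (c * stopped Y a b t w + U (Y (stopped Y a b t w) w))%:E) /\
    \int[P]_w (c * stopped Y a b t w + U (Y (stopped Y a b t w) w)) = U x0).

Let mval n : measurable_fun setT (fun w => U (Y (stop n w) w)).
Proof. exact: (measurable_stopped_value hY a b cU). Qed.

Let ival n : P.-integrable setT (fun w => (U (Y (stop n w) w))%:E).
Proof.
apply: (@integrable_le_real _ _ _ _ _ measurableT _ (fun=> M)) => //.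
exact: finite_measure_integrable_cst.
Qed.

(** At the times n + 1 the expectation splits, as both terms are bounded. *)
Lemma optional_stopping n :
  c * \int[P]_w stop n w + \int[P]_w U (Y (stop n w) w) = U x0.
Proof.
have [_ <-] := mart (ltr0Sn R n).
have i1 := integrable_scaler measurableT c (istop n).
by rewrite (RintegralD measurableT i1 (ival n)) (RintegralZl _ measurableT (istop n)).
Qed.

Lemma stopped_value_integral_le n : `|\int[P]_w U (Y (stop n w) w)| <= M.
Proof.
have [] := ae_bounded_integral (P := P) (G := fun=> M) (mval n).
- exact: finite_measure_integrable_cst.
- by apply: aeW => w; exact: UM.
move=> _ h; apply: (le_trans h); have h' := probability_setT P.
by rewrite Rintegral_cst// [X in fine X]h' mulr1.
Qed.

(** Along a path with a finite exit time the stopped value is eventually the value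
    at the exit point.  The measurable function g stands for the latter. *)
Lemma exit_value_cvg (g : Om -> R) : measurable_fun setT g ->
  {ae P, forall w, exists2 r, tau w = r%:E & g w = U (Y r w)} ->
  \int[P]_w U (Y (stop n w) w) @[n --> \oo] --> \int[P]_w g w.
Proof.
move=> mg hg.
have [] := @Rdominated_cvg _ _ _ P setT (fun n w => U (Y (stop n w) w)) g (fun=> M) measurableT.
- exact: mval.
- exact: mg.
- apply: filterS hg => w [r tr ->] _; apply: cvg_near_cst.
  by apply: filterS (stopped_eventually tr) => n ->.
- exact: finite_measure_integrable_cst.
- by apply: aeW => w n _; exact: UM.
by [].
Qed.

End limit.

Lemma scale_gt0 : 0 < scale V a b.
Proof.
have [dV VC _ _] := bV.
have cV : continuous V by exact: is_derive_continuous dV.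
have ceV : continuous (fun y => expR (V y)).
  by move=> x; apply: continuous_comp; [exact: cV|exact: continuous_expR].
have C0 : 0 < expR (- C) by exact: expR_gt0.
rewrite /scale prim_ge ?(ltW ab)//.
apply: (@lt_le_trans _ _ (\int[mu]_(y in `[a, b]) expR (- C))).
  have lab : fine (mu `[a, b]) = b - a by rewrite lebesgue_measure_itv/= lte_fin ab -EFinB.
  by rewrite Rintegral_cst// lab mulr_gt0// subr_gt0.
apply: le_Rintegral => //.
- by apply: (@continuous_integrable_itv _ (fun=> expR (- C))) => x; exact: cvg_cst.
- exact: continuous_integrable_itv.
- move=> y _; rewrite ler_expR; have := VC y; rewrite ler_norml => /andP[h _]; exact: h.
Qed.

Let s0 := lt0r_neq0 scale_gt0.
Let scale_base : scale V a a = 0. Proof. exact: prim_base. Qed.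
Let scale_speed_base : scale_speed V a a = 0. Proof. exact: prim_base. Qed.
Let aab : a <= a <= b. Proof. by rewrite lexx ltW. Qed.
Let bab : a <= b <= b. Proof. by rewrite lexx ltW. Qed.

(** Take kap = 1 and boundary values 0.  The means of stopped n are bounded by
    2 M, so by monotone convergence tau is integrable, hence almost surely finite;
    then U (Y stopped) tends to U a = U b = 0. *)
Lemma exit_time_finite_and_mean : {ae P, forall w, tau w \is a fin_num} /\
  (\int[P]_w tau w = (mean_exit V a b x0)%:E)%E.
Proof.
have [U [M [cU UM Uu mart]]] := generator_martingale bV hY ab 0 (scale_speed V a b / scale V a b) 1.
have Ua : U a = 0 by rewrite Uu// scale_base scale_speed_base; ring.
have Ub : U b = 0 by rewrite Uu//; field.
have Ux : U x0 = mean_exit V a b x0 by rewrite Uu// /mean_exit; ring.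
have OS n : \int[P]_w stop n w = U x0 - \int[P]_w U (Y (stop n w) w).
  by rewrite -(optional_stopping cU UM mart n); ring.
have fin : {ae P, forall w, tau w \is a fin_num}.
  have it : P.-integrable setT tau.
    apply/integrableP; split; first exact: measurable_exit_time.
    rewrite (eq_integral tau); last by move=> w _; rewrite gee0_abs// exit_time_ge0.
    apply: (@le_lt_trans _ _ (M + M)%:E); last by rewrite ltry.
    have ce := exit_time_integral_cvg.
    rewrite -(cvg_lim (@ereal_hausdorff R) ce); apply: lime_le; first by apply/cvg_ex; eexists; exact: ce.
    near=> n; rewrite lee_fin OS; have := UM x0.
    have := stopped_value_integral_le cU UM n.
    by rewrite !ler_norml => /andP[h1 h2] /andP[h3 h4]; lra.
  by apply: filterS (integrable_ae measurableT it) => w; apply.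
split => //.
have val0 : \int[P]_w U (Y (stop n w) w) @[n --> \oo] --> (0 : R).
  have -> : (0 : R) = \int[P]_w (0 : R) by rewrite Rintegral_cst// mul0r.
  apply: exit_value_cvg => //.
  apply: filterS2 fin ae_start => w + y0; case tr : (tau w) => [r| |]// _; exists r => //.
  by have [_ [->|->]] := exit_edge y0 tr.
have c1 : (\int[P]_w stop n w)%:E @[n --> \oo] --> (mean_exit V a b x0)%:E.
  apply/cvg_EFin; first by near=> n.
  rewrite (_ : _ \o _ = (fun n => U x0 - \int[P]_w U (Y (stop n w) w))); last first.
    by apply/funext => n /=; exact: OS.
  by rewrite -Ux -[X in _ --> X]subr0; apply: cvgB => //; exact: cvg_cst.
exact: (cvg_unique _ exit_time_integral_cvg c1).
Unshelve. all: by end_near. Qed.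

Let pointE (x : R) : [set x] = [set y | (`|y - x| <= 0)%R].
Proof. by apply/seteqP; split => y /=; rewrite normr_le0 subr_eq0 => /eqP. Qed.

Let dist_continuous (x : R) : continuous (fun y => `|y - x|).
Proof.
apply: (@continuous_of_lipschitz _ _ 1) => u v; rewrite mul1r.
have -> : u - v = (u - x) - (v - x) by ring.
exact: ler_dist_dist.
Qed.

Let point_attained x r w : hitting_time Y [set x] w = r%:E -> Y r w = x.
Proof.
rewrite pointE => /(hitting_attained cY (dist_continuous (x := x)))[_].
by rewrite normr_le0 subr_eq0 => /eqP.
Qed.

Let hit_exit x w : x = a \/ x = b -> (tau w <= hitting_time Y [set x] w)%E.
Proof.
move=> hx; apply: ereal_inf_le_tmp => _ [t [t0 /= yt] <-]; exists t => //; split => //.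
by case: hx => hx; [left|right]; rewrite /= in_itv/= yt hx lexx.
Qed.

Let hit_le x r w : 0 <= r -> Y r w = x -> (hitting_time Y [set x] w <= r%:E)%E.
Proof. by move=> r0 yr; apply: ereal_inf_lbound; exists r. Qed.

(** Take kap = 0 and the boundary values 1 at a, 0 at b: then U (Y tau) is the
    indicator function of the event that a is hit first. *)
Lemma exit_left_probability :
  P [set w | (hitting_time Y [set a] w < hitting_time Y [set b] w)%E] =
  (exit_left V a b x0)%:E.
Proof.
set E := [set w | _].
have mE : measurable E.
  rewrite /E !pointE; exact: (measurable_hitting_lt hF aY cY (@dist_continuous a) (@dist_continuous b)).
have [U [M [cU UM Uu mart]]] := generator_martingale bV hY ab 1 (- (scale V a b)^-1) 0.
have Ua : U a = 1 by rewrite Uu// scale_base; ring.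
have Ub : U b = 0 by rewrite Uu//; field.
have Ux : U x0 = exit_left V a b x0 by rewrite Uu// /exit_left; ring.
have val : \int[P]_w U (Y (stop n w) w) @[n --> \oo] --> \int[P]_w \1_E w.
  apply: (exit_value_cvg cU UM); first exact: measurable_indic.
  have [fin _] := exit_time_finite_and_mean.
  apply: filterS2 fin ae_start => w + y0; case tr : (tau w) => [r| |]// _; exists r => //.
  have [r0 [yr|yr]] := exit_edge y0 tr; rewrite yr ?Ua ?Ub indicE.
    rewrite mem_set// /E /=; apply: (le_lt_trans (hit_le r0 yr)).
    rewrite lt_neqAle -tr hit_exit ?andbT; last by right.
    apply/eqP => e; have := point_attained (esym (etrans (esym tr) e)).
    by rewrite yr => e'; move: ab; rewrite e' ltxx.
  rewrite memNset// /E /= => h; have := lt_le_trans h (hit_le r0 yr).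
  by rewrite ltNge -tr hit_exit//; left.
have cst0 : \int[P]_w U (Y (stop n w) w) @[n --> \oo] --> exit_left V a b x0.
  apply: cvg_near_cst; near=> n; have := optional_stopping cU UM mart n.
  by rewrite mul0r add0r Ux.
have <- := cvg_unique _ val cst0.
rewrite /Rintegral integral_indic// setIT fineK//; exact: fin_num_measure.
Unshelve. all: by end_near. Qed.

End exit_statistics.

(** * The asymptotic equivalences *)

(** The limits above are along sequences of gamma bounded below by 1, and a limit at
    +oo may be tested along such sequences. *)
Lemma asymp_equiv_sequences {R : realType} (f : R -> \bar R) (r h : R -> R) :
  (forall g, 1 <= g -> f g = (r g)%:E) -> (forall g, 1 <= g -> h g != 0) ->
  (forall u : nat -> R, (forall n, 1 <= u n) -> u n @[n --> \oo] --> +oo ->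
     r (u n) / h (u n) @[n --> \oo] --> (1 : R)) ->
  asymp_equiv f h.
Proof.
move=> fr h0 H; rewrite /asymp_equiv.
have n1 : \forall g \near +oo, 1 <= (g : R) by exact: nbhs_pinfty_ge.
have e g : 1 <= g -> (f g / (h g)%:E)%E = (r g / h g)%:E.
  by move=> g1; rewrite fr// inver (negbTE (h0 _ g1)).
apply: cvg_EFin; first by apply: filterS n1 => g g1; rewrite e.
apply/cvg_pinftyP => u uy.
pose v n := Num.max 1 (u n).
have uv : \forall n \near \oo, v n = u n.
  have /cvgryPge/(_ 1) := uy; apply: filterS => n un.
  by rewrite /v max_r.
have vy : v n @[n --> \oo] --> +oo.
  by apply/cvgryPge => A; have /cvgryPge/(_ A) := uy; apply: filterS => n un; rewrite le_max un orbT.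
have v1 n : 1 <= v n by rewrite le_max lexx.
apply: cvg_trans (H v v1 vy); apply: near_eq_cvg.
by apply: filterS uv => n e'; rewrite /= -e' e.
Qed.

Theorem proposition4p1 (R : realType)
  (w : R -> R) (s_w : R) (hA : assumption_A w s_w)
  (r_w : R) (hr_w : 0 < r_w <= s_w) (hC3 : Cn_on 3 `[- r_w, r_w] w)
  (delta_w tau : R) (hdelta_w : 0 < delta_w < s_w) (htau : 0 < tau)
  (hslope : forall z, delta_w <= z <= s_w -> w z <= tau * (z - s_w))
  (K : nat) (hK : (3 <= K)%N) (ell : R) (hell : 0 < ell)
  (j : nat) (hj : (2 <= j <= K.-1)%N)
  (X m : nat -> R)
  (hX : forall k, (1 <= k < K)%N -> X k < X k.+1)
  (hm : forall k, (1 <= k <= K)%N -> 0 < m k < 1)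
  (hsum : \sum_(1 <= k < K.+1) m k = 1)
  (hgap : forall k, (1 <= k < K)%N -> 2 * s_w * ell < X k.+1 - X k)
  (alpha : R) (halpha : 0 < alpha < s_w)
  (hmass : `|w alpha| / - inf (range w)
             < Num.min (m j / m j.-1) (m j / m j.+1))
  (x0 : R) (hx0 : X j - s_w * ell < x0 < X j + s_w * ell)
  (d : R -> measure_display) (Omega : forall gamma, measurableType (d gamma))
  (P : forall gamma, probability (Omega gamma) R)
  (F : forall gamma, R -> set (set (Omega gamma)))
  (B Y : forall gamma, R -> Omega gamma -> R)
  (hY : forall gamma, 0 < gamma ->
     langevin_solution (P gamma) (F gamma) (B gamma)
       (V_eff w ell K X m gamma) x0 (Y gamma)) :
  let Delta := - inf (range w) in
  let a := X j.-1 + alpha * ell in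
  let b := X j.+1 - alpha * ell in
  asymp_equiv
    (fun gamma =>
       \int[P gamma]_omega
         hitting_time (Y gamma) (`]-oo, a] `|` `[b, +oo[) omega)%E
    (fun gamma =>
       (X j.+1 - X j - 2 * s_w * ell) * (X j - X j.-1 - 2 * s_w * ell)
         / (X j.+1 - X j.-1 - 4 * s_w * ell)
       * Num.sqrt (2 * pi * ell / (gamma * w^`(2)%classic 0 * m j))
       * expR (gamma * ell * Delta * m j - 1 / 2))
  /\
  asymp_equiv
    (fun gamma =>
       P gamma [set omega | (hitting_time (Y gamma) [set a] omega
                              < hitting_time (Y gamma) [set b] omega)%E])
    (fun=> (X j.+1 - X j - 2 * s_w * ell)
             / (X j.+1 - X j.-1 - 4 * s_w * ell)).
Proof.
move=> Delta a b.
have s0 : 0 < s_w by case/andP: hr_w => /lt_le_trans; apply.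
have [al0 als] := andP halpha.
have [L cw] := assumption_A_clump_well s0 hA.
have m0 i : (1 <= i < K.+1)%N -> 0 < m i by rewrite ltnS => /hm /andP[].
have DE : Delta = - w 0 by rewrite /Delta (inf_range_min (cw_min cw)).
have D0 : 0 < - w 0 by rewrite oppr_gt0; exact: cw_w0 cw.
have mj0 := m0 _ (index_mid hj).
have [massl massr] : `|w alpha| * m j.-1 < - w 0 * m j /\ `|w alpha| * m j.+1 < - w 0 * m j.
  move: hmass; rewrite -/Delta DE lt_min => /andP[].
  have ml0 := m0 _ (index_left hj); have mr0 := m0 _ (index_right hj).
  by rewrite !ltr_pdivrMr// ![_ / _ * - w 0]mulrAC !ltr_pdivlMr// ![m j * _]mulrC.
have Lg0 : 0 < Lgap s_w ell j X by exact: Lgap_gt0 hj hgap.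
have Rg0 : 0 < Rgap s_w ell j X by exact: Rgap_gt0 hj hgap.
have LR : X j.+1 - X j.-1 - 4 * s_w * ell = Lgap s_w ell j X + Rgap s_w ell j X.
  by rewrite /Lgap /Rgap; ring.
have LR0 : 0 < Lgap s_w ell j X + Rgap s_w ell j X by rewrite addr_gt0.
have ax0b : a < x0 < b.
  have gl := gap_left hj hgap; have gr := gap_right hj hgap.
  have h : alpha * ell < s_w * ell by rewrite ltr_pM2r.
  by move: hx0 => /andP[h1 h2]; rewrite /a /b; apply/andP; split; lra.
rewrite LR -/(Rgap s_w ell j X) -/(Lgap s_w ell j X) DE.
have law g : 1 <= g -> exists C V1, bounded_C11 C (V_eff w ell K X m g) V1.
  by move=> g1; apply: (V_eff_C11 cw erefl X hell (lt_le_trans ltr01 g1) m0).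
have g0 (g : R) : 1 <= g -> 0 < g by exact: lt_le_trans.
split.
- apply: (@asymp_equiv_sequences _ _ (fun g => mean_exit (V_eff w ell K X m g) a b x0)).
  + move=> g g1; have [C [V1 bV]] := law g g1.
    by have [_ <-] := exit_time_finite_and_mean bV (hY _ (g0 _ g1)) ax0b.
  + move=> g g1; rewrite -mulrA mulf_neq0//.
      by rewrite gt_eqF// divr_gt0// mulr_gt0.
    by rewrite -(kramers_constE cw erefl hell m0 hj (gam := fun=> g) (fun=> g1) 0)
      gt_eqF// (kramers_const_gt0 cw erefl hell m0 hj).
  + move=> u u1 uy.
    have c0 : Rgap s_w ell j X * Lgap s_w ell j X / (Lgap s_w ell j X + Rgap s_w ell j X) != 0.
      by rewrite gt_eqF// divr_gt0// mulr_gt0.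
    have := mean_exit_cvg cw erefl hell m0 hj al0 als hgap u1 uy massl massr hx0.
    set cst := (X in _ --> X) in c0 * => lim; rewrite -/cst.
    rewrite (_ : (fun n => _) = (fun n => mean_exit (V_eff w ell K X m (u n)) a b x0 /
      kramers_const w (w^`(2)%classic 0) ell j m u n * cst^-1)); last first.
      apply/funext => n; rewrite (kramers_constE cw erefl hell m0 hj u1 n).
      rewrite -/cst; set z := Num.sqrt _; set e := expR _; set A := mean_exit _ _ _ _.
      by rewrite !invfM; ring.
    by rewrite -[X in _ --> X](mulfV c0); apply: cvgM; [exact: lim|exact: cvg_cst].
- apply: (@asymp_equiv_sequences _ _ (fun g => exit_left (V_eff w ell K X m g) a b x0)).
  + move=> g g1; have [C [V1 bV]] := law g g1.
    by rewrite (exit_left_probability bV (hY _ (g0 _ g1)) ax0b).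
  + by move=> g _; rewrite gt_eqF// divr_gt0.
  + move=> u u1 uy.
    have c0 : Rgap s_w ell j X / (Lgap s_w ell j X + Rgap s_w ell j X) != 0.
      by rewrite gt_eqF// divr_gt0.
    rewrite -[X in _ --> X](mulfV c0); apply: cvgM; last exact: cvg_cst.
    exact: (exit_left_cvg cw erefl hell m0 hj al0 als hgap u1 uy hx0).
Qed.
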